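(* Let $\mathbb{G}$ be a homogeneous Lie group of homogeneous dimension $Q$, $|\cdot|$ any homogeneous quasi-norm, $R>0$, $B(0,R)=\{x\in\mathbb{G}:|x|<R\}$, $1<p<\infty$, $\alpha,\beta\in\mathbb{R}$, and $L(x)=\log\frac{R}{|x|}$. (i) If $(Q-\alpha-p)(\beta+p)\ge0$, then for all complex-valued $f\in C_0^\infty(B(0,R)\setminus\{0\})$, $$\left|\frac{\beta+p}{p}\right|^p\int_{B(0,R)}\frac{|f|^p}{|x|^{\alpha+p}L^{\beta+p+1}}dx\le\int_{B(0,R)}\frac{|\mathcal{R}_{|x|}f|^p}{|x|^{\alpha}L^{\beta+1}}dx,$$ and when $\beta\neq-p$ the constant $\left|\frac{\beta+p}{p}\right|^p$ is sharp. (ii) For all complex-valued $f\in C_0^\infty(B(0,R)\setminus\{0\})$, $$\left|\frac{\beta+p}{p}\right|^p\int_{B(0,R)}\frac{|f|^p}{|x|^{\alpha+p}L^{\beta+p+1}}dx=\int_{B(0,R)}\frac{|\mathcal{R}_{|x|}f|^p}{|x|^{\alpha}L^{\beta+1}}dx-(Q-\alpha-p)\frac{\beta+p}{p}\left|\frac{\beta+p}{p}\right|^{p-2}\int_{B(0,R)}\frac{|f|^p}{|x|^{\alpha+p}L^{\beta+p}}dx-\int_{B(0,R)}C_p(\xi,\eta)dx,$$ where $\xi=\dfrac{\mathcal{R}_{|x|}f}{|x|^{\alpha/p}L^{(\beta+1)/p}}$ and $\eta=\xi+\dfrac{\beta+p}{p}\dfrac{f}{|x|^{(\alpha+p)/p}L^{(\beta+p+1)/p}}$.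 (iii) If $Q=\alpha+p$ and $p\ge2$, then $\int_{B(0,R)}C_p(\xi,\eta)dx$ vanishes only if $f=L^{(\beta+p)/p}\varphi(x/|x|)$ for some $\varphi:\mathfrak{S}\to\mathbb{C}$, which for $f\in C_0^\infty(B(0,R)\setminus\{0\})$ forces $f=0$; hence the inequality in (i) is strict for every nonzero such $f$.
   Context: A homogeneous Lie group is a connected simply connected (nilpotent) Lie group $\mathbb{G}$, identified with $\mathbb{R}^n$, whose Lie algebra carries dilations $D_\lambda=\exp(A\ln\lambda)$ with $A$ diagonalisable with positive eigenvalues and each $D_\lambda$ a Lie algebra automorphism, inducing dilations $x\mapsto\lambda x$ on $\mathbb{G}$; $Q=\operatorname{Tr}A$ and the Haar (Lebesgue) measure satisfies $\int f(\lambda x)dx=\lambda^{-Q}\int f dx$. A homogeneous quasi-norm is a continuous $|\cdot|:\mathbb{G}\to[0,\infty)$ with $|x^{-1}|=|x|$, $|\lambda x|=\lambda|x|$, $|x|=0$ iff $x=0$. $\mathfrak{S}=\{|x|=1\}$ and there is a Borel measure $\sigma$ on $\mathfrak{S}$ with $\int_{\mathbb{G}}f\,dx=\int_0^\infty\int_{\mathfrak{S}}f(ry)r^{Q-1}d\sigma(y)dr$. The radial derivative is $\mathcal{R}_{|x|}f(x)=\frac{d}{dr}f(ry)$ at $r=|x|$, $y=x/|x|$. For complex $\xi,\eta$, $C_p(\xi,\eta):=|\xi|^p-|\xi-\eta|^p-p|\xi-\eta|^{p-2}\operatorname{Re}((\xi-\eta)\overline{\eta})$ (last term $0$ when $\xi=\eta$).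 *)

(* Defs.v *)
(* mathcomp-analysis (R : realType), complex values in R[i]
   (mathcomp-real-closed's complex). *)
From HB Require Import structures.
From mathcomp Require Import all_boot all_order all_algebra.
From mathcomp Require Import all_classical all_reals all_analysis.
From mathcomp Require Import complex.
Import Order.TTheory GRing.Theory Num.Theory.
Import numFieldNormedType.Exports.
Set Implicit Arguments. Unset Strict Implicit. Unset Printing Implicit Defensive.
Local Open Scope ring_scope.
Local Open Scope classical_set_scope.

(* The underlying space R^n of the homogeneous group (exponential coordinates
   in a basis of eigenvectors of the dilation generator A).                 *)
Definition Rn (R : realType) (n : nat) := 'rV[R]_n.
HB.instance Definition _ (R : realType) (n : nat) :=
  NormedModule.copy (Rn R n) ('rV[R]_n : normedModType R).

Definition coor (R : realType) n (i : 'I_n) (x : Rn R n) : R := x ord0 i.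

(* Borel sigma-algebra of R^n: generated by the coordinate functions. *)
Section RnMeasurable.
Variables (R : realType) (n : nat).
Let s0 : g_sigma_preimage (@coor R n) set0. Proof. exact: sigma_algebra0. Qed.
Let sC A : g_sigma_preimage (@coor R n) A -> g_sigma_preimage (@coor R n) (~` A).
Proof. exact: sigma_algebraC. Qed.
Let sU (F : _^nat) : (forall i, g_sigma_preimage (@coor R n) (F i)) ->
  g_sigma_preimage (@coor R n) (\bigcup_i (F i)).
Proof. exact: sigma_algebra_bigcup. Qed.
HB.instance Definition _ :=
  @isMeasurable.Build (measure_tuple_display default_measure_display)
  (Rn R n) (g_sigma_preimage (@coor R n)) s0 sC sU.
End RnMeasurable.

(* Lebesgue measure on R^n: the (unique) measure on the Borel sets giving
   every half-open box its volume. *)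
Definition is_lebesgue_measure (R : realType) (n : nat)
    (mu : {measure set (Rn R n) -> \bar R}) : Prop :=
  forall a b : Rn R n, (forall i, coor i a <= coor i b) ->
    mu [set x | forall i, coor i a <= coor i x < coor i b] =
    (\prod_(i < n) (coor i b - coor i a))%:E.

(* Dilations: D_lambda = exp(A ln lambda) with A = diag(nu_1,...,nu_n). *)
Definition dil (R : realType) n (nu : 'I_n -> R) (r : R) (x : Rn R n) : Rn R n :=
  \row_i (r `^ nu i * x ord0 i).

(* homogeneous dimension Q = Tr A *)
Definition hdim (R : realType) n (nu : 'I_n -> R) : R := \sum_(i < n) nu i.

(* each coordinate of the group law is a polynomial in (x, y) *)
Definition polynomial_law (R : realType) n (mul : Rn R n -> Rn R n -> Rn R n) :=
  forall k : 'I_n, exists s : seq (R * ('I_n -> nat) * ('I_n -> nat)),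
    forall x y : Rn R n, mul x y ord0 k =
      \sum_(t <- s) (t.1.1 * \prod_(i < n) x ord0 i ^+ t.1.2 i
                           * \prod_(i < n) y ord0 i ^+ t.2 i).

(* A homogeneous (Lie) group structure on R^n (exponential coordinates):
   polynomial group law with identity 0 and inverse x |-> -x, for which the
   dilations (positive weights nu_i) are group automorphisms. *)
Definition homogeneous_group (R : realType) n (nu : 'I_n -> R)
    (mul : Rn R n -> Rn R n -> Rn R n) : Prop :=
  [/\ (forall i, 0 < nu i),
      polynomial_law mul,
      (forall x y z, mul x (mul y z) = mul (mul x y) z),
      (forall x, mul 0 x = x /\ mul x 0 = x) &
      (forall x, mul x (- x) = 0 /\ mul (- x) x = 0)] /\
  (forall r x y, 0 < r -> dil nu r (mul x y) = mul (dil nu r x) (dil nu r y)).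

(* homogeneous quasi-norm (x^{-1} = -x in exponential coordinates) *)
Definition quasi_norm (R : realType) n (nu : 'I_n -> R) (qn : Rn R n -> R) :=
  [/\ continuous qn,
      forall x, 0 <= qn x,
      forall x, qn (- x) = qn x,
      forall r x, 0 < r -> qn (dil nu r x) = r * qn x &
      forall x, qn x = 0 <-> x = 0].

(* Smoothness: all partial derivatives of all orders exist and are continuous *)
Definition evec (R : realType) n (i : 'I_n) : Rn R n := delta_mx ord0 i.

Fixpoint dpart (R : realType) n (f : Rn R n -> R) (s : seq 'I_n) : Rn R n -> R :=
  match s with
  | [::] => f
  | i :: s' => fun x => 'D_(evec R i) (dpart f s') x
  end.

Definition smooth (R : realType) n (f : Rn R n -> R) : Prop :=
  forall s : seq 'I_n, continuous (dpart f s) /\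
    forall (i : 'I_n) (x : Rn R n), derivable (dpart f s) x (evec R i).

(* modulus of a complex number *)
Definition cabs (R : realType) (z : R[i]) : R :=
  Num.sqrt (complex.Re z ^+ 2 + complex.Im z ^+ 2).

(* f in C_0^infty(B(0,R0) \ {0}), complex valued *)
Definition C0inf_punct (R : realType) n (qn : Rn R n -> R) (R0 : R)
    (f : Rn R n -> R[i]) : Prop :=
  smooth (fun x => complex.Re (f x)) /\ smooth (fun x => complex.Im (f x)) /\
  exists K : set (Rn R n), [/\ compact K,
    K `<=` [set x | qn x < R0] `\ 0 &
    forall x, ~ K x -> f x = 0].

(* radial derivative R_{|x|} f(x) = d/dr f(r y) at r = |x|, y = x/|x| *)
Definition radderiv (R : realType) n (nu : 'I_n -> R) (qn : Rn R n -> R)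
    (f : Rn R n -> R[i]) (x : Rn R n) : R[i] :=
  let y := dil nu (qn x)^-1 x in
  Complex (derive1 (fun r => complex.Re (f (dil nu r y))) (qn x))
          (derive1 (fun r => complex.Im (f (dil nu r y))) (qn x)).

(* C_p(xi, eta) *)
Definition Cp (R : realType) (p : R) (xi eta : R[i]) : R :=
  cabs xi `^ p - cabs (xi - eta) `^ p -
  (if xi == eta then 0
   else p * cabs (xi - eta) `^ (p - 2) * complex.Re ((xi - eta) * eta^*)).

(* The quantities appearing in the theorem. *)
Section Quantities.
Variables (R : realType) (n : nat) (nu : 'I_n -> R) (qn : Rn R n -> R)
  (mu : {measure set (Rn R n) -> \bar R}) (R0 p alpha beta : R).

Definition qball : set (Rn R n) := [set x | qn x < R0].
Definition Lw (x : Rn R n) : R := ln (R0 / qn x).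

(* int_B |f|^p / (|x|^(alpha+p) L^(beta+p+1)) *)
Definition I_f (f : Rn R n -> R[i]) : R :=
  Rintegral mu qball (fun x =>
    cabs (f x) `^ p / (qn x `^ (alpha + p) * Lw x `^ (beta + p + 1))).

(* int_B |R f|^p / (|x|^alpha L^(beta+1)) *)
Definition I_Rf (f : Rn R n -> R[i]) : R :=
  Rintegral mu qball (fun x =>
    cabs (radderiv nu qn f x) `^ p / (qn x `^ alpha * Lw x `^ (beta + 1))).

(* int_B |f|^p / (|x|^(alpha+p) L^(beta+p)) *)
Definition I_f' (f : Rn R n -> R[i]) : R :=
  Rintegral mu qball (fun x =>
    cabs (f x) `^ p / (qn x `^ (alpha + p) * Lw x `^ (beta + p))).

Definition xi_f (f : Rn R n -> R[i]) (x : Rn R n) : R[i] :=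
  radderiv nu qn f x / real_complex R (qn x `^ (alpha / p) * Lw x `^ ((beta + 1) / p)).

Definition eta_f (f : Rn R n -> R[i]) (x : Rn R n) : R[i] :=
  xi_f f x + real_complex R ((beta + p) / p) * f x /
    real_complex R (qn x `^ ((alpha + p) / p) * Lw x `^ ((beta + p + 1) / p)).

Definition I_Cp (f : Rn R n -> R[i]) : R :=
  Rintegral mu qball (fun x => Cp p (xi_f f x) (eta_f f x)).

End Quantities.

(* Main.v *)
Require Import Defs.
From HB Require Import structures.
From mathcomp Require Import all_boot all_order all_algebra.
From mathcomp Require Import all_classical all_reals all_analysis.
From mathcomp Require Import complex measurable_realfun ring lra.
Import Order.TTheory GRing.Theory Num.Theory.
Import numFieldNormedType.Exports.
Set Implicit Arguments. Unset Strict Implicit. Unset Printing Implicit Defensive.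
Local Open Scope ring_scope.
Local Open Scope classical_set_scope.

(** Lebesgue measure is scaled by r^Q under the dilations; differentiating the
    scaling law at r = 1 gives [int E h = - Q int h] for the Euler field
    [E = |x| R_{|x|}].  No polar decomposition is needed, and only the radial
    regularity of h matters, so h may involve the merely continuous quasi-norm.
    Taking [h = |f|^p |x|^(-alpha-p) L^(-beta-p)] and expanding C_p pointwise
    yields (ii).  As C_p >= 0 by Young's inequality, (i) follows; if C_p = 0
    almost everywhere then eta vanishes, [f L^(-(beta+p)/p)] is constant on
    rays, and compactness of the support forces f = 0.

    For sharpness, fix a coordinate direction e_i and blow up at the boundary
    point of the ball on its axis, with test functions that are products of
    one-variable functions of the rescaled coordinates z.  With y = - z_i the
    log weight L becomes y / nu_i in the limit, and the inequality becomes the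
    Hardy inequality [C int |F|^p y^(-beta-p-1) <= int |d_i F|^p y^(-beta-1)].
    It is tested on [y^((beta+p)/p)] times a plateau equal to 1 on [2, 2^N]:
    all dyadic shells have the same mass for dz / y, hence the N - 1 shells of
    the plateau dominate the two transition shells as N grows. *)

(** * Lebesgue measure on R^n *)

(** The quasi-norm is only continuous, and this shapes both halves. For the identity, every
    derivative is taken along dilation orbits, on which [qn] is linear in the parameter and L has
    Euler derivative -1. Since p > 1, |f|^p is differentiable along orbits even at zeros of f. The
    support of f stays away from 0 and from the sphere |x| = R, so the weights are bounded on it.

    For sharpness, the test functions concentrate at |x| = R, where every power of |x| tends to a
    constant; hence alpha leaves the limit problem. The axial scale s is that of L itself.
    Transversally no modulus of continuity of [qn] is available, so the transverse scale eps is
    picked after s, small enough to move ln |x| by at most s^2. This costs nothing: the Euler field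
    multiplies a transverse derivative, of size 1/eps, by a coordinate of size eps, while the axial
    term has size 1/s and dominates. The exponent (beta+p)/p is the one at which the powers of y in
    both limit densities collapse to 1/y. *)

Section LebesgueRn.
Context {R : realType} {n : nat}.
Implicit Types (a b x : Rn R n) (mu : {measure set (Rn R n) -> \bar R}).

Definition hobox a b : set (Rn R n) :=
  [set x | forall i, coor i a <= coor i x < coor i b].

Lemma measurable_coor i : measurable_fun [set: Rn R n] (@coor R n i).
Proof.
move=> _ Y mY; apply: sub_sigma_algebra => /=.
rewrite -bigcup_seq/=; exists i => /=; first by rewrite mem_index_enum.
by exists Y.
Qed.

Lemma measurable_fun_coorP d (T : measurableType d) (f : T -> Rn R n) :
  (forall i, measurable_fun [set: T] (@coor R n i \o f)) ->
  measurable_fun [set: T] f.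
Proof.
move=> mf; apply: (measurability
  (\big[setU/set0]_(i < n) preimage_set_system setT (@coor R n i) measurable)).
  by [].
move=> _ [B + <-]; rewrite -bigcup_seq/= => -[i _ [C mC <-]].
by rewrite [setT `&` _ in X in measurable X]setTI; exact: mf.
Qed.

Lemma hoboxE a b :
  hobox a b = \bigcap_(i in [set: 'I_n]) (coor i @^-1` `[coor i a, coor i b[).
Proof.
apply/seteqP; split => x /=; first by move=> h i _ /=; rewrite in_itv/= h.
by move=> h i; have /= := h i I; rewrite in_itv.
Qed.

Lemma measurable_hobox a b : measurable (hobox a b).
Proof.
rewrite hoboxE; apply: fin_bigcap_measurable => // i _.
by rewrite -[X in measurable X]setTI; apply: measurable_coor.
Qed.

Lemma hobox_setI a b a' b' : hobox a b `&` hobox a' b' =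
  hobox (\row_i Num.max (coor i a) (coor i a'))
        (\row_i Num.min (coor i b) (coor i b')).
Proof.
apply/seteqP; split => x /=.
  move=> [h1 h2] i; rewrite /coor !mxE ge_max lt_min.
  by have /andP[-> ->] := h1 i; have /andP[-> ->] := h2 i.
move=> h; split => i; have := h i; rewrite /coor !mxE ge_max lt_min;
  by case/andP => /andP[? ?] /andP[? ?]; apply/andP.
Qed.

Definition symbox (k : nat) : set (Rn R n) :=
  hobox (\row_i - k%:R) (\row_i k%:R).

Lemma norm_coor i x : `|coor i x| <= `|x|.
Proof.
rewrite /coor (_ : `|x| = mx_norm x)// mx_normrE.
exact: (le_bigmax _ (fun ij : 'I_1 * 'I_n => `|x ij.1 ij.2|) (ord0, i)).
Qed.

Lemma symbox_norm x k : `|x| < k%:R -> symbox k x.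
Proof.
move=> xk i; have := le_lt_trans (norm_coor i x) xk.
by rewrite ltr_norml /coor !mxE => /andP[/ltW -> ->].
Qed.

Lemma bigcup_symbox : \bigcup_k symbox k = setT.
Proof.
apply/seteqP; split => // x _.
by exists (Num.truncn `|x|).+1 => //; apply: symbox_norm; exact: truncnS_gt.
Qed.

Definition hoboxes : set (set (Rn R n)) := [set A | exists a b, A = hobox a b].

Lemma measurable_RnE : @measurable _ (Rn R n) = <<s hoboxes >>.
Proof.
apply/seteqP; split; last first.
  apply: smallest_sub; first exact: sigma_algebra_measurable.
  by move=> _ [a [b ->]]; exact: measurable_hobox.
apply: smallest_sub; first exact: smallest_sigma_algebra.
move=> A; rewrite -bigcup_seq/= => -[i _ [C mC <-]].
have ms : measurable_fun [set: g_sigma_algebraType hoboxes]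
    (@coor R n i : g_sigma_algebraType hoboxes -> R).
  apply: (measurability _ (RGenCInfty.measurableE R)).
  move=> _ [_ [x ->] <-]; rewrite setTI.
  (* A closed half-space is the union of boxes with i-th side [x, k) and all other sides [-k, k). *)
  rewrite [X in measurable X](_ : _ = \bigcup_k (hobox
    (\row_j if j == i then x else - k%:R) (\row_j k%:R))).
    apply: bigcupT_measurable => k; apply: sub_sigma_algebra.
    by exists (\row_j if j == i then x else - k%:R), (\row_j k%:R).
  apply/seteqP; split => y /=.
    rewrite in_itv/= andbT => xy.
    exists (Num.truncn `|y|).+1 => //.
    have := symbox_norm (truncnS_gt `|y|) => h j.
    have := h j; rewrite /coor !mxE; case: eqP => // ->.
    by move=> /andP[_ ->]; rewrite andbT.
  move=> [k _ /(_ i)]; rewrite /coor !mxE eqxx => /andP[h _].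
  by rewrite in_itv/= andbT.
exact: ms.
Qed.

Lemma lebesgue_hobox mu a b : is_lebesgue_measure mu ->
  (forall i, coor i a <= coor i b) ->
  mu (hobox a b) = (\prod_(i < n) (coor i b - coor i a))%:E.
Proof. by move=> h; exact: h. Qed.

Lemma hobox_eq0 a b : ~ (forall i, coor i a <= coor i b) -> hobox a b = set0.
Proof.
move=> /existsNP[i /negP]; rewrite -ltNge => ba.
by apply/seteqP; split => // x /(_ i) /andP[h1 h2]; lra.
Qed.

Lemma lebesgue_symbox_lty mu k : is_lebesgue_measure mu -> (mu (symbox k) < +oo)%E.
Proof.
move=> h; rewrite lebesgue_hobox// ?ltry// => i.
by rewrite /coor !mxE; have := ler0n R k; lra.
Qed.

(** Boxes form a pi-system generating the measurable sets, and the boxes [symbox k], of finite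
    measure, exhaust the space. A change of variables therefore needs checking on boxes only. *)
Lemma lebesgue_unique mu (m : {measure set (Rn R n) -> \bar R}) :
  is_lebesgue_measure mu -> is_lebesgue_measure m ->
  forall A, measurable A -> mu A = m A.
Proof.
move=> h1 h2; apply: (measure_unique hoboxes symbox).
- exact: measurable_RnE.
- move=> _ _ [a [b ->]] [a' [b' ->]]; rewrite hobox_setI.
  by eexists; eexists.
- by move=> k; eexists; eexists.
- exact: bigcup_symbox.
- move=> _ [a [b ->]].
  have [ab|ab] := pselect (forall i, coor i a <= coor i b).
    by rewrite !lebesgue_hobox.
  by rewrite hobox_eq0// !measure0.
- by move=> k; exact: lebesgue_symbox_lty.
Qed.

(** Measurability is defined through coordinates and has to be linked to the topology: an open set
    is the union of the countably many rational boxes that it contains. *)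
Lemma open_measurable_Rn (U : set (Rn R n)) : open U -> measurable U.
Proof.
move=> oU.
pose box (q : 'rV[rat]_n * 'rV[rat]_n) : set (Rn R n) :=
  hobox (\row_i ratr (q.1 ord0 i)) (\row_i ratr (q.2 ord0 i)).
pose F q := if `[< box q `<=` U >] then box q else set0.
rewrite (_ : U = \bigcup_q F q).
  apply: countable_bigcupT_measurable => // q.
  by rewrite /F; case: ifPn => // _; exact: measurable_hobox.
apply/seteqP; split => [x Ux|x [q _]]; last first.
  by rewrite /F; case: ifPn => // /asboolP; exact.
have /nbhs_ballP[e /= e0 eU] : nbhs x U by rewrite nbhsE; exists U.
have hl i : exists q : rat, ratr q \in `]x ord0 i - e, x ord0 i[%R.
  by apply: rat_in_itvoo; rewrite ltrBlDr ltrDl.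
have hr i : exists q : rat, ratr q \in `]x ord0 i, x ord0 i + e[%R.
  by apply: rat_in_itvoo; rewrite ltrDl.
have [l hlP] := choice hl; have [r hrP] := choice hr.
exists (\row_i l i, \row_i r i) => //; rewrite /F ifT.
  move=> i; rewrite /coor !mxE/= ?mxE.
  by have := hlP i; have := hrP i; rewrite !in_itv/=; lra.
apply/asboolP => y hy; apply: eU; split => // i j; rewrite ord1.
have := hlP j; have := hrP j; rewrite !in_itv/= => /andP[h1 h2] /andP[h3 h4].
have := hy j; rewrite /coor !mxE/= ?mxE => /andP[h5 h6].
by rewrite /ball/= ltr_norml; apply/andP; split; lra.
Qed.

Lemma continuous_measurable_Rn (f : Rn R n -> R) :
  continuous f -> measurable_fun setT f.
Proof.
move=> /continuousP cf; apply: (measurability _ (RGenOpens.measurableE R)).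
move=> _ [_ [a [b ->]] <-]; rewrite setTI; apply: open_measurable_Rn.
by apply: cf; exact: interval_open.
Qed.

(** One change of variables serves two purposes: dilations are the case a = 0, d i = r^(nu i), and
    the blow-up at a boundary point uses a nonzero centre a. *)
Definition affine (a d : 'I_n -> R) (x : Rn R n) : Rn R n :=
  \row_i (a i + d i * x ord0 i).

Lemma measurable_affine (a d : 'I_n -> R) : measurable_fun setT (affine a d).
Proof.
apply: measurable_fun_coorP => i; rewrite /comp /coor.
under eq_fun do rewrite mxE.
apply: measurable_funD => //; apply: measurable_funM => //.
exact: measurable_coor.
Qed.

(** The image of mu under the map, multiplied by the product of the d i, again gives each box its
    volume; by uniqueness it is mu. *)
Lemma ge0_integral_affine mu (a d : 'I_n -> R) (f : Rn R n -> \bar R) :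
  is_lebesgue_measure mu -> (forall i, 0 < d i) ->
  measurable_fun setT f -> (forall x, 0 <= f x)%E ->
  (\int[mu]_x f x =
   (\prod_(i < n) d i)%:E * \int[mu]_x f (affine a d x))%E.
Proof.
move=> hmu d0 mf f0.
have D0 : 0 <= \prod_(i < n) d i by apply: prodr_ge0 => i _; exact: ltW.
have mT := measurable_affine a d.
pose m1 : {measure set (Rn R n) -> \bar R} :=
  measure_function_pushforward__canonical__measure_function_Measure mu mT.
pose m : {measure set (Rn R n) -> \bar R} := mscale (NngNum D0) m1.
have hm : is_lebesgue_measure m.
  move=> u v uv.
  have -> : m [set x | forall i, coor i u <= coor i x < coor i v] =
    ((\prod_(i < n) d i)%:E * mu (affine a d @^-1` hobox u v))%E by [].
  rewrite (_ : _ @^-1` _ = hobox (\row_i ((coor i u - a i) / d i))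
                                 (\row_i ((coor i v - a i) / d i))).
    rewrite lebesgue_hobox//; last first.
      move=> i; rewrite /coor !mxE; apply: ler_wpM2r.
        by rewrite invr_ge0; exact: ltW.
      by rewrite lerD2r; exact: uv.
    rewrite -EFinM -big_split/=; congr EFin; apply: eq_bigr => i _.
    by rewrite /coor !mxE; field; exact: lt0r_neq0.
  apply/seteqP; split => x /= h i; have := h i; rewrite /coor !mxE;
    by rewrite ler_pdivrMr// ltr_pdivlMr// lerBlDl ltrBrDl [d i * _]mulrC.
rewrite (eq_measure_integral m); last by move=> A mA _; exact: lebesgue_unique.
rewrite ge0_integral_mscale//= ge0_integral_pushforward//.
Qed.

Lemma integrable_affine mu (a d : 'I_n -> R) (f : Rn R n -> R) :
  is_lebesgue_measure mu -> (forall i, 0 < d i) ->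
  mu.-integrable setT (EFin \o f) ->
  mu.-integrable setT (EFin \o (f \o affine a d)).
Proof.
move=> hmu d0 /integrableP[mf intf].
have D0 : 0 < \prod_(i < n) d i by exact: prodr_gt0.
apply/integrableP; split.
  by rewrite compA; apply: measurableT_comp => //; exact: measurable_affine.
move: intf; rewrite (@ge0_integral_affine mu a d)//; last first.
  by apply: measurableT_comp => //; exact: measurable_abse.
move: (\int[mu]_x _)%E => [r| |]//=; first by rewrite !ltry.
by rewrite mulry gtr0_sg// mul1e.
Qed.

Lemma Rintegral_affine mu (a d : 'I_n -> R) (f : Rn R n -> R) :
  is_lebesgue_measure mu -> (forall i, 0 < d i) ->
  mu.-integrable setT (EFin \o f) ->
  (\int[mu]_x f x)%R =
   (\prod_(i < n) d i) * (\int[mu]_x f (affine a d x))%R.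
Proof.
move=> hmu d0 intf.
have := integrable_affine a hmu d0 intf.
have /integrableP[mf _] := intf => intf'.
rewrite /Rintegral integralE [in RHS]integralE.
rewrite (@ge0_integral_affine mu a d)//; last exact: measurable_funepos.
rewrite (@ge0_integral_affine mu a d ((EFin \o f)^\-)%E)//; last exact: measurable_funeneg.
have := integrable_pos_fin_num measurableT intf'.
have := integrable_neg_fin_num measurableT intf'.
rewrite [X in fine (X - _)](_ : _ =
  (\prod_(i < n) d i)%:E * \int[mu]_x (EFin \o (f \o affine a d))^\+ x)%E//.
rewrite [X in fine (_ - X)](_ : _ =
  (\prod_(i < n) d i)%:E * \int[mu]_x (EFin \o (f \o affine a d))^\- x)%E//.
move: (\int[mu]_x (EFin \o (f \o affine a d))^\+ x)%E.
move: (\int[mu]_x (EFin \o (f \o affine a d))^\- x)%E.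
- by move=> [r| |]// [s| |]//= _ _; rewrite mulrBr.
- by congr (_ * _)%E; apply: eq_integral => x _; rewrite !funenegE.
- by congr (_ * _)%E; apply: eq_integral => x _; rewrite !funeposE.
Qed.

Lemma bounded_support_integrable mu B M (f : Rn R n -> R) :
  is_lebesgue_measure mu -> measurable_fun setT f ->
  (forall x, `|f x| <= M) -> (forall x, B < `|x| -> f x = 0) ->
  mu.-integrable setT (EFin \o f).
Proof.
move=> hmu mf fM fB.
pose k := (Num.truncn B).+1.
have mS : measurable (symbox k) by exact: measurable_hobox.
apply/integrableP; split; first exact/measurable_EFinP.
apply: (@le_lt_trans _ _ (\int[mu]_x ((cst M%:E) \_ (symbox k)) x)%E).
  apply: ge0_le_integral => //.
  - by apply: measurableT_comp => //; exact/measurable_EFinP.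
  - by apply/(measurable_restrictT _ _).1.
  - move=> x _; rewrite patchE; case: ifPn => [_|]; first by rewrite lee_fin.
    rewrite notin_setE => h /=; rewrite fB ?normr0// ltNge; apply/negP => xB.
    by apply: h; apply: symbox_norm; exact: le_lt_trans xB (truncnS_gt _).
rewrite -integral_mkcond integral_cst//.
have := lebesgue_symbox_lty k hmu; have : (0 <= mu (symbox k))%E by exact: measure_ge0.
case: (mu (symbox k)) => [r _ _|//|]; first by rewrite -EFinM ltry.
by [].
Qed.

Lemma lebesgue_open_gt0 mu (U : set (Rn R n)) x :
  is_lebesgue_measure mu -> open U -> U x -> (0 < mu U)%E.
Proof.
move=> hmu oU Ux.
have /nbhs_ballP[e /= e0 eU] : nbhs x U by rewrite nbhsE; exists U.
pose B := hobox (\row_i (coor i x - e / 2)) (\row_i (coor i x + e / 2)).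
have BU : B `<=` U.
  move=> y hy; apply: eU; split => // i j; rewrite ord1.
  have := hy j; rewrite /coor !mxE => /andP[h1 h2].
  by rewrite /ball/= ltr_norml; apply/andP; split; lra.
have mB : measurable B by exact: measurable_hobox.
apply: (@lt_le_trans _ _ (mu B)); last first.
  by rewrite le_measure// ?inE//; exact: open_measurable_Rn.
rewrite lebesgue_hobox//; last by move=> i; rewrite /coor !mxE; lra.
by rewrite lte_fin; apply: prodr_gt0 => i _; rewrite /coor !mxE; lra.
Qed.

Lemma integrable_indic_ball mu (B M : R) : is_lebesgue_measure mu -> 0 <= M ->
  mu.-integrable setT (EFin \o (fun x => M * \1_[set x : Rn R n | `|x| <= B] x)).
Proof.
move=> hmu M0; set S := [set x | _].
have mS : measurable S.
  have cn : continuous (fun x : Rn R n => `|x| : R).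
    by move=> x; exact: (@norm_continuous R (Rn R n) x).
  rewrite (_ : S = setT `&` (fun x : Rn R n => `|x| : R) @^-1` `]-oo, B]).
    exact: (continuous_measurable_Rn cn).
  by rewrite setTI; apply/seteqP; split => x /=; rewrite in_itv.
apply: (@bounded_support_integrable _ B M) => //.
- by apply: measurable_funM => //; exact: measurable_indic.
- move=> x; rewrite normrM (ger0_norm M0) ler_piMr// indicE.
  by case: (_ \in _); rewrite ?normr0 ?normr1.
- move=> x xB; rewrite indicE memNset ?mulr0// /S/=.
  by apply/negP; rewrite -ltNge.
Qed.

(** If the integral vanished, g would be 0 outside a null set; that set would contain U, which has
    positive measure because it contains a box. *)
Lemma Rintegral_gt0 mu (g : Rn R n -> R)
    (U : set (Rn R n)) x :
  is_lebesgue_measure mu -> mu.-integrable setT (EFin \o g) -> (forall y, 0 <= g y) ->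
  open U -> U x -> (forall y, U y -> g y != 0) -> 0 < (\int[mu]_y g y)%R.
Proof.
move=> hmu ig g0 oU Ux gU.
have I0 : 0 <= (\int[mu]_y g y)%R by exact: Rintegral_ge0.
rewrite lt_neqAle I0 andbT; apply/eqP => /esym Ig.
have mg : measurable_fun setT (EFin \o g) by case/integrableP : ig.
have : ae_eq mu setT (EFin \o g) (cst 0%E).
  apply/(ae_eq_integral_abs mu measurableT) => //.
  have -> : (\int[mu]_x `|(EFin \o g) x| = \int[mu]_x (EFin \o g) x)%E.
    by apply: eq_integral => y _ /=; rewrite ger0_norm.
  have := integrable_fin_num measurableT ig; move: Ig; rewrite /Rintegral.
  by move=> h1 h2; rewrite -[LHS]fineK// h1.
case=> N [mN N0 hN].
have UN : U `<=` N.
  by move=> y Uy; apply: hN => /= /(_ I) [gy]; have := gU y Uy; rewrite gy eqxx.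
have h1 := lebesgue_open_gt0 hmu oU Ux.
have : (mu U <= mu N)%E.
  by apply: le_measure => //; rewrite inE//; exact: open_measurable_Rn.
by rewrite N0 => h2; have := lt_le_trans h1 h2; rewrite ltxx.
Qed.

End LebesgueRn.

(** * Chain rule and Euler field *)

Lemma cvg_bigsum (R : realType) (T I : Type) (F : set_system T) {FF : Filter F}
    (r : seq I) (f : I -> T -> R) (l : I -> R) :
  (forall i, f i x @[x --> F] --> l i) ->
  (\sum_(i <- r) f i x) @[x --> F] --> \sum_(i <- r) l i.
Proof.
move=> h; elim: r => [|i r IH].
  by under eq_fun do rewrite big_nil; rewrite big_nil; exact: cvg_cst.
by under eq_fun do rewrite big_cons; rewrite big_cons; exact: cvgD.
Qed.

Section ChainRule.
Context {R : realType} {n : nat}.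
Implicit Types (x v : Rn R n) (f : Rn R n -> R).

Lemma is_derive_line f x (e : Rn R n) (s : R) :
  derivable f (x + s *: e) e ->
  is_derive s 1 (fun s => f (x + s *: e)) ('D_e f (x + s *: e)).
Proof.
move=> df.
have E h : h^-1 *: (f (x + (h *: (1 : R) + s) *: e) - f (x + s *: e)) =
           h^-1 *: (f (h *: e + (x + s *: e)) - f (x + s *: e)).
  by rewrite [h *: 1]mulr1 scalerDl addrCA.
split.
  rewrite /derivable; apply/cvg_ex; exists ('D_e f (x + s *: e)).
  under eq_fun do rewrite E.
  exact: df.
rewrite /derive.
by under eq_fun do rewrite E.
Qed.

(** The sign of u is left open because u will be the increment of a coordinate. *)
Lemma MVT_unordered (phi dphi : R -> R) (u : R) :
  (forall s : R, is_derive s 1 phi (dphi s)) ->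
  exists2 c, `|c| <= `|u| & phi u - phi 0 = u * dphi c.
Proof.
move=> h.
have cphi (A : set R) : {within A, continuous phi}.
  apply: continuous_subspaceT => s; apply: differentiable_continuous.
  by apply/derivable1_diffP; have [] := h s.
have [u0|u0|->] := ltgtP u 0.
- have [|c cu E] := @MVT R phi dphi u 0 u0 (fun z _ => h z); first exact: cphi.
  exists c; last by rewrite -opprB E; ring.
  by move: cu; rewrite in_itv/= => /andP[c1 c2]; rewrite !ltr0_norm//; lra.
- have [|c cu E] := @MVT R phi dphi 0 u u0 (fun z _ => h z); first exact: cphi.
  exists c; last by rewrite E; ring.
  by move: cu; rewrite in_itv/= => /andP[c1 c2]; rewrite !gtr0_norm//; lra.
- by exists 0 => //; rewrite subrr mul0r.
Qed.

Lemma mx_norm_le x (e : R) : 0 <= e -> (forall i, `|coor i x| <= e) -> `|x| <= e.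
Proof.
move=> e0 h; rewrite (_ : `|x| = mx_norm x)// mx_normrE.
by apply: bigmax_le => // -[i j] _; rewrite ord1; exact: h.
Qed.

(** Coordinates are moved one at a time and the mean value theorem is applied on each leg; in the
    sup norm no intermediate point is farther from x than [|v|]. *)
Lemma increment_partials f x v :
  (forall i y, derivable f y (evec R i)) ->
  exists xi : 'I_n -> Rn R n, (forall i, `|xi i - x| <= `|v|) /\
    f (x + v) - f x = \sum_(i < n) coor i v * 'D_(evec R i) f (xi i).
Proof.
move=> df.
pose p (k : nat) : Rn R n := \row_j (coor j x + (if (j < k)%N then coor j v else 0)).
have pS (k : 'I_n) : p k.+1 = p k + coor k v *: evec R k.
  apply/rowP => j; rewrite !mxE/= ?eqxx/=.
  have [->|jk] := eqVneq j k; first by rewrite ltnSn ltnn mulr1 addr0.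
  rewrite mulr0 addr0 ltnS leq_eqVlt.
  by rewrite (_ : (j == k :> nat) = false)//; apply/negbTE.
have h (k : 'I_n) : exists xi, `|xi - x| <= `|v| /\
    f (p k.+1) - f (p k) = coor k v * 'D_(evec R k) f xi.
  have [|c cu E] := @MVT_unordered (fun s => f (p k + s *: evec R k))
    (fun s => 'D_(evec R k) f (p k + s *: evec R k)) (coor k v).
    by move=> s; exact: is_derive_line.
  exists (p k + c *: evec R k); split; last first.
    by rewrite -E scale0r addr0 pS.
  apply: mx_norm_le => // j; rewrite /coor !mxE/= ?eqxx/= -/(coor j x).
  rewrite addrAC [_ - _]addrAC subrr add0r.
  have [->|jk] := eqVneq j k.
    by rewrite ltnn mulr1 add0r; apply: le_trans cu _; exact: norm_coor.
  by rewrite mulr0 addr0; case: ifP => _; rewrite ?normr0//; exact: norm_coor.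
have [xi hxi] := choice h.
exists xi; split => [i|]; first by have [] := hxi i.
under eq_bigr do rewrite -(hxi _).2.
rewrite -(big_mkord xpredT (fun k => f (p k.+1) - f (p k))).
rewrite telescope_sumr//; congr (f _ - f _); apply/rowP => j; rewrite !mxE/=.
  by rewrite ltn_ord.
by rewrite addr0.
Qed.

Lemma is_derive_of_cvg (phi : R -> R) (t l : R) :
  (h^-1 * (phi (h + t) - phi t)) @[h --> 0^'] --> l -> is_derive t 1 phi l.
Proof.
move=> H.
have H' : (h^-1 *: ((phi \o shift t) (h *: (1:R)) - phi t)) @[h --> 0^'] --> l.
  by under eq_fun do rewrite /= [_ *: 1]mulr1.
by split; [apply/cvg_ex; exists l | exact/cvg_lim].
Qed.

Lemma cvg_of_is_derive (phi : R -> R) (t l : R) :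
  is_derive t 1 phi l -> (h^-1 * (phi (h + t) - phi t)) @[h --> 0^'] --> l.
Proof.
move=> [d <-]; have := d; rewrite /derivable /derive => /cvg_ex[l' H].
have E : (fun h : R => h^-1 *: ((phi \o shift t) (h *: (1:R)) - phi t)) =
  (fun h => h^-1 * (phi (h + t) - phi t)).
  by apply/funext => h /=; rewrite [_ *: 1]mulr1.
by rewrite E in H *; rewrite (cvg_lim _ H).
Qed.

(** Dividing [increment_partials] by h gives difference quotients of the coordinates times partial
    derivatives at points tending to g t, so continuity of the partials there is enough. *)
Lemma is_derive_curve f (g : R -> Rn R n) (dg : 'I_n -> R) t :
  (forall i y, derivable f y (evec R i)) ->
  (forall i, {for g t, continuous ('D_(evec R i) f)}) ->
  (forall i, is_derive t 1 (fun s => coor i (g s)) (dg i)) ->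
  is_derive t 1 (f \o g) (\sum_(i < n) dg i * 'D_(evec R i) f (g t)).
Proof.
move=> df cf hg.
have [xi hxi] := choice (fun h => increment_partials (g t) (g (h + t) - g t) df).
apply: is_derive_of_cvg => /=.
have E h : h^-1 * (f (g (h + t)) - f (g t)) = \sum_(i < n)
   (h^-1 * (coor i (g (h + t)) - coor i (g t))) * 'D_(evec R i) f (xi h i).
  have [_] := hxi h; rewrite subrKC => ->.
  by rewrite mulr_sumr; apply: eq_bigr => i _; rewrite mulrA /coor !mxE.
under eq_fun do rewrite E.
(* The curve is continuous at t because each coordinate increment is h times a convergent difference
   quotient. *)
have gc : g (h + t) - g t @[h --> 0^'] --> (0 : Rn R n).
  apply/cvgr0Pnorm_le => e e0.
  near=> h; apply: mx_norm_le; first exact: ltW.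
  near: h.
  suff : forall i, \forall h \near (0:R)^', `|coor i (g (h + t) - g t)| <= e.
    by move=> H; apply: filter_forall => i; exact: H.
  move=> i.
  have : h * (h^-1 * (coor i (g (h + t)) - coor i (g t))) @[h --> 0^'] --> 0 * dg i.
    apply: cvgM; last exact: cvg_of_is_derive.
    exact: cvg_within.
  rewrite mul0r => /cvgr0Pnorm_le/(_ e e0) H; near=> h.
  have h0 : h != 0 by near: h; exact: nbhs_dnbhs_neq.
  have : `|h * (h^-1 * (coor i (g (h + t)) - coor i (g t)))| <= e by near: h.
  by rewrite mulrA mulfV// mul1r /coor !mxE.
apply: cvg_bigsum => i; apply: cvgM; first exact: cvg_of_is_derive.
suff H : xi h i @[h --> 0^'] --> g t by exact: (cvg_comp _ _ H (cf i)).
apply/cvgrPdist_le => e e0; near=> h; rewrite distrC.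
apply: (le_trans ((hxi h).1 i)); near: h.
by move/cvgr0Pnorm_le : gc; exact.
Unshelve. all: by end_near. Qed.

End ChainRule.

Section Euler.
Context {R : realType} {n : nat}.
Variable nu : 'I_n -> R.
Implicit Types (x : Rn R n) (f : Rn R n -> R).

(** The generator of the dilations, that is |x| times the radial derivative ([radderivE]). It does
    not mention the quasi-norm, so it is continuous for smooth f. *)
Definition euler f x : R := \sum_(i < n) nu i * coor i x * 'D_(evec R i) f x.

Lemma is_derive_dil f x (r : R) : smooth f -> 0 < r ->
  is_derive r 1 (fun r => f (dil nu r x)) (r^-1 * euler f (dil nu r x)).
Proof.
move=> sf r0.
have H := @is_derive_curve R n f (fun r => dil nu r x)
  (fun i => nu i * r `^ (nu i - 1) * coor i x) r.
apply: (is_derive_eq (H _ _ _)).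
- by move=> i y; have [_ h] := sf [::]; exact: h.
- by move=> i; have [h _] := sf [:: i]; exact: h.
- move=> i.
  have -> : (fun s : R => coor i (dil nu s x)) = ((@powR R)^~ (nu i)) * cst (x ord0 i).
    by apply/funext => s; rewrite /coor mxE.
  have dpow := is_derive1_powR (nu i) r0.
  apply: is_derive_eq; rewrite [_ *: 0]mulr0 add0r.
  by rewrite [_ *: _]mulrC.
- rewrite /euler mulr_sumr; apply: eq_bigr => i _.
  rewrite [RHS]mulrA; congr (_ * _); rewrite /coor mxE.
  rewrite powRB ?powRr1 ?(ltW r0)//; last by apply/implyP => _; rewrite gt_eqF.
  by field; rewrite gt_eqF.
Qed.

Lemma smooth_continuous f : smooth f -> continuous f.
Proof. by move=> /(_ [::])[]. Qed.

Lemma continuous_euler f : smooth f -> continuous (euler f).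
Proof.
move=> sf x; rewrite /euler; apply: (@cvg_bigsum R _ _ (nbhs x)) => i.
apply: cvgM; last by have [h _] := sf [:: i]; exact: h.
by apply: cvgM; [exact: cvg_cst | exact: coord_continuous].
Qed.

Lemma dil1 x : dil nu 1 x = x.
Proof. by apply/rowP => i; rewrite mxE powR1 mul1r. Qed.

Lemma dilM (r s : R) x : 0 <= r -> 0 <= s -> dil nu r (dil nu s x) = dil nu (r * s) x.
Proof. by move=> r0 s0; apply/rowP => i; rewrite !mxE powRM// mulrA. Qed.

Lemma dil_affine (r : R) : dil nu r = affine (fun=> 0) (fun i => r `^ nu i).
Proof. by apply/funext => x; apply/rowP => i; rewrite !mxE add0r. Qed.

Lemma prod_powR (r : R) : 0 < r -> \prod_(i < n) r `^ nu i = r `^ hdim nu.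
Proof.
move=> r0; rewrite /hdim; elim/big_rec2 : _ => [|i y z _ ->].
  by rewrite powRr0.
by rewrite powRD//; apply/implyP => _; rewrite gt_eqF.
Qed.

Lemma Rintegral_dil (mu : {measure set (Rn R n) -> \bar R}) (h : Rn R n -> R) (r : R) :
  is_lebesgue_measure mu -> mu.-integrable setT (EFin \o h) -> 0 < r ->
  (\int[mu]_x h (dil nu r x))%R = r `^ (- hdim nu) * (\int[mu]_x h x)%R.
Proof.
move=> hmu ih r0; rewrite dil_affine.
rewrite [in RHS](@Rintegral_affine R n mu (fun=> 0) (fun i => r `^ nu i))//; last first.
  by move=> i; exact: powR_gt0.
by rewrite prod_powR// mulrA powRN mulVf ?mul1r// gt_eqF ?powR_gt0.
Qed.

(* Differentiate the scaling law of Lebesgue measure at r = 1. *)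
Lemma Rintegral_euler (mu : {measure set (Rn R n) -> \bar R}) (h Eh : Rn R n -> R) (M B : R) :
  is_lebesgue_measure mu -> measurable_fun setT h -> measurable_fun setT Eh ->
  (forall x, `|h x| <= M) -> (forall x, `|Eh x| <= M) ->
  (forall x, B < `|x| -> h x = 0) -> (forall x, B < `|x| -> Eh x = 0) ->
  (forall x (r : R), 0 < r ->
     is_derive r 1 (fun r => h (dil nu r x)) (r^-1 * Eh (dil nu r x))) ->
  (\int[mu]_x Eh x)%R = - hdim nu * (\int[mu]_x h x)%R.
Proof.
move=> hmu mh mEh hM EhM hB EhB dh.
have M0 : 0 <= M by exact: le_trans (hM 0).
have ih : mu.-integrable setT (EFin \o h) by exact: bounded_support_integrable hB.
(* For 1/2 < r < 2, undoing the dilation enlarges coordinate i by at most 2^|nu i|. Hence all these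
   dilates of h and Eh vanish outside the single ball of radius c |B|. *)
pose c := \sum_(i < n) 2 `^ `|nu i|.
pose B' := c * `|B|.
pose S : set (Rn R n) := [set x | `|x| <= B'].
(* The dominating function for differentiation under the integral; its factor 2 bounds the r^-1 in
   the derivative along the orbit. *)
pose G (x : Rn R n) : R := (2 * M) * \1_S x.
have G0 x : 0 <= G x by rewrite /G mulr_ge0// ?mulr_ge0//; lra.
have iG : mu.-integrable setT (EFin \o G).
  by apply: integrable_indic_ball => //; rewrite mulr_ge0.
have intf (r : R) : `]2^-1, 2[ r -> mu.-integrable setT (EFin \o (fun x => h (dil nu r x))).
  rewrite /= in_itv/= => /andP[r1 _]; rewrite dil_affine.
  apply: (@integrable_affine R n mu _ _ h) => // i; apply: powR_gt0.
  by apply: lt_trans r1; rewrite invr_gt0.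
have dil_big (r : R) x : `]2^-1, 2[ r -> B' < `|x| -> B < `|dil nu r x|.
  rewrite /= in_itv/= => /andP[r1 r2] xB; rewrite ltNge; apply/negP => dB.
  have r0 : 0 < r by apply: lt_trans r1; rewrite invr_gt0.
  have : `|x| <= B'; last by rewrite leNgt xB.
  apply: mx_norm_le; first by rewrite /B' mulr_ge0// sumr_ge0// => i _; exact: powR_ge0.
  move=> i.
  have -> : coor i x = r `^ (- nu i) * coor i (dil nu r x).
    by rewrite /coor mxE mulrA powRN mulVf ?mul1r// gt_eqF ?powR_gt0.
  rewrite normrM; apply: ler_pM => //; last first.
    by apply: le_trans (norm_coor _ _) _; apply: le_trans dB _; exact: ler_norm.
  rewrite ger0_norm ?powR_ge0//.
  apply: (@le_trans _ _ (2 `^ `|nu i|)); last first.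
    by rewrite /c (bigD1 i)//= lerDl sumr_ge0// => j _; exact: powR_ge0.
  rewrite /powR !gt_eqF// ler_expR.
  apply: le_trans (ler_norm _) _; rewrite normrM normrN; apply: ler_wpM2l => //.
  rewrite ler_norml -lnV ?posrE// !ler_ln ?posrE ?invr_gt0//.
  by rewrite !ltW.
have Gub (r : R) x : `]2^-1, 2[ r -> setT x ->
    `|partial1of2 (fun r x => h (dil nu r x)) r x| <= G x.
  move=> Ir _; have := Ir; rewrite /= in_itv/= => /andP[r1 r2].
  have r0 : 0 < r by apply: lt_trans r1; rewrite invr_gt0.
  have [_ E] := dh x r r0.
  rewrite partial1of2E E /G indicE; have [xS|xS] := boolP (x \in S).
    rewrite mulr1 normrM; apply: ler_pM => //.
    rewrite ger0_norm ?invr_ge0 ?(ltW r0)//.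
    by rewrite -[leRHS]invrK lef_pV2 ?posrE ?invr_gt0// ltW.
  rewrite mulr0 EhB ?mulr0 ?normr0//; apply: dil_big => //.
  by move: xS; rewrite notin_setE /S/= => /negP; rewrite -ltNge.
have I1 : `]2^-1, 2[%classic (1 : R) by rewrite /= in_itv/=; apply/andP; split; lra.
have := @differentiation_under_integral R _ _ mu (fun r x => h (dil nu r x)) setT
  measurableT 1 _ _ I1 intf _ G G0 iG Gub.
have dd : forall (x : R) (y : Rn R n), `]2^-1, 2[ x -> setT y ->
    derivable (fun r => h (dil nu r y)) x 1.
  move=> r x; rewrite /= in_itv/= => /andP[r1 r2] _.
  by have [] := dh x r (lt_trans _ r1).
move=> /(_ dd) H.
have {H}-> : (\int[mu]_x Eh x)%R =
    derive1 (fun r => \int[mu]_y h (dil nu r y))%R 1.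
  rewrite H; apply: eq_Rintegral => x _.
  have [_ E] := dh x 1 ltr01.
  by rewrite partial1of2E E invr1 mul1r dil1.
rewrite derive1E.
have := is_derive1_powR (- hdim nu) (@ltr01 R).
move=> /(is_deriveZ (\int[mu]_x h x)%R) dpow.
have [_ <-] : is_derive (1 : R) 1 (fun r : R => \int[mu]_y h (dil nu r y))%R
    (- hdim nu * (\int[mu]_x h x)%R).
  apply: near_eq_is_derive (is_derive_eq dpow _).
    near=> r; rewrite Rintegral_dil//; first by rewrite mulrC.
    by near: r; exact: lt_nbhsr.
  by rewrite powR1 mulr1 [_ *: _]mulrC.
by [].
Unshelve. all: by end_near. Qed.
End Euler.

(** * Scalar calculus *)

Section ScalarCalculus.
Context {R : realType}.
Implicit Types (t a : R) (f g u v : R -> R).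

Lemma is_derive_fD f g t (df dg : R) :
  is_derive t 1 f df -> is_derive t 1 g dg ->
  is_derive t 1 (fun s => f s + g s) (df + dg).
Proof. by move=> h1 h2; exact: is_deriveD. Qed.

Lemma is_derive_fM f g t (df dg : R) :
  is_derive t 1 f df -> is_derive t 1 g dg ->
  is_derive t 1 (fun s => f s * g s) (df * g t + f t * dg).
Proof.
move=> h1 h2; apply: (is_derive_eq (is_deriveM h1 h2)).
by rewrite addrC; congr (_ + _); rewrite [_ *: _]mulrC.
Qed.

Lemma is_derive_fcomp f g t (df dg : R) :
  is_derive (g t) 1 f df -> is_derive t 1 g dg ->
  is_derive t 1 (fun s => f (g s)) (df * dg).
Proof. by move=> h1 h2; exact: is_derive1_comp. Qed.

Lemma is_derive_fpowR f t (df : R) a : 0 < f t -> is_derive t 1 f df ->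
  is_derive t 1 (fun s => f s `^ a) (a * f t `^ (a - 1) * df).
Proof. by move=> f0 h; exact: (is_derive_fcomp (is_derive1_powR a f0) h). Qed.

Lemma is_derive_fcst a t : is_derive t 1 (fun _ : R => a) 0.
Proof. exact: is_derive_cst. Qed.

Lemma is_derive_fid t : is_derive t 1 (fun s : R => s) 1.
Proof. exact: is_derive_id. Qed.

Lemma is_derive_fMr (q t : R) : is_derive t 1 (fun s => s * q) q.
Proof.
apply: (is_derive_eq (is_derive_fM (is_derive_fid t) (is_derive_fcst q t))).
by rewrite mul1r mulr0 addr0.
Qed.

(** Along a dilation orbit L is [ln R0 - ln (s * qn x)], in which the quasi-norm enters only as the
    number q. At t = 1 this says that the Euler field maps L to -1. *)
Lemma is_derive_log_ratio (c q t : R) : 0 < q -> 0 < t ->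
  is_derive t 1 (fun s => c - ln (s * q)) (- t^-1).
Proof.
move=> q0 t0; have tq : 0 < t * q by rewrite mulr_gt0.
have h := is_derive_fD (is_derive_fcst c t) (is_derive_fM (is_derive_fcst (-1) t)
  (@is_derive_fcomp (@ln R) (fun s => s * q) t _ _ (is_derive1_ln tq) (is_derive_fMr q t))).
apply: near_eq_is_derive (is_derive_eq h _).
  by near=> s; rewrite mulN1r.
by field; rewrite !gt_eqF.
Unshelve. all: by end_near. Qed.

Lemma powR_cvg_pos (T : Type) (F : set_system T) {FF : Filter F} (f : T -> R) (l a : R) :
  0 < l -> f x @[x --> F] --> l -> (f x `^ a) @[x --> F] --> l `^ a.
Proof.
move=> l0 h; have [/derivable1_diffP/differentiable_continuous c _] :=
  is_derive1_powR a l0.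
exact: (cvg_comp _ _ h c).
Qed.

Lemma powR_cvg_zero (T : Type) (F : set_system T) {FF : Filter F} (f : T -> R) (a : R) :
  0 < a -> (forall x, 0 <= f x) -> f x @[x --> F] --> 0 ->
  (f x `^ a) @[x --> F] --> 0.
Proof.
move=> a0 f0 /cvgr0Pnorm_le h; apply/cvgr0Pnorm_le => e e0.
have := h (e `^ a^-1) (powR_gt0 _ e0); apply: filterS => x.
rewrite ger0_norm// => fx; rewrite ger0_norm ?powR_ge0//.
have -> : e = (e `^ a^-1) `^ a by rewrite -powRrM mulVf ?gt_eqF// powRr1// ltW.
by apply: ge0_ler_powR => //; rewrite ?nnegrE ?powR_ge0 ?f0 ?(ltW a0).
Qed.

Lemma powR_cvg_nneg (T : Type) (F : set_system T) {FF : Filter F} (f : T -> R) (l a : R) :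
  0 < a -> (forall x, 0 <= f x) -> 0 <= l -> f x @[x --> F] --> l ->
  (f x `^ a) @[x --> F] --> l `^ a.
Proof.
move=> a0 f0; rewrite le_eqVlt => /predU1P[<-|l0] h; last exact: powR_cvg_pos.
by rewrite powR0 ?gt_eqF//; exact: powR_cvg_zero.
Qed.

Lemma sqrt_sqr_le (x y : R) : Num.sqrt (x ^+ 2 + y ^+ 2) <= `|x| + `|y|.
Proof.
rewrite -[leRHS]ger0_norm ?addr_ge0// -sqrtr_sqr; apply: ler_wsqrtr.
have := normr_ge0 x; have := normr_ge0 y.
by rewrite -(real_normK (num_real x)) -(real_normK (num_real y)); nra.
Qed.

(** The formula also covers a common zero of u and v, where its last factor makes it 0 whatever
    value the power p - 2 takes. *)
Lemma is_derive_norm_powR u v t (du dv p : R) : 1 < p ->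
  is_derive t 1 u du -> is_derive t 1 v dv ->
  is_derive t 1 (fun s => Num.sqrt (u s ^+ 2 + v s ^+ 2) `^ p)
    (p * Num.sqrt (u t ^+ 2 + v t ^+ 2) `^ (p - 2) * (u t * du + v t * dv)).
Proof.
move=> p1 hu hv.
have sq0 s : 0 <= u s ^+ 2 + v s ^+ 2 by rewrite addr_ge0// sqr_ge0.
have sE s q : Num.sqrt (u s ^+ 2 + v s ^+ 2) `^ q = (u s ^+ 2 + v s ^+ 2) `^ (q / 2).
  by rewrite -powR12_sqrt// -powRrM mulrC.
have [z|nz] := eqVneq (u t ^+ 2 + v t ^+ 2) 0; last first.
  have pos : 0 < u t ^+ 2 + v t ^+ 2 by rewrite lt_neqAle eq_sym nz sq0.
  have -> : (fun s => Num.sqrt (u s ^+ 2 + v s ^+ 2) `^ p) =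
    (fun s => (u s * u s + v s * v s) `^ (p / 2)).
    by apply/funext => s; rewrite sE !expr2.
  have pos' : 0 < u t * u t + v t * v t by rewrite -!expr2.
  apply: (is_derive_eq (@is_derive_fpowR (fun s => u s * u s + v s * v s) t _
    (p / 2) pos' (is_derive_fD (is_derive_fM hu hu) (is_derive_fM hv hv)))).
  rewrite sE -!expr2 (_ : (p - 2) / 2 = p / 2 - 1); last by field.
  by field.
have [u0 v0] : u t = 0 /\ v t = 0.
  move: z => /eqP; rewrite paddr_eq0 ?sqr_ge0// !sqrf_eq0.
  by move=> /andP[/eqP -> /eqP ->].
rewrite u0 v0 !mul0r addr0 mulr0; apply: is_derive_of_cvg.
rewrite u0 v0 expr0n/= addr0 sqrtr0.
have p0 : p != 0 by rewrite gt_eqF//; lra.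
rewrite powR0// {z}.
pose w (h : R) : R := `|u (h + t)| + `|v (h + t)|.
(* [z] dominates the difference quotient: one factor [w], divided by |h|, stays bounded, and the
   remaining w^(p-1) tends to 0 because p > 1. *)
pose z (h : R) : R := (`|h^-1 * (u (h + t) - u t)| + `|h^-1 * (v (h + t) - v t)|) * w h `^ (p - 1).
have cu := cvg_of_is_derive hu; have cv := cvg_of_is_derive hv.
have c0 (q : R -> R) (dq : R) : is_derive t 1 q dq -> q t = 0 ->
    q (h + t) @[h --> 0^'] --> 0.
  move=> hq q0; have cq : {for t, continuous q}.
    by apply: differentiable_continuous; apply/derivable1_diffP; have [] := hq.
  have ct : h + t @[h --> (0:R)^'] --> t.
    rewrite -[X in _ --> X]add0r; apply: cvgD; last exact: cvg_cst.
    exact: cvg_within.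
  by have := cvg_comp _ _ ct cq; rewrite /= q0.
have wc : w h @[h --> 0^'] --> 0.
  have n0 (q : R -> R) (dq : R) : is_derive t 1 q dq -> q t = 0 ->
      `|q (h + t)| @[h --> (0 : R)^'] --> (0 : R).
    move=> hq q0; rewrite -[X in _ --> X](@normr0 _ R); apply: cvg_norm.
    exact: c0 hq q0.
  by rewrite -[X in _ --> X]addr0; apply: cvgD; [exact: n0 hu u0|exact: n0 hv v0].
have zc : z h @[h --> 0^'] --> 0.
  rewrite -[X in _ --> X](mulr0 (`|du| + `|dv|)); apply: cvgM.
    by apply: cvgD; apply: cvg_norm.
  by apply: powR_cvg_zero => //; [lra|move=> h; rewrite addr_ge0].
apply: norm_cvg0; apply: (squeeze_cvgr _ (cvg_cst 0) zc).
near=> h; rewrite normr_ge0/= /z u0 v0 !subr0 !normrM -mulrDr -mulrA.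
apply: ler_wpM2l => //; rewrite -/(w h) ger0_norm ?powR_ge0//.
rewrite mulr_powRB1 ?addr_ge0//; last by lra.
apply: ge0_ler_powR; rewrite ?nnegrE ?sqrtr_ge0 ?addr_ge0//; first by lra.
exact: sqrt_sqr_le.
Unshelve. all: by end_near. Qed.

(** Adding both endpoint values spares a case distinction on the sign of a wherever a weight is
    bounded. *)
Lemma powR_le_endpoints (lo hi x a : R) : 0 < lo -> lo <= x -> x <= hi ->
  x `^ a <= lo `^ a + hi `^ a.
Proof.
move=> lo0 lox xhi; have x0 : 0 < x by exact: lt_le_trans lox.
have [a0|a0] := leP 0 a.
  apply: (@le_trans _ _ (hi `^ a)); last by rewrite lerDr powR_ge0.
  by apply: ge0_ler_powR => //; rewrite nnegrE ?(ltW x0)// (le_trans (ltW x0)).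
apply: (@le_trans _ _ (lo `^ a)); last by rewrite lerDl powR_ge0.
rewrite -[a]opprK !(powRN _ (- a)) lef_pV2 ?posrE ?powR_gt0//.
by apply: ge0_ler_powR => //; rewrite ?nnegrE ?oppr_ge0 ?ltW.
Qed.

(** The function s^p - p s has its strict minimum over s >= 0 at 1; the mean value theorem gives the
    sign on either side. *)
Lemma bernoulli_strict (p x : R) : 1 < p -> 0 <= x -> x != 1 ->
  0 < x `^ p + (p - 1) - p * x.
Proof.
move=> p1; rewrite le_eqVlt => /predU1P[<- _|x0 x1].
  by rewrite powR0; [lra|rewrite gt_eqF//; lra].
pose phi s := s `^ p + (- p) * s.
have dphi (s : R) : 0 < s -> is_derive s 1 phi (p * s `^ (p - 1) - p).
  move=> s0; apply: (is_derive_eq (is_derive_fD (is_derive_fpowR p s0 (is_derive_fid s))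
    (is_derive_fM (is_derive_fcst (- p) s) (is_derive_fid s)))).
  by rewrite mul0r add0r !mulr1.
have phi1 : phi 1 = 1 - p by rewrite /phi powR1; ring.
have E1 : 1 `^ (p - 1) = 1 :> R by rewrite powR1.
suff : phi 1 < phi x by rewrite phi1 /phi; lra.
have cphi (a b : R) : 0 < a -> {within `[a, b], continuous phi}.
  move=> a0; apply: continuous_in_subspaceT => s; rewrite inE/= in_itv/= => /andP[as_ _].
  apply: differentiable_continuous; apply/derivable1_diffP.
  by have [] := dphi s (lt_le_trans a0 as_).
case: (ltgtP x 1) x1 => // x1 _.
- have [| |c] := @MVT R phi (fun s => p * s `^ (p - 1) - p) x 1 x1.
  + by move=> s; rewrite in_itv/= => /andP[xs _]; apply: dphi; lra.
  + exact: cphi.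
  + rewrite in_itv/= => /andP[xc c1] E.
    have : c `^ (p - 1) < 1.
      rewrite -[X in _ < X]E1; apply: gt0_ltr_powR => //; first by lra.
      by rewrite nnegrE; lra.
      by rewrite nnegrE.
    by move=> h; rewrite -subr_lt0 E pmulr_llt0 ?subr_gt0//; nra.
- have [| |c] := @MVT R phi (fun s => p * s `^ (p - 1) - p) 1 x x1.
  + by move=> s; rewrite in_itv/= => /andP[xs _]; apply: dphi; lra.
  + exact: cphi.
  + rewrite in_itv/= => /andP[xc c1] E.
    have : 1 < c `^ (p - 1).
      rewrite -[X in X < _]E1; apply: gt0_ltr_powR => //; first by lra.
      by rewrite nnegrE.
      by rewrite nnegrE; lra.
    by move=> h; rewrite -subr_gt0 E pmulr_lgt0 ?subr_gt0//; nra.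
Qed.

(** Dividing by b^p reduces the claim to [bernoulli_strict] at x / b; when b = 0 only x^p remains,
    since 0^(p-1) = 0. *)
Lemma young_strict (p x b : R) : 1 < p -> 0 <= x -> 0 <= b ->
  0 <= x `^ p + (p - 1) * b `^ p - p * b `^ (p - 1) * x /\
  (x `^ p + (p - 1) * b `^ p - p * b `^ (p - 1) * x = 0 -> x = b).
Proof.
move=> p1 x0; rewrite le_eqVlt => /predU1P[<-|b0].
  have p0 : p != 0 by rewrite gt_eqF//; lra.
  have p10 : p - 1 != 0 by rewrite gt_eqF//; lra.
  rewrite !powR0//.
  rewrite !mulr0 mul0r subr0 addr0; split; first exact: powR_ge0.
  by move=> /powR_eq0_eq0.
have E : x `^ p + (p - 1) * b `^ p - p * b `^ (p - 1) * x =
    b `^ p * ((x / b) `^ p + (p - 1) - p * (x / b)).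
  have -> : x `^ p = b `^ p * (x / b) `^ p.
    rewrite -powRM ?(ltW b0) ?divr_ge0 ?(ltW b0)//.
    by congr (_ `^ _); field; rewrite gt_eqF.
  rewrite -(mulr_powRB1 (ltW b0)); last by lra.
  by field; rewrite gt_eqF.
have bp : 0 < b `^ p by exact: powR_gt0.
have xb0 : 0 <= x / b by rewrite divr_ge0// ltW.
rewrite E; split.
  rewrite pmulr_rge0//; have [->|h] := eqVneq (x / b) 1.
    by rewrite powR1; lra.
  by apply/ltW/bernoulli_strict.
move=> /eqP; rewrite mulf_eq0 gt_eqF//=.
have [h _|h] := eqVneq (x / b) 1; last by rewrite gt_eqF// bernoulli_strict.
by rewrite -[RHS]mul1r -h; field; rewrite gt_eqF.
Qed.

Lemma cauchy_schwarz2 (a b c d : R) :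
  a * c + b * d <= Num.sqrt (a ^+ 2 + b ^+ 2) * Num.sqrt (c ^+ 2 + d ^+ 2).
Proof.
rewrite -sqrtrM ?addr_ge0 ?sqr_ge0//; apply: le_trans (ler_norm _) _.
rewrite -sqrtr_sqr; apply: ler_wsqrtr.
by have := sqr_ge0 (a * d - b * c); nra.
Qed.

End ScalarCalculus.

(** * The remainder C_p *)

Section ComplexLemmas.
Context {R : realType}.
Implicit Types (z xi eta : R[i]) (c p : R).

Lemma complex_scale z c :
  z * real_complex R c = Complex (complex.Re z * c) (complex.Im z * c).
Proof. by case: z => a b; apply/eqP; rewrite eq_complex/= !mulr0 subr0 ?add0r ?addr0 !eqxx. Qed.

Lemma complex_div_real z c :
  z / real_complex R c = Complex (complex.Re z / c) (complex.Im z / c).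
Proof. by rewrite -fmorphV complex_scale. Qed.

Lemma cabs_scale (a b c : R) : cabs (Complex (a * c) (b * c)) = cabs (Complex a b) * `|c|.
Proof.
rewrite /cabs/= !exprMn -mulrDl sqrtrM ?addr_ge0 ?sqr_ge0//.
by rewrite sqrtr_sqr.
Qed.

Lemma cabs_ge0 z : 0 <= cabs z. Proof. exact: sqrtr_ge0. Qed.

Lemma cabs0 : cabs (0 : R[i]) = 0.
Proof. by rewrite /cabs/= expr0n/= addr0 sqrtr0. Qed.

Lemma cabs_sqr z : cabs z ^+ 2 = complex.Re z ^+ 2 + complex.Im z ^+ 2.
Proof. by rewrite /cabs sqr_sqrtr// addr_ge0 ?sqr_ge0. Qed.

Lemma cabs_eq0 z : cabs z = 0 -> z = 0.
Proof.
move=> h; have := cabs_sqr z; rewrite h expr0n/= => /esym/eqP.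
rewrite paddr_eq0 ?sqr_ge0// !sqrf_eq0 => /andP[/eqP a /eqP b].
by case: z a b {h} => a b /= -> ->.
Qed.

(** In terms of xi and b = xi - eta the remainder splits into two pure powers and a cross term, the
    shape of the three densities of the identity. The separate clause at xi = eta agrees, since
    every term containing b then vanishes. *)
Lemma CpE p xi eta : 1 < p ->
  Cp p xi eta = cabs xi `^ p + (p - 1) * cabs (xi - eta) `^ p -
    p * cabs (xi - eta) `^ (p - 2) *
    (complex.Re (xi - eta) * complex.Re xi + complex.Im (xi - eta) * complex.Im xi).
Proof.
move=> p1; rewrite /Cp.
have p0 : p != 0 by rewrite gt_eqF//; lra.
have [->|ne] := eqVneq xi eta.
  by rewrite subrr cabs0 powR0//= !mul0r addr0 !mulr0 !subr0 addr0.
set b := xi - eta.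
have B0 : 0 < cabs b.
  rewrite lt_neqAle cabs_ge0 andbT eq_sym; apply/eqP => /cabs_eq0 /eqP.
  by rewrite /b subr_eq0 (negbTE ne).
have -> : cabs b `^ p = cabs b `^ (p - 2) * (complex.Re b ^+ 2 + complex.Im b ^+ 2).
  rewrite -cabs_sqr -powR_mulrn ?cabs_ge0// -powRD ?subrK//.
  by apply/implyP => _; rewrite gt_eqF.
have -> : eta = xi - b by rewrite /b opprB addrC subrK.
move: b {B0} => [b1 b2]; case: xi {ne} => [x1 x2] /=.
by ring.
Qed.

(** Cauchy-Schwarz bounds the cross term by |b|^(p-1) |xi|, which leaves Young's inequality for |xi|
    and |b|. *)
Lemma Cp_ge0 p xi eta : 1 < p -> 0 <= Cp p xi eta.
Proof.
move=> p1; rewrite CpE//; set b := xi - eta.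
have [h _] := young_strict p1 (cabs_ge0 xi) (cabs_ge0 b).
apply: le_trans h _; rewrite lerD2l lerN2 -!mulrA; apply: ler_wpM2l; first by lra.
have -> : p - 1 = (p - 2) + 1 by ring.
have [b0|b0] := eqVneq (cabs b) 0.
  by rewrite (cabs_eq0 b0)/= !mul0r addr0 mulr0 mulr_ge0 ?powR_ge0 ?cabs_ge0.
rewrite [in leRHS]powRD; last by apply/implyP => _.
rewrite powRr1 ?cabs_ge0// -mulrA; apply: ler_wpM2l; first exact: powR_ge0.
exact: cauchy_schwarz2.
Qed.

(** Equality must hold in Young, so |xi| = |b|, and in Cauchy-Schwarz, so xi and b point in the same
    direction; hence xi = b. *)
Lemma Cp_eq0 p xi eta : 1 < p -> Cp p xi eta = 0 -> eta = 0.
Proof.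
move=> p1; rewrite CpE//; set b := xi - eta => H.
have p0 : p != 0 by rewrite gt_eqF//; lra.
have [h h'] := young_strict p1 (cabs_ge0 xi) (cabs_ge0 b).
have eE : eta = xi - b by rewrite /b opprB addrC subrK.
have [b0|b0] := eqVneq (cabs b) 0.
  move: H; rewrite b0 (cabs_eq0 b0)/= !mul0r addr0 mulr0 powR0// mulr0 addr0 subr0.
  move=> /powR_eq0_eq0/cabs_eq0 x0; rewrite eE x0 (cabs_eq0 b0).
  by rewrite subr0.
have B0 : 0 < cabs b by rewrite lt_neqAle cabs_ge0 eq_sym b0.
have E1 : cabs b `^ (p - 1) = cabs b `^ (p - 2) * cabs b.
  have -> : p - 1 = (p - 2) + 1 by ring.
  by rewrite powRD ?powRr1 ?cabs_ge0//; apply/implyP.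
have Pb : 0 < cabs b `^ (p - 2) by exact: powR_gt0.
have cs := cauchy_schwarz2 (complex.Re b) (complex.Im b) (complex.Re xi) (complex.Im xi).
rewrite -/(cabs b) -/(cabs xi) in cs.
rewrite E1 in h h'.
have cs2 : complex.Re b * complex.Re xi + complex.Im b * complex.Im xi = cabs b * cabs xi.
  apply/eqP; rewrite eq_le cs/= leNgt; apply/negP => lt.
  suff : 0 < 0 :> R by rewrite ltxx.
  rewrite -[X in _ < X]H; apply: le_lt_trans h _.
  rewrite ltrD2l ltrN2 -!mulrA ltr_pM2l; last by lra.
  by rewrite ltr_pM2l.
have xb : cabs xi = cabs b.
  by apply: h'; rewrite -H cs2; ring.
(* Expand |xi - b|^2 = |xi|^2 + |b|^2 - 2 |b| |xi|, where the two moduli are equal. *)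
apply: cabs_eq0; apply/eqP; rewrite -sqrf_eq0 cabs_sqr eE; apply/eqP.
have s1 := cabs_sqr b; have s2 := cabs_sqr xi; rewrite xb in s2 cs2.
move: s1 s2 cs2; move: b {H h h' eE b0 B0 E1 Pb cs xb} => [b1 b2]; case: xi => [x1 x2] /=.
by move=> s1 s2 s3; nra.
Qed.

End ComplexLemmas.

(** * Weights built from the quasi-norm and the logarithm *)

Section Weights.
Context {R : realType} {n : nat}.
Variables (nu : 'I_n -> R) (qn : Rn R n -> R) (R0 : R).
Hypotheses (hq : quasi_norm nu qn) (R00 : 0 < R0).
Implicit Type x : Rn R n.

Lemma qn_ge0 x : 0 <= qn x. Proof. by case: hq. Qed.

Lemma qn_continuous : continuous qn. Proof. by case: hq. Qed.

Lemma qn_dil (r : R) x : 0 < r -> qn (dil nu r x) = r * qn x.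
Proof. by case: hq => _ _ _ h _; exact: h. Qed.

Lemma qn_eq0 x : qn x = 0 <-> x = 0. Proof. by case: hq. Qed.

Lemma qn_gt0 x : x != 0 -> 0 < qn x.
Proof.
move=> x0; rewrite lt_neqAle qn_ge0 andbT eq_sym; apply/eqP => /qn_eq0.
exact/eqP.
Qed.

Lemma Lw_gt0 x : 0 < qn x -> qn x < R0 -> 0 < Lw qn R0 x.
Proof. by move=> q0 q1; rewrite /Lw ln_gt0// ltr_pdivlMr// mul1r. Qed.

(** Passing from the quotient to negative powers is unconditional ([weightE]), also where [qn] or
    [Lw] vanishes. *)
Definition weight (a b : R) x : R := qn x `^ (- a) * Lw qn R0 x `^ (- b).

Lemma weightE (a b : R) x : (qn x `^ a * Lw qn R0 x `^ b)^-1 = weight a b x.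
Proof. by rewrite invfM /weight !powRN. Qed.

Lemma weight_ge0 a b x : 0 <= weight a b x.
Proof. by rewrite mulr_ge0// powR_ge0. Qed.

Lemma measurable_qn : measurable_fun setT qn.
Proof. exact: continuous_measurable_Rn qn_continuous. Qed.

Lemma measurable_weight a b : measurable_fun setT (weight a b).
Proof.
apply: measurable_funM.
  by apply: (measurableT_comp (measurable_powR _)); exact: measurable_qn.
apply: (measurableT_comp (measurable_powR _)); rewrite /Lw.
apply: (measurableT_comp (@measurable_ln R)).
under eq_fun do rewrite -powR_inv1 ?qn_ge0//.
apply: measurable_funM => //.
by apply: (measurableT_comp (measurable_powR _)); exact: measurable_qn.
Qed.

Lemma weight_bounded (q0 q1 a b : R) : 0 < q0 -> q1 < R0 ->
  exists M : R, forall x, q0 <= qn x -> qn x <= q1 -> weight a b x <= M.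
Proof.
move=> q00 q1R.
exists ((q0 `^ (- a) + q1 `^ (- a)) * (ln (R0 / q1) `^ (- b) + ln (R0 / q0) `^ (- b))).
move=> x h1 h2; have qx : 0 < qn x by exact: lt_le_trans h1.
have q10 : 0 < q1 by exact: lt_le_trans h2.
apply: ler_pM; rewrite ?powR_ge0//; first exact: powR_le_endpoints.
apply: powR_le_endpoints.
- by rewrite ln_gt0// ltr_pdivlMr// mul1r.
- by rewrite /Lw ler_ln ?posrE ?divr_gt0// ler_pM2l// lef_pV2.
- by rewrite /Lw ler_ln ?posrE ?divr_gt0// ler_pM2l// lef_pV2.
Qed.

End Weights.

(** * Functions with compact support *)

Section Support.
Context {R : realType} {n : nat}.
Implicit Types (x : Rn R n) (K : set (Rn R n)) (g : Rn R n -> R).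

Lemma continuous_bounded_on K g : compact K -> {in K, continuous g} ->
  exists M : R, forall x, K x -> `|g x| <= M.
Proof.
move=> cK cg.
have := continuous_compact (continuous_in_subspaceT cg) cK.
move=> /compact_bounded[M [_ HM]]; exists (M + 1) => x Kx.
by apply: (HM (M + 1)); [rewrite ltrDl|exists x].
Qed.

Lemma euler_off_support (nu : 'I_n -> R) K g x : closed K ->
  (forall y, ~ K y -> g y = 0) -> ~ K x -> euler nu g x = 0.
Proof.
move=> cK g0 Kx; rewrite /euler big1// => i _.
have -> : 'D_(evec R i) g x = 'D_(evec R i) (cst 0 : Rn R n -> R) x.
  apply: near_eq_derive.
  have : nbhs x (~` K) by apply: open_nbhs_nbhs; split => //; exact: closed_openC.
  by apply: filterS => y; exact: g0.
by rewrite derive_cst mulr0.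
Qed.

Lemma compact_closed_Rn K : compact K -> closed K.
Proof. by move=> cK; apply: compact_closed => //; exact: norm_hausdorff. Qed.

End Support.

(** * The integral identity *)

Section BoundedSupport.
Context {R : realType} {n : nat}.
Implicit Types (x : Rn R n) (K : set (Rn R n)) (g h : Rn R n -> R).

(** A linear class containing every density of the identity. It asks for measurability rather than
    continuity because one density has the factor |f|^(p-2), which may be discontinuous at zeros of
    f. *)
Definition bsupp K g := [/\ measurable_fun setT g,
  exists M : R, forall x, K x -> `|g x| <= M & forall x, ~ K x -> g x = 0].

Lemma bsuppD K g h : bsupp K g -> bsupp K h -> bsupp K (fun x => g x + h x).
Proof.
move=> [mg [M gM] g0] [mh [N hN] h0]; split.
- exact: measurable_funD.
- by exists (M + N) => x Kx; rewrite (le_trans (ler_normD _ _))// lerD ?gM ?hN.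
- by move=> x Kx; rewrite g0// h0// addr0.
Qed.

Lemma bsuppZ K g (c : R) : bsupp K g -> bsupp K (fun x => c * g x).
Proof.
move=> [mg [M gM] g0]; split.
- exact: measurable_funM.
- by exists (`|c| * M) => x Kx; rewrite normrM ler_wpM2l ?gM.
- by move=> x Kx; rewrite g0// mulr0.
Qed.

Lemma bsupp_global K g : compact K -> bsupp K g ->
  exists M B : R, (forall x, `|g x| <= M) /\ (forall x, B < `|x| -> g x = 0).
Proof.
move=> /compact_bounded[B [_ HB]] [mg [M gM] g0].
exists `|M|, (B + 1); split => x.
  have [Kx|Kx] := pselect (K x); last by rewrite g0// normr0.
  by apply: le_trans (gM x Kx) _; exact: ler_norm.
move=> Bx; apply: g0 => Kx.
have : `|x| <= B + 1 by apply: (HB (B + 1)) => //; rewrite ltrDl.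
by rewrite leNgt Bx.
Qed.

Lemma bsupp_integrable (mu : {measure set (Rn R n) -> \bar R}) K g :
  is_lebesgue_measure mu -> compact K -> bsupp K g ->
  mu.-integrable setT (EFin \o g).
Proof.
move=> hmu cK bg; have [M [B [h1 h2]]] := bsupp_global cK bg.
by case: bg => mg _ _; exact: bounded_support_integrable h2.
Qed.

(** Passes from the ball, over which the quantities of the theorem are integrated, to the whole
    space, on which the dilations act. *)
Lemma Rintegral_supp (mu : {measure set (Rn R n) -> \bar R}) (D : set (Rn R n)) g :
  (forall x, ~ D x -> g x = 0) -> (\int[mu]_(x in D) g x = \int[mu]_x g x)%R.
Proof.
move=> g0; rewrite Rintegral_mkcond; apply: eq_Rintegral => x _.
rewrite patchE; case: ifPn => //; rewrite notin_setE => h.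
by rewrite g0.
Qed.

Lemma measurable_norm2 (u v : Rn R n -> R) : measurable_fun setT u ->
  measurable_fun setT v ->
  measurable_fun setT (fun x => cabs (Complex (u x) (v x))).
Proof.
move=> mu mv; rewrite /cabs/=.
apply: (measurableT_comp (continuous_measurable_fun (@sqrt_continuous R))).
by apply: measurable_funD; exact: measurable_funX.
Qed.

Lemma cabs_powR_bounded K (u v : Rn R n -> R) (a : R) : 0 <= a ->
  compact K -> continuous u -> continuous v ->
  exists M : R, forall x, K x -> `|cabs (Complex (u x) (v x)) `^ a| <= M.
Proof.
move=> a0 cK cu cv.
have [M hM] := continuous_bounded_on cK (in1W cu).
have [N hN] := continuous_bounded_on cK (in1W cv).
exists ((M + N) `^ a) => x Kx; rewrite ger0_norm ?powR_ge0//.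
have h : cabs (Complex (u x) (v x)) <= M + N.
  by apply: le_trans (sqrt_sqr_le _ _) _; rewrite lerD ?hM ?hN.
apply: ge0_ler_powR => //; rewrite nnegrE ?cabs_ge0//.
by apply: le_trans h; exact: cabs_ge0.
Qed.

End BoundedSupport.

(** * A fixed admissible function: densities, identity and equality case *)

Section Admissible.
Context {R : realType} {n : nat}.
Variables (nu : 'I_n -> R) (qn : Rn R n -> R)
  (mu : {measure set (Rn R n) -> \bar R}) (R0 p alpha beta : R).
Hypotheses (hmu : is_lebesgue_measure mu) (hq : quasi_norm nu qn)
  (R00 : 0 < R0) (p1 : 1 < p).
Variables (f : Rn R n -> R[i]) (K : set (Rn R n)).
Let u x := complex.Re (f x).
Let v x := complex.Im (f x).
Hypotheses (su : smooth u) (sv : smooth v) (cK : compact K)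
  (KR : K `<=` [set x | qn x < R0] `\ 0) (fK : forall x, ~ K x -> f x = 0).
Let Eu := euler nu u.
Let Ev := euler nu v.
Implicit Type x : Rn R n.

Let pp : 0 < p. Proof. exact: lt_trans ltr01 p1. Qed.
Let p0 : p != 0. Proof. exact: lt0r_neq0. Qed.

(** This includes x = 0: the orbit of 0 is constant, and the inverse of 0 is 0. *)
Lemma radderivE x :
  radderiv nu qn f x = Complex ((qn x)^-1 * Eu x) ((qn x)^-1 * Ev x).
Proof.
rewrite /radderiv; have [->|x0] := eqVneq x 0.
  have d0 (r : R) : dil nu r (0 : Rn R n) = 0.
    by apply/rowP => i; rewrite !mxE mulr0.
  have -> : qn 0 = 0 by apply/(qn_eq0 hq).
  rewrite invr0 !mul0r d0.
  by congr Complex; under eq_fun do rewrite d0; rewrite derive1_cst.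
have q0 := qn_gt0 hq x0.
have E : dil nu (qn x) (dil nu (qn x)^-1 x) = x.
  by rewrite dilM ?invr_ge0 ?(ltW q0)// mulfV ?gt_eqF// dil1.
have [_ hu] := is_derive_dil nu (dil nu (qn x)^-1 x) su q0.
have [_ hv] := is_derive_dil nu (dil nu (qn x)^-1 x) sv q0.
by rewrite !derive1E; congr Complex; [rewrite hu E|rewrite hv E].
Qed.

Lemma qn_support x : K x -> 0 < qn x /\ qn x < R0.
Proof.
by move=> /KR[/= h x0]; split => //; apply: (qn_gt0 hq); exact/eqP.
Qed.

(** The bounds come from boundedness of 1 / qn and 1 / (R0 - qn) on K, which covers an empty K as
    well; the 1 added to |M1| and |M2| keeps the denominators positive. *)
Lemma qn_support_bounds : exists q0 q1 : R, [/\ 0 < q0, q1 < R0 &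
  forall x, K x -> q0 <= qn x /\ qn x <= q1].
Proof.
have cq := qn_continuous hq.
have [M1 h1] : exists M : R, forall x, K x -> `|(qn x)^-1| <= M.
  apply: continuous_bounded_on => // x /set_mem Kx; have [q0 _] := qn_support Kx.
  by apply: (@cvgV _ _ (nbhs x) _ qn (qn x)); [exact: lt0r_neq0|exact: cq].
have [M2 h2] : exists M : R, forall x, K x -> `|(R0 - qn x)^-1| <= M.
  apply: continuous_bounded_on => // x /set_mem Kx; have [_ q1] := qn_support Kx.
  apply: (@cvgV _ _ (nbhs x) _ (fun y => R0 - qn y) (R0 - qn x)).
    by rewrite subr_eq0 gt_eqF.
  by apply: cvgB; [exact: cvg_cst|exact: cq].
exists (`|M1| + 1)^-1, (R0 - (`|M2| + 1)^-1); split.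
- by rewrite invr_gt0 ltr_wpDl.
- by rewrite ltrBlDr ltrDl invr_gt0 ltr_wpDl.
- move=> x Kx; have [q0 q1] := qn_support Kx.
  have := h1 x Kx; have := h2 x Kx.
  rewrite gtr0_norm ?invr_gt0 ?subr_gt0// => a.
  rewrite gtr0_norm ?invr_gt0// => b; split.
    rewrite -[leRHS]invrK lef_pV2 ?posrE ?invr_gt0 ?ltr_wpDl//.
    by apply: le_trans b _; apply: le_trans (ler_norm _) _; rewrite lerDl.
  rewrite lerBrDl -lerBrDr -[leRHS]invrK lef_pV2 ?posrE ?invr_gt0 ?subr_gt0 ?ltr_wpDl//.
  by apply: le_trans a _; apply: le_trans (ler_norm _) _; rewrite lerDl.
Qed.

Lemma bsupp_weight (g : Rn R n -> R) (a b : R) : measurable_fun setT g ->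
  (exists M : R, forall x, K x -> `|g x| <= M) -> (forall x, ~ K x -> g x = 0) ->
  bsupp K (fun x => g x * weight qn R0 a b x).
Proof.
move=> mg [M gM] g0; split.
- by apply: measurable_funM => //; exact: measurable_weight hq _ _.
- have [q0 [q1 [q00 q1R qK]]] := qn_support_bounds.
  have [N hN] : exists N : R, forall x, q0 <= qn x -> qn x <= q1 ->
      weight qn R0 a b x <= N by exact: weight_bounded.
  exists (M * N) => x Kx; have [h1 h2] := qK x Kx.
  rewrite normrM; apply: ler_pM => //; first exact: gM.
  by rewrite ger0_norm ?weight_ge0// hN.
- by move=> x Kx; rewrite g0// mul0r.
Qed.

Definition gradR x := cabs (Complex (Eu x) (Ev x)).
Definition innerR x := u x * Eu x + v x * Ev x.

(* Integrands of [I_Rf], [I_f], [I_f'] and of the cross term of [Cp], with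
   [|x| R_{|x|} f] replaced by the Euler field. *)
Definition dens_A x := gradR x `^ p * weight qn R0 (alpha + p) (beta + 1) x.
Definition dens_B x := cabs (f x) `^ p * weight qn R0 (alpha + p) (beta + p + 1) x.
Definition dens_h x := cabs (f x) `^ p * weight qn R0 (alpha + p) (beta + p) x.
Definition dens_D x := cabs (f x) `^ (p - 2) * innerR x *
  weight qn R0 (alpha + p) (beta + p) x.

Let closK : closed K. Proof. exact: compact_closed_Rn. Qed.
Let u0 x : ~ K x -> u x = 0. Proof. by move=> /fK; rewrite /u => ->. Qed.
Let v0 x : ~ K x -> v x = 0. Proof. by move=> /fK; rewrite /v => ->. Qed.
Let offball x : ~ qball qn R0 x -> ~ K x.
Proof. by move=> h /KR[]. Qed.
Let Eu0 x : ~ K x -> Eu x = 0. Proof. exact: euler_off_support. Qed.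
Let Ev0 x : ~ K x -> Ev x = 0. Proof. exact: euler_off_support. Qed.
Let cu := smooth_continuous su.
Let cv := smooth_continuous sv.
Let cEu := @continuous_euler R n nu u su.
Let cEv := @continuous_euler R n nu v sv.
Let mcu := continuous_measurable_Rn cu.
Let mcv := continuous_measurable_Rn cv.
Let mcEu := continuous_measurable_Rn cEu.
Let mcEv := continuous_measurable_Rn cEv.

Let cabsfE x : cabs (f x) = cabs (Complex (u x) (v x)).
Proof. by []. Qed.

Let f0 x : ~ K x -> cabs (f x) `^ p = 0.
Proof. by move=> /fK ->; rewrite cabs0 powR0. Qed.

Lemma bsupp_A : bsupp K dens_A.
Proof.
apply: bsupp_weight.
- apply: (measurableT_comp (measurable_powR _)); exact: measurable_norm2.
- by apply: cabs_powR_bounded => //; exact: ltW pp.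
- move=> x Kx; rewrite /gradR Eu0// Ev0//.
  by rewrite /cabs/= expr0n/= addr0 sqrtr0 powR0.
Qed.

Lemma bsupp_cabs_weight a b : bsupp K (fun x => cabs (f x) `^ p * weight qn R0 a b x).
Proof.
apply: bsupp_weight => //.
- apply: (measurableT_comp (measurable_powR _)); exact: measurable_norm2 mcu mcv.
- by apply: (@cabs_powR_bounded R n K u v) => //; exact: ltW pp.
Qed.

(** For p < 2 the factor |f|^(p-2) is unbounded near zeros of f. Cauchy-Schwarz gives [innerR] a
    factor |f|, and the product is controlled by |f|^(p-1). *)
Lemma bsupp_D : bsupp K dens_D.
Proof.
apply: bsupp_weight.
- apply: measurable_funM.
    apply: (measurableT_comp (measurable_powR _)); exact: measurable_norm2 mcu mcv.
  by apply: measurable_funD; exact: measurable_funM.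
- have p10 : 0 < p - 1 by rewrite subr_gt0.
  have [M hM] := cabs_powR_bounded (ltW p10) cK cu cv.
  have [N hN] := cabs_powR_bounded ler01 cK cEu cEv.
  exists (M * N) => x Kx.
  have h1 := hM x Kx; have h2 := hN x Kx.
  rewrite ger0_norm ?powR_ge0// in h1.
  rewrite ger0_norm ?powR_ge0// powRr1 ?cabs_ge0// in h2.
  rewrite normrM ger0_norm ?powR_ge0//.
  have h3 : `|innerR x| <= cabs (f x) * gradR x.
    rewrite ler_norml; apply/andP; split; last exact: cauchy_schwarz2.
    rewrite lerNl /innerR opprD -!mulNr.
    by have := cauchy_schwarz2 (- u x) (- v x) (Eu x) (Ev x); rewrite !sqrrN.
  apply: (@le_trans _ _ (cabs (f x) `^ (p - 2) * (cabs (f x) * gradR x))).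
    by apply: ler_wpM2l => //; exact: powR_ge0.
  rewrite mulrA [_ * cabs (f x)]mulrC (_ : p - 2 = p - 1 - 1); last by ring.
  rewrite mulr_powRB1 ?cabs_ge0//.
  by apply: ler_pM => //; rewrite ?powR_ge0 ?cabs_ge0.
- by move=> x Kx; rewrite /innerR u0// v0// !mul0r addr0 mulr0.
Qed.

(** The product rule along an orbit: |f|^p produces [dens_D], the power of |x| reproduces [dens_h],
    and L^(-beta-p) produces (beta+p) [dens_B] because the Euler field maps L to -1. *)
Lemma is_derive_dens_h x (r : R) : 0 < r ->
  is_derive r 1 (fun r => dens_h (dil nu r x))
   (r^-1 * (p * dens_D (dil nu r x) - (alpha + p) * dens_h (dil nu r x)
            + (beta + p) * dens_B (dil nu r x))).
Proof.
move=> r0.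
have [Ky|Ky] := pselect (K (dil nu r x)); last first.
  have [_ _ hD] := bsupp_D.
  rewrite hD// /dens_h /dens_B f0// !mul0r !mulr0 subr0 addr0 mulr0.
  (* K is closed, so the orbit stays outside K for nearby parameters and the function is locally 0,
     even at points where the weight is singular. *)
  apply: near_eq_is_derive (is_derive_fcst 0 r).
  have cd : dil nu s x @[s --> r] --> dil nu r x.
    apply/cvg_ballP => e e0.
    have H k : \forall s \near r,
        ball (r `^ nu k * x ord0 k) e (s `^ nu k * x ord0 k).
      have : (s `^ nu k * x ord0 k) @[s --> r] --> r `^ nu k * x ord0 k.
        by apply: cvgMl; exact: (@powR_cvg_pos R R (nbhs r) _ id r).
      by move/cvg_ballP => /(_ e e0).
    near=> s; split => // i j; rewrite ord1 !mxE.
    have : forall k, ball (r `^ nu k * x ord0 k) e (s `^ nu k * x ord0 k).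
      by near: s; exact: filter_forall.
    exact.
  have H := cd (~` K) (open_nbhs_nbhs (conj (closed_openC closK) Ky)).
  near=> s; have h : ~ K (dil nu s x) by near: s; exact: H.
  by rewrite f0// mul0r.
have [qy qyR] := qn_support Ky.
rewrite qn_dil// in qy qyR.
have q0 : 0 < qn x by rewrite pmulr_rgt0 in qy.
pose l (s : R) := ln R0 - ln (s * qn x).
have lE (s : R) : 0 < s -> ln (R0 / (s * qn x)) = l s.
  by move=> s0; rewrite lnM ?posrE ?invr_gt0 ?mulr_gt0// lnV ?posrE ?mulr_gt0.
have dq := is_derive_fMr (qn x) r.
have dl : is_derive r 1 l (- r^-1) by exact: is_derive_log_ratio.
have l0 : 0 < l r by rewrite -lE// ln_gt0// ltr_pdivlMr// mul1r.
have dN := is_derive_norm_powR p1 (is_derive_dil nu x su r0) (is_derive_dil nu x sv r0).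
have dw := is_derive_fM (@is_derive_fpowR R (fun s => s * qn x) r _ (- (alpha + p)) qy dq)
  (is_derive_fpowR (- (beta + p)) l0 dl).
apply: near_eq_is_derive (is_derive_eq (is_derive_fM dN dw) _).
  near=> s; have s0 : 0 < s by near: s; exact: lt_nbhsr.
  rewrite /dens_h /weight /Lw (qn_dil hq)//.
  by rewrite lE.
rewrite /dens_D /dens_h /dens_B /weight /Lw (qn_dil hq)// lE// /innerR -/Eu -/Ev.
rewrite -/(u (dil nu r x)) -/(v (dil nu r x)).
rewrite (_ : - (beta + p + 1) = - (beta + p) - 1); last by ring.
rewrite (_ : Num.sqrt (u (dil nu r x) ^+ 2 + v (dil nu r x) ^+ 2) = cabs (f (dil nu r x)))//.
have -> : (r * qn x) `^ (- (alpha + p) - 1) = (r * qn x) `^ (- (alpha + p)) / (r * qn x).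
  by rewrite powRB ?powRr1 ?(ltW qy)//; apply/implyP => _; rewrite gt_eqF.
by field; rewrite !gt_eqF.
Unshelve. all: by end_near. Qed.

Lemma Rintegral_dens : p * (\int[mu]_x dens_D x)%R - (alpha + p) * (\int[mu]_x dens_h x)%R
   + (beta + p) * (\int[mu]_x dens_B x)%R = - hdim nu * (\int[mu]_x dens_h x)%R.
Proof.
pose Eh x := p * dens_D x + (- (alpha + p)) * dens_h x + (beta + p) * dens_B x.
have bD := bsupp_D; have bh : bsupp K dens_h by exact: bsupp_cabs_weight.
have bB : bsupp K dens_B by exact: bsupp_cabs_weight.
have b1 := bsuppZ p bD; have b2 := bsuppZ (- (alpha + p)) bh.
have b3 := bsuppZ (beta + p) bB.
have b12 := bsuppD b1 b2.
have bE : bsupp K Eh by exact: bsuppD.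
have [M [B [h1 h2]]] := bsupp_global cK bE.
have [M' [B' [h1' h2']]] := bsupp_global cK bh.
have <- : (\int[mu]_x Eh x)%R = - hdim nu * (\int[mu]_x dens_h x)%R.
  apply: (@Rintegral_euler R n nu mu dens_h Eh (Num.max M M') (Num.max B B')) => //.
  - by case: bh.
  - by case: bE.
  - by move=> x; rewrite le_max h1' orbT.
  - by move=> x; rewrite le_max h1.
  - by move=> x; rewrite gt_max => /andP[_ h]; exact: h2'.
  - by move=> x; rewrite gt_max => /andP[h _]; exact: h2.
  - move=> x r r0; apply: (is_derive_eq (is_derive_dens_h x r0)).
    by rewrite /Eh mulNr.
have i1 := bsupp_integrable hmu cK b1; have i2 := bsupp_integrable hmu cK b2.
have i3 := bsupp_integrable hmu cK b3; have i12 := bsupp_integrable hmu cK b12.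
rewrite /Eh RintegralD// RintegralD// !RintegralZl//;
  by [rewrite mulNr|exact: bsupp_integrable hmu cK _].
Qed.

Let kap : R := (beta + p) / p.

Lemma I_fE : I_f qn mu R0 p alpha beta f = (\int[mu]_x dens_B x)%R.
Proof.
rewrite /I_f Rintegral_supp; last by move=> x /offball h; rewrite f0// mul0r.
by apply: eq_Rintegral => x _; rewrite weightE.
Qed.

Lemma I_f'E : I_f' qn mu R0 p alpha beta f = (\int[mu]_x dens_h x)%R.
Proof.
rewrite /I_f' Rintegral_supp; last by move=> x /offball h; rewrite f0// mul0r.
by apply: eq_Rintegral => x _; rewrite weightE.
Qed.

Let gradR0 x : ~ K x -> gradR x = 0.
Proof. by move=> h; rewrite /gradR Eu0// Ev0// -[RHS](@cabs0 R). Qed.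

Let cabs_radderiv x : 0 < qn x -> cabs (radderiv nu qn f x) = gradR x * (qn x)^-1.
Proof.
move=> q0; rewrite radderivE ![(qn x)^-1 * _]mulrC cabs_scale.
by rewrite ger0_norm// invr_ge0 ltW.
Qed.

Lemma I_RfE : I_Rf nu qn mu R0 p alpha beta f = (\int[mu]_x dens_A x)%R.
Proof.
have off x : ~ K x -> cabs (radderiv nu qn f x) `^ p = 0.
  move=> h; rewrite radderivE Eu0// Ev0// !mulr0.
  by rewrite (_ : Complex (0 : R) 0 = 0)// cabs0 powR0.
rewrite /I_Rf Rintegral_supp; last by move=> x /offball h; rewrite off// mul0r.
apply: eq_Rintegral => x _; rewrite weightE /dens_A.
have [Kx|Kx] := pselect (K x); last by rewrite off// gradR0// powR0// !mul0r.
have [q0 _] := qn_support Kx.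
rewrite cabs_radderiv// powRM ?cabs_ge0 ?invr_ge0 ?(ltW q0)//.
rewrite -powR_inv1 ?(ltW q0)// -powRrM /weight !mulrA; congr (_ * _).
rewrite -mulrA -powRD; last by apply/implyP => _; rewrite gt_eqF.
by congr (_ * _ `^ _); ring.
Qed.

Let wpow (q l a b c : R) : 0 < q -> 0 < l ->
  (q `^ a * l `^ b) `^ c = q `^ (a * c) * l `^ (b * c).
Proof. by move=> q0 l0; rewrite powRM ?powR_ge0// -!powRrM. Qed.

Let wmul (q l a b a' b' : R) : 0 < q -> 0 < l ->
  (q `^ a * l `^ b) * (q `^ a' * l `^ b') = q `^ (a + a') * l `^ (b + b').
Proof.
move=> q0 l0; rewrite !powRD; first by ring.
  by apply/implyP => _; rewrite gt_eqF.
by apply/implyP => _; rewrite gt_eqF.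
Qed.

(** [s1] and [s2] are p-th roots of the weights of [dens_B] and [dens_A]. They factor out of xi -
    eta and xi, and s1^(p-1) s2 is the weight of the cross term [dens_D]. *)
Let s1 x := qn x `^ (- ((alpha + p) / p)) * Lw qn R0 x `^ (- ((beta + p + 1) / p)).
Let s2 x := qn x `^ (- ((alpha + p) / p)) * Lw qn R0 x `^ (- ((beta + 1) / p)).

Lemma xi_fE x : 0 < qn x -> xi_f nu qn R0 p alpha beta f x = Complex (Eu x * s2 x) (Ev x * s2 x).
Proof.
move=> q0; rewrite /xi_f complex_div_real weightE radderivE/= /s2 /weight.
have -> : - ((alpha + p) / p) = -1 + - (alpha / p) by field.
rewrite powRD ?powR_inv1 ?(ltW q0)//; last by apply/implyP => _; rewrite gt_eqF.
by congr Complex; ring.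
Qed.

Lemma eta_f_diff x : 0 < qn x ->
  xi_f nu qn R0 p alpha beta f x - eta_f nu qn R0 p alpha beta f x =
  Complex (u x * (- kap * s1 x)) (v x * (- kap * s1 x)).
Proof.
move=> q0; rewrite /eta_f opprD addrA subrr sub0r complex_div_real weightE.
rewrite [_ * f x]mulrC complex_scale /= /s1 /weight -/kap.
by apply/eqP; rewrite eq_complex/= -/(u x) -/(v x); apply/andP; split; apply/eqP; ring.
Qed.

Lemma Cp_dens x : Cp p (xi_f nu qn R0 p alpha beta f x) (eta_f nu qn R0 p alpha beta f x) =
  dens_A x + (p - 1) * `|kap| `^ p * dens_B x + p * kap * `|kap| `^ (p - 2) * dens_D x.
Proof.
have [Kx|Kx] := pselect (K x); last first.
  have [_ _ hA] := bsupp_A; have [_ _ hD] := bsupp_D.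
  rewrite hA// hD// /dens_B f0// mul0r !mulr0 !addr0.
  have -> : eta_f nu qn R0 p alpha beta f x = xi_f nu qn R0 p alpha beta f x.
    by rewrite /eta_f fK// mulr0 mul0r addr0.
  have -> : xi_f nu qn R0 p alpha beta f x = 0.
    by rewrite /xi_f radderivE Eu0// Ev0// !mulr0 mul0r.
  by rewrite /Cp eqxx subrr cabs0 powR0// !subr0.
have [q0 qR] := qn_support Kx; have l0 := Lw_gt0 q0 qR.
rewrite CpE// eta_f_diff// xi_fE//= !cabs_scale -/(gradR x).
have s10 : 0 < s1 x by rewrite mulr_gt0// powR_gt0.
have s20 : 0 < s2 x by rewrite mulr_gt0// powR_gt0.
have P2 : s2 x `^ p = weight qn R0 (alpha + p) (beta + 1) x.
  by rewrite /s2 wpow// /weight; congr (_ `^ _ * _ `^ _); field.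
have P1 : s1 x `^ p = weight qn R0 (alpha + p) (beta + p + 1) x.
  by rewrite /s1 wpow// /weight; congr (_ `^ _ * _ `^ _); field.
have E : s1 x `^ (p - 2) * (s1 x * s2 x) = weight qn R0 (alpha + p) (beta + p) x.
  by rewrite /s1 /s2 wpow// !wmul// /weight; congr (_ `^ _ * _ `^ _); field.
rewrite /dens_A /dens_B /dens_D -P1 -P2 -E.
move: (s1 x) (s2 x) s10 s20 {P1 P2 E} => a b a0 b0.
rewrite (normrM (- kap)) normrN (gtr0_norm a0) (gtr0_norm b0).
rewrite !powRM ?cabs_ge0 ?mulr_ge0 ?(ltW a0) ?(ltW b0)//.
rewrite -cabsfE /innerR -/(u x) -/(v x).
by ring.
Qed.

Lemma bsupp_Cp : bsupp K (fun x =>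
  Cp p (xi_f nu qn R0 p alpha beta f x) (eta_f nu qn R0 p alpha beta f x)).
Proof.
rewrite (_ : (fun x => Cp _ _ _) = (fun x => dens_A x + (p - 1) * `|kap| `^ p * dens_B x +
  p * kap * `|kap| `^ (p - 2) * dens_D x)); last by apply/funext => x; rewrite Cp_dens.
apply: bsuppD; last by apply: bsuppZ; exact: bsupp_D.
by apply: bsuppD; [exact: bsupp_A|apply: bsuppZ; exact: bsupp_cabs_weight].
Qed.

Lemma I_CpE : I_Cp nu qn mu R0 p alpha beta f = (\int[mu]_x
  Cp p (xi_f nu qn R0 p alpha beta f x) (eta_f nu qn R0 p alpha beta f x))%R.
Proof.
rewrite /I_Cp Rintegral_supp// => x /offball.
by have [_ _] := bsupp_Cp; exact.
Qed.

(** [Rintegral_dens] eliminates the cross term. This brings in -p |kap|^p times the integral of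
    [dens_B], which combines with the (p-1) |kap|^p of the remainder into -|kap|^p. *)
Lemma hardy_identity : `|kap| `^ p * I_f qn mu R0 p alpha beta f =
  I_Rf nu qn mu R0 p alpha beta f -
  (hdim nu - alpha - p) * kap * `|kap| `^ (p - 2) * I_f' qn mu R0 p alpha beta f -
  I_Cp nu qn mu R0 p alpha beta f.
Proof.
rewrite I_fE I_f'E I_RfE I_CpE.
have bB : bsupp K dens_B by exact: bsupp_cabs_weight.
have bB' := bsuppZ ((p - 1) * `|kap| `^ p) bB.
have bD' := bsuppZ (p * kap * `|kap| `^ (p - 2)) bsupp_D.
have bAB := bsuppD bsupp_A bB'.
have -> : (\int[mu]_x Cp p (xi_f nu qn R0 p alpha beta f x)
    (eta_f nu qn R0 p alpha beta f x))%R = (\int[mu]_x dens_A x)%R +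
    (p - 1) * `|kap| `^ p * (\int[mu]_x dens_B x)%R +
    p * kap * `|kap| `^ (p - 2) * (\int[mu]_x dens_D x)%R.
  under eq_Rintegral do rewrite Cp_dens.
  rewrite RintegralD//; [|exact: bsupp_integrable bAB|exact: bsupp_integrable bD'].
  rewrite RintegralD//; [|exact: bsupp_integrable bsupp_A|exact: bsupp_integrable bB'].
  rewrite !RintegralZl//; [exact: bsupp_integrable bsupp_D|exact: bsupp_integrable bB].
have H := Rintegral_dens.
(* For kap = 0 both sides are 0, whatever the power p - 2 is there; otherwise the exponents add
   up. *)
have kE : `|kap| `^ p = kap * `|kap| `^ (p - 2) * kap.
  have [k0|k0] := eqVneq kap 0; first by rewrite k0 normr0 powR0// !mul0r.
  rewrite mulrAC -expr2 -(real_normK (num_real kap)) -powR_mulrn// -powRD.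
    by rewrite addrC subrK.
  by apply/implyP => _; rewrite normr_eq0.
rewrite kE.
set iA := (\int[mu]_x dens_A x)%R; set iB := (\int[mu]_x dens_B x)%R.
set ih := (\int[mu]_x dens_h x)%R in H *; set iD := (\int[mu]_x dens_D x)%R in H *.
rewrite -/iB in H.
have bk : beta + p = p * kap by rewrite /kap; field.
rewrite bk in H.
have -> : p * kap * `|kap| `^ (p - 2) * iD = kap * `|kap| `^ (p - 2) * (p * iD) by ring.
have -> : p * iD = - hdim nu * ih + (alpha + p) * ih - p * kap * iB by rewrite -H; ring.
by ring.
Qed.

Lemma ICp_ge0 : 0 <= I_Cp nu qn mu R0 p alpha beta f.
Proof. by apply: Rintegral_ge0 => x _; exact: Cp_ge0. Qed.

Lemma I_f'_ge0 : 0 <= I_f' qn mu R0 p alpha beta f.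
Proof.
by apply: Rintegral_ge0 => x _; rewrite divr_ge0 ?mulr_ge0 ?powR_ge0.
Qed.

Lemma hardy_inequality : 0 <= (hdim nu - alpha - p) * (beta + p) ->
  `|kap| `^ p * I_f qn mu R0 p alpha beta f <= I_Rf nu qn mu R0 p alpha beta f.
Proof.
move=> h; rewrite hardy_identity -addrA gerDl -opprD oppr_le0.
apply: addr_ge0; last exact: ICp_ge0.
rewrite mulr_ge0 ?I_f'_ge0// mulr_ge0 ?powR_ge0// /kap mulrA.
by rewrite mulr_ge0// invr_ge0 ltW.
Qed.

(** L^(-kap) is an integrating factor: g L^(-kap) is constant on the ray through x. Followed
    outwards, the ray leaves K before reaching the sphere |x| = R0, so the constant is 0. *)
Lemma ray_zero (g : Rn R n -> R) : smooth g -> (forall x, ~ K x -> g x = 0) ->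
  (forall x, x != 0 -> qn x < R0 -> Lw qn R0 x * euler nu g x + kap * g x = 0) ->
  forall x, g x = 0.
Proof.
move=> sg g0 hg x.
have [Kx|] := pselect (K x); last exact: g0.
have [q0 qR] := qn_support Kx.
have [q0' [q1 [_ q1R qK]]] := qn_support_bounds.
(* The dilate of x by [t1] has quasi-norm halfway between max(qn x, q1) and R0: beyond K, still
   inside the ball, and with t1 > 1. *)
pose t1 := (Num.max (qn x) q1 + R0) / 2 / qn x.
have m1 : qn x <= Num.max (qn x) q1 by rewrite le_max lexx.
have m2 : q1 <= Num.max (qn x) q1 by rewrite le_max lexx orbT.
have m3 : Num.max (qn x) q1 < R0 by rewrite gt_max qR.
move: (Num.max _ _) m1 m2 m3 @t1 => m m1 m2 m3 t1.
have t1q : t1 * qn x = (m + R0) / 2 by rewrite /t1 divfK// gt_eqF.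
have t11 : 1 < t1 by rewrite /t1 ltr_pdivlMr// mul1r; lra.
pose l (s : R) := ln R0 - ln (s * qn x).
pose phi (s : R) := g (dil nu s x) * l s `^ (- kap).
have dphi (r : R) : 0 < r -> r * qn x < R0 -> is_derive r 1 phi 0.
  move=> r0 rR; have qy : 0 < r * qn x by rewrite mulr_gt0.
  have lE : ln (R0 / (r * qn x)) = l r.
    by rewrite lnM ?posrE ?invr_gt0// lnV.
  have dl : is_derive r 1 l (- r^-1) by exact: is_derive_log_ratio.
  have l0 : 0 < l r by rewrite -lE ln_gt0// ltr_pdivlMr// mul1r.
  apply: (is_derive_eq (is_derive_fM (is_derive_dil nu x sg r0)
    (is_derive_fpowR (- kap) l0 dl))).
  have y0 : dil nu r x != 0.
    by apply/eqP => /(qn_eq0 hq); rewrite (qn_dil hq)// => /eqP; rewrite gt_eqF.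
  have := hg _ y0; rewrite (qn_dil hq)// => /(_ rR).
  rewrite /Lw (qn_dil hq)// lE => E.
  have -> : l r `^ (- kap) = l r `^ (- kap - 1) * l r.
    rewrite -{3}(powRr1 (ltW l0)) -powRD ?subrK//.
    by apply/implyP => _; rewrite gt_eqF.
  transitivity (r^-1 * l r `^ (- kap - 1) *
    (l r * euler nu g (dil nu r x) + kap * g (dil nu r x))); last by rewrite E mulr0.
  by ring.
have rng (s : R) : 1 <= s -> s <= t1 -> is_derive s 1 phi 0.
  move=> s1' s2'; apply: dphi; first by lra.
  have : s * qn x <= t1 * qn x by rewrite ler_pM2r.
  by rewrite t1q => ?; lra.
have [| |c _ E] := @MVT R phi (fun=> 0) 1 t1 t11.
- by move=> s; rewrite in_itv/= => /andP[? ?]; apply: rng; exact: ltW.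
- apply: continuous_in_subspaceT => s; rewrite inE/= in_itv/= => /andP[? ?].
  apply: differentiable_continuous; apply/derivable1_diffP.
  by have [] := rng s.
move: E; rewrite mul0r /phi dil1 g0; last first.
  move=> Kt; have [_] := qK _ Kt; rewrite (qn_dil hq)//; last by lra.
  by rewrite t1q => ?; lra.
rewrite mul0r sub0r => /eqP; rewrite oppr_eq0 mulf_eq0 => /orP[/eqP//|].
have l0 : 0 < l 1.
  rewrite /l mul1r subr_gt0 ltr_ln ?posrE//.
by rewrite gt_eqF// powR_gt0.
Unshelve. all: by end_near. Qed.

(** Since s2 = s1 L, dividing eta = 0 by [s1] leaves the equation whose solutions along rays are the
    multiples of L^kap. *)
Lemma eta_eq0_ode x : 0 < qn x -> qn x < R0 ->
  eta_f nu qn R0 p alpha beta f x = 0 ->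
  Lw qn R0 x * Eu x + kap * u x = 0 /\ Lw qn R0 x * Ev x + kap * v x = 0.
Proof.
move=> q0 qR e0; have l0 := Lw_gt0 q0 qR.
have := eta_f_diff q0; rewrite e0 subr0 xi_fE// => -[h1 h2].
have s10 : 0 < s1 x by rewrite mulr_gt0// powR_gt0.
have E : s2 x = s1 x * Lw qn R0 x.
  rewrite /s1 /s2 -mulrA -{3}(powRr1 (ltW l0)) -powRD; last first.
    by apply/implyP => _; rewrite gt_eqF.
  by congr (_ * _ `^ _); field.
rewrite E in h1 h2; split; apply/eqP.
- rewrite -(mulrI_eq0 _ (lregP (lt0r_neq0 s10))).
  by apply/eqP; rewrite mulrDr; transitivity (Eu x * (s1 x * Lw qn R0 x) + kap * u x * s1 x);
    [ring|rewrite h1; ring].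
- rewrite -(mulrI_eq0 _ (lregP (lt0r_neq0 s10))).
  by apply/eqP; rewrite mulrDr; transitivity (Ev x * (s1 x * Lw qn R0 x) + kap * v x * s1 x);
    [ring|rewrite h2; ring].
Qed.

Lemma continuous_Lw x : 0 < qn x -> {for x, continuous (Lw qn R0)}.
Proof.
move=> q0; rewrite /Lw.
have c1 : R0 / qn y @[y --> x] --> R0 / qn x.
  apply: (@cvgM _ _ (nbhs x) _ (fun=> R0) (fun y => (qn y)^-1)); first exact: cvg_cst.
  apply: (@cvgV _ _ (nbhs x) _ qn (qn x)); first exact: lt0r_neq0.
  exact: (@qn_continuous _ _ _ _ hq x).
by apply: (cvg_comp _ _ c1); apply: continuous_ln; rewrite divr_gt0.
Qed.

Let continuous_ode (g : Rn R n -> R) x : 0 < qn x ->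
  {for x, continuous g} -> {for x, continuous (euler nu g)} ->
  {for x, continuous (fun y => Lw qn R0 y * euler nu g y + kap * g y)}.
Proof.
move=> q0 cg cEg; apply: (@cvgD _ _ _ (nbhs x) _
  (fun y => Lw qn R0 y * euler nu g y) (fun y => kap * g y)).
  apply: (@cvgM _ _ (nbhs x) _ (Lw qn R0) (euler nu g)) => //.
  exact: continuous_Lw.
by apply: (@cvgM _ _ (nbhs x) _ (fun=> kap) g) => //; exact: cvg_cst.
Qed.

(** Almost everywhere is upgraded to everywhere through the continuous function H = L Eg + kap g for
    g = u and g = v: if H were nonzero at a point, then C_p would be nonzero on a neighbourhood, and
    its integral positive. *)
Lemma ICp_eq0 : I_Cp nu qn mu R0 p alpha beta f = 0 -> f = (fun=> 0).
Proof.
rewrite I_CpE; set g := (fun x => Cp _ _ _) => Ig.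
have g0 x : 0 <= g x by exact: Cp_ge0.
have ig := bsupp_integrable hmu cK bsupp_Cp.
have nz (H : Rn R n -> R) : (forall x, 0 < qn x -> {for x, continuous H}) ->
   (forall x, 0 < qn x -> qn x < R0 -> H x != 0 -> g x != 0) ->
   forall x, x != 0 -> qn x < R0 -> H x = 0.
  move=> cH Hg x x0 xR; apply: contrapT => /eqP Hx.
  have q0 := qn_gt0 hq x0.
  pose U := [set y | [/\ 0 < qn y, qn y < R0 & H y != 0]].
  have Ux : nbhs x U.
    have a1 : \forall y \near x, 0 < qn y.
      exact: (cvgr_gt _ (@qn_continuous _ _ _ _ hq x)).
    have a2 : \forall y \near x, qn y < R0.
      exact: (cvgr_lt _ (@qn_continuous _ _ _ _ hq x)).
    have a3 : \forall y \near x, H y != 0.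
      exact: (@cvgr_neq0 _ _ _ (nbhs x) _ H (H x) (cH x q0) Hx).
    near=> y; split; near: y; [exact: a1|exact: a2|exact: a3].
  have gU y : interior U y -> g y != 0.
    by move=> /interior_subset[y1 y2 y3]; exact: Hg.
  have := Rintegral_gt0 hmu ig g0 (@open_interior _ U) Ux gU.
  by rewrite Ig ltxx.
have uz : forall x, u x = 0.
  apply: ray_zero => //; apply: nz.
    by move=> x q0; apply: continuous_ode => //; [exact: cu|exact: cEu].
  move=> x q0 qR; apply: contra_neq => gx.
  by have [] := eta_eq0_ode q0 qR (Cp_eq0 p1 gx).
have vz : forall x, v x = 0.
  apply: ray_zero => //; apply: nz.
    by move=> x q0; apply: continuous_ode => //; [exact: cv|exact: cEv].
  move=> x q0 qR; apply: contra_neq => gx.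
  by have [] := eta_eq0_ode q0 qR (Cp_eq0 p1 gx).
apply/funext => x; have := uz x; have := vz x; rewrite /u /v.
by case: (f x) => a b /= -> ->.
Unshelve. all: by end_near. Qed.

End Admissible.

(** * Smooth test functions *)

Section SmoothOneVariable.
Context {R : realType}.
Implicit Types (U V : set R) (f g : R -> R) (k m : nat).

(** Existence of k successive derivatives on U. Derivatives of order below k are then continuous, so
    having this for all k is smoothness, and the recursion suits induction on k. *)
Fixpoint Ck U k f : Prop :=
  match k with
  | 0 => True
  | k'.+1 => (forall x : R, U x -> derivable f x 1) /\ Ck U k' (derive1 f)
  end.

Lemma is_derive_derive1 f (x : R) : derivable f x 1 -> is_derive x 1 f (derive1 f x).
Proof. by move=> h; split => //; rewrite derive1E. Qed.

Lemma derive1_eq f (x d : R) : is_derive x 1 f d -> derive1 f x = d.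
Proof. by move=> [_ <-]; rewrite derive1E. Qed.

Lemma Ck_ext U k f g : open U -> (forall x, U x -> f x = g x) -> Ck U k f -> Ck U k g.
Proof.
move=> oU; elim: k f g => [//|k IH] f g fg [df cf].
have nfg (x : R) : U x -> \forall y \near x, f y = g y.
  by move=> Ux; apply: filterS fg _; exact: open_nbhs_nbhs.
have dg (x : R) : U x -> is_derive x 1 g (derive1 f x).
  move=> Ux; apply: (near_eq_is_derive (nfg x Ux)).
  exact: is_derive_derive1 (df x Ux).
split; first by move=> x Ux; have [] := dg x Ux.
by apply: IH cf => x Ux; rewrite (derive1_eq (dg x Ux)).
Qed.

Lemma Ck_derive U k f g : open U -> (forall x, U x -> is_derive x 1 f (g x)) ->
  Ck U k g -> Ck U k.+1 f.
Proof.
move=> oU h cg; split; first by move=> x Ux; have [] := h x Ux.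
by apply: Ck_ext cg => // x Ux; rewrite (derive1_eq (h x Ux)).
Qed.

Lemma Ck_pred U k f : Ck U k.+1 f -> Ck U k f.
Proof. by elim: k f => [//|k IH] f [h1 h2]; split => //; exact: IH. Qed.

(** Lets [profile] be treated by different formulas on two overlapping open sets. *)
Lemma Ck_union U V k f : Ck U k f -> Ck V k f -> Ck (U `|` V) k f.
Proof.
elim: k f => [//|k IH] f [h1 h2] [h3 h4]; split; last exact: IH.
by move=> x [Ux|Vx]; [exact: h1|exact: h3].
Qed.

Lemma Ck_cst U k (c : R) : open U -> Ck U k (fun=> c).
Proof.
move=> oU; elim: k c => [//|k IH] c.
apply: (@Ck_derive _ _ _ (fun=> 0) oU); exact: IH.
Qed.

Lemma Ck_id U k : open U -> Ck U k (fun x => x).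
Proof.
move=> oU; case: k => [//|k].
apply: (@Ck_derive _ _ _ (fun=> 1) oU); exact: Ck_cst.
Qed.

Lemma CkD U k f g : open U -> Ck U k f -> Ck U k g -> Ck U k (fun x => f x + g x).
Proof.
move=> oU; elim: k f g => [//|k IH] f g [f1 f2] [g1 g2].
apply: (@Ck_derive _ _ _ (fun x => derive1 f x + derive1 g x) oU); last exact: IH.
by move=> x Ux; apply: is_derive_fD; apply: is_derive_derive1; [exact: f1|exact: g1].
Qed.

Lemma CkM U k f g : open U -> Ck U k f -> Ck U k g -> Ck U k (fun x => f x * g x).
Proof.
move=> oU; elim: k f g => [//|k IH] f g cf cg.
have [f1 f2] := cf; have [g1 g2] := cg.
apply: (@Ck_derive _ _ _ (fun x => derive1 f x * g x + f x * derive1 g x) oU).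
  by move=> x Ux; apply: is_derive_fM; apply: is_derive_derive1; [exact: f1|exact: g1].
by apply: CkD => //; apply: IH => //; exact: Ck_pred.
Qed.

Lemma Ck_comp U V k f g : open U -> open V -> (forall x, U x -> V (g x)) ->
  Ck V k f -> Ck U k g -> Ck U k (fun x => f (g x)).
Proof.
move=> oU oV gUV; elim: k f g gUV => [//|k IH] f g gUV [f1 f2] cg.
have [g1 g2] := cg.
apply: (@Ck_derive _ _ _ (fun x => derive1 f (g x) * derive1 g x) oU).
  move=> x Ux; apply: is_derive_fcomp; apply: is_derive_derive1; last exact: g1.
  by apply: f1; exact: gUV.
by apply: CkM => //; apply: IH => //; exact: Ck_pred.
Qed.

Lemma CkV U k f : open U -> (forall x, U x -> f x != 0) -> Ck U k f ->
  Ck U k (fun x => (f x)^-1).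
Proof.
move=> oU f0; elim: k => [//|k IH] cf; have [f1 f2] := cf.
apply: (@Ck_derive _ _ _ (fun x => (-1) * derive1 f x * ((f x)^-1 * (f x)^-1)) oU).
  move=> x Ux; apply: (is_derive_eq (is_deriveV (f0 x Ux) (is_derive_derive1 (f1 x Ux)))).
  by rewrite /GRing.scale/= expr2 invfM; ring.
have cV := IH (Ck_pred cf).
by apply: CkM => //; apply: CkM => //; exact: Ck_cst.
Qed.

Lemma Ck_powR k (a : R) : Ck [set x | 0 < x] k (fun x => x `^ a).
Proof.
have oU : open [set x : R | 0 < x] by exact: open_gt.
elim: k a => [//|k IH] a.
apply: (@Ck_derive _ _ _ (fun x => a * x `^ (a - 1)) oU).
by apply: CkM => //; exact: Ck_cst.
Qed.

Lemma Ck_affine U k (a b : R) : open U -> Ck U k (fun x => a * x + b).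
Proof.
move=> oU; apply: CkD => //; last exact: Ck_cst.
by apply: CkM => //; [exact: Ck_cst|exact: Ck_id].
Qed.

(** The exponent m makes the family closed under differentiation: the derivative combines the
    members m + 1 and m + 2. *)
Definition flat m (x : R) : R := if 0 < x then x^-1 ^+ m * expR (- x^-1) else 0.

Lemma flat_ge0 m x : 0 <= flat m x.
Proof.
rewrite /flat; case: ifP => // x0.
by rewrite mulr_ge0 ?expR_ge0// exprn_ge0// invr_ge0 ltW.
Qed.

Lemma flat_gt0 m x : 0 < x -> 0 < flat m x.
Proof. by move=> x0; rewrite /flat x0 mulr_gt0 ?expR_gt0// exprn_gt0// invr_gt0. Qed.

Lemma flat_eq0 m x : x <= 0 -> flat m x = 0.
Proof. by move=> x0; rewrite /flat ltNge x0. Qed.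

(** With y = 1/x and k = m + 1, the inequality exp(y/k) >= y/k raised to the power k gives y^k
    exp(-y) <= k^k. *)
Lemma flat_bounded m x : flat m.+1 x <= m.+1%:R ^+ m.+1.
Proof.
rewrite /flat; case: ifP => [x0|_]; last by rewrite exprn_ge0.
set y := x^-1; have y0 : 0 < y by rewrite invr_gt0.
rewrite expRN ler_pdivrMr ?expR_gt0//.
have -> : y = m.+1%:R * (y / m.+1%:R) by rewrite mulrCA mulfV ?mulr1// pnatr_eq0.
rewrite expRM_natl exprMn; apply: ler_wpM2l; first exact: exprn_ge0.
apply: lerXn2r; rewrite ?nnegrE ?expR_ge0 ?divr_ge0 ?(ltW y0)//.
by apply: le_trans (expR_ge1Dx _); rewrite lerDr.
Qed.

Lemma flat_succ m (x : R) : x != 0 -> x^-1 * flat m x = flat m.+1 x.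
Proof. by move=> x0; rewrite /flat; case: ifP => _; rewrite ?mulr0// mulrA -exprS. Qed.

Lemma is_derive_flat m (x : R) :
  is_derive x 1 (flat m) ((- m%:R) * flat m.+1 x + flat m.+2 x).
Proof.
have [x0|x0|->] := ltgtP x 0.
- rewrite !flat_eq0 ?(ltW x0)// mulr0 addr0.
  apply: near_eq_is_derive (is_derive_fcst 0 x).
  by near=> y; rewrite flat_eq0//; apply: ltW; near: y; exact: lt_nbhsl.
- have dV : is_derive x 1 (fun y : R => y^-1) (- (x^-1 * x^-1)).
    apply: (is_derive_eq (is_deriveV (lt0r_neq0 x0) (is_derive_fid x))).
    by rewrite /GRing.scale/= expr2 invfM mulr1.
  have dX : is_derive x 1 (fun y : R => y^-1 ^+ m) (- (m%:R * x^-1 ^+ m.+1)).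
    elim: m => [|m IH].
      by rewrite mul0r oppr0; apply: (is_derive_fcst 1 x).
    have -> : (fun y : R => y^-1 ^+ m.+1) = (fun y => y^-1 * y^-1 ^+ m).
      by apply/funext => y; rewrite exprS.
    apply: (is_derive_eq (is_derive_fM dV IH)).
    by rewrite -natr1 !exprS; ring.
  have dE := @is_derive_fcomp R (@expR R) (fun y => -1 * y^-1) x _ _
    (is_derive_expR _) (is_derive_fM (is_derive_fcst (-1) x) dV).
  apply: near_eq_is_derive (is_derive_eq (is_derive_fM dX dE) _).
    near=> y; rewrite /flat ifT ?mulN1r//.
    by near: y; exact: lt_nbhsr.
  rewrite /flat x0 !exprS mulN1r; ring.
(* At 0 the difference quotient is flat (m+1) h = h flat (m+2) h, which tends to 0 because the
   second factor is bounded. *)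
- rewrite !flat_eq0// mulr0 addr0; apply: is_derive_of_cvg.
  rewrite flat_eq0//.
  apply: norm_cvg0.
  have zc : `|h| * m.+2%:R ^+ m.+2 @[h --> (0 : R)^'] --> (0 : R).
    rewrite -[X in _ --> X](mul0r (m.+2%:R ^+ m.+2)); apply: cvgMl.
    by rewrite -[X in _ --> X](@normr0 _ R); apply: cvg_norm; exact: cvg_within.
  apply: (squeeze_cvgr _ (cvg_cst 0) zc).
  near=> h; have h0 : h != 0 by near: h; exact: nbhs_dnbhs_neq.
  rewrite addr0 subr0 flat_succ// normr_ge0/=.
  have -> : flat m.+1 h = h * flat m.+2 h by rewrite -(flat_succ m.+1 h0) mulrA mulfV// mul1r.
  rewrite normrM; apply: ler_wpM2l => //.
  by rewrite ger0_norm ?flat_ge0// flat_bounded.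
Unshelve. all: by end_near. Qed.

Lemma Ck_flat k m : Ck setT k (flat m).
Proof.
elim: k m => [//|k IH] m.
apply: (@Ck_derive _ _ _ (fun x => (- m%:R) * flat m.+1 x + flat m.+2 x) openT).
- by move=> x _; exact: is_derive_flat.
- apply: CkD => //; first exact: openT.
  by apply: CkM => //; [exact: openT|apply: Ck_cst; exact: openT].
Qed.

Definition bump (x : R) : R := flat 0 (1 * x + 1) * flat 0 (-1 * x + 1).

Lemma Ck_bump k : Ck setT k bump.
Proof.
apply: CkM; first exact: openT.
  by apply: (@Ck_comp _ setT) => //; [exact: openT|exact: openT|exact: Ck_flat|
    apply: Ck_affine; exact: openT].
by apply: (@Ck_comp _ setT) => //; [exact: openT|exact: openT|exact: Ck_flat|
    apply: Ck_affine; exact: openT].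
Qed.

Lemma bump_ge0 x : 0 <= bump x.
Proof. by rewrite mulr_ge0 ?flat_ge0. Qed.

Lemma bump_gt0 x : `|x| < 1 -> 0 < bump x.
Proof. by rewrite ltr_norml => /andP[? ?]; rewrite mulr_gt0// flat_gt0//; lra. Qed.

Lemma bump_supp x : bump x != 0 -> `|x| <= 1.
Proof.
rewrite /bump; apply: contraR; rewrite -ltNge lter_normr => /orP[h|h].
  by rewrite (@flat_eq0 _ (-1 * x + 1)) ?mulr0//; lra.
by rewrite (@flat_eq0 _ (1 * x + 1)) ?mul0r//; lra.
Qed.

(** The transition takes place on [1/4, 3/4], so that the function is locally constant near every x
    <= 0 and every x >= 1, endpoints included. *)
Definition step (x : R) : R :=
  flat 0 (4 * x + -1) * (flat 0 (4 * x + -1) + flat 0 (-4 * x + 3))^-1.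

Lemma step_denom x : 0 < flat 0 (4 * x + -1) + flat 0 (-4 * x + 3).
Proof.
have [h|h] := ltP 0 (4 * x + -1).
  by apply: ltr_wpDr; [exact: flat_ge0|exact: flat_gt0].
by apply: ltr_wpDl; [exact: flat_ge0|apply: flat_gt0; lra].
Qed.

Lemma Ck_step k : Ck setT k step.
Proof.
have oT : open (setT : set R) by exact: openT.
have c1 : Ck setT k (fun x => flat 0 (4 * x + -1)).
  by apply: (@Ck_comp _ setT) => //; [exact: Ck_flat|exact: Ck_affine].
have c2 : Ck setT k (fun x => flat 0 (-4 * x + 3)).
  by apply: (@Ck_comp _ setT) => //; [exact: Ck_flat|exact: Ck_affine].
apply: CkM => //; apply: CkV => //; last exact: CkD.
by move=> x _; rewrite gt_eqF// step_denom.
Qed.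

Lemma step_ge0 x : 0 <= step x.
Proof. by rewrite mulr_ge0 ?flat_ge0// invr_ge0 ltW// step_denom. Qed.

Lemma step_le1 x : step x <= 1.
Proof. by rewrite ler_pdivrMr ?step_denom// mul1r lerDl flat_ge0. Qed.

Lemma step_eq0 x : x <= 1 / 4 -> step x = 0.
Proof. by move=> h; rewrite /step flat_eq0 ?mul0r//; lra. Qed.

Lemma step_eq1 x : 3 / 4 <= x -> step x = 1.
Proof.
move=> h; rewrite /step (@flat_eq0 _ (-4 * x + 3)); last by lra.
by rewrite addr0 divff// gt_eqF// flat_gt0//; lra.
Qed.

Lemma derive1_step_eq0 x : x <= 0 \/ 1 <= x -> derive1 step x = 0.
Proof.
move=> [h|h]; apply: derive1_eq.
  apply: near_eq_is_derive (is_derive_fcst 0 x).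
  near=> y; rewrite step_eq0//.
  have : y < 1 / 4 by near: y; apply: lt_nbhsl; lra.
  exact: ltW.
apply: near_eq_is_derive (is_derive_fcst 1 x).
near=> y; rewrite step_eq1//.
have : 3 / 4 < y by near: y; apply: lt_nbhsr; lra.
exact: ltW.
Unshelve. all: by end_near. Qed.

Lemma Ck_continuous U f x : Ck U 1 f -> U x -> {for x, continuous f}.
Proof.
move=> [h _] Ux; apply: differentiable_continuous; apply/derivable1_diffP.
exact: h.
Qed.

Lemma derive1_step_bounded : exists S : R, forall x, `|derive1 step x| <= S.
Proof.
have cd : continuous (derive1 step).
  move=> x; have [_ h] := Ck_step 2; exact: Ck_continuous h _.
have := continuous_compact (continuous_subspaceT cd) (@segment_compact R 0 1).
move=> /compact_bounded[M [_ HM]]; exists (`|M| + 1) => x.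
have [x01|nx] := boolP (x \in `[0, 1]).
  apply: (HM (`|M| + 1)); first by rewrite (le_lt_trans (ler_norm _))// ltrDl.
  by exists x => //; exact: set_mem.
rewrite derive1_step_eq0 ?normr0 ?addr_ge0//.
move: nx; rewrite notin_setE/= in_itv/= => /negP; rewrite negb_and -!ltNge.
by move=> /orP[h|h]; [left|right]; exact: ltW.
Qed.

End SmoothOneVariable.

(** * Products of one-variable functions and their affine transplants *)

Section Tensor.
Context {R : realType} {n : nat}.
Implicit Types (phi : 'I_n -> R -> R) (x z : Rn R n).

Definition smooth1 (f : R -> R) := forall k, Ck setT k f.

Lemma smooth1_derive1 f : smooth1 f -> smooth1 (derive1 f).
Proof. by move=> h k; have [] := h k.+1. Qed.

Lemma smooth1_is_derive f (t : R) : smooth1 f -> is_derive t 1 f (derive1 f t).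
Proof. by move=> h; apply: is_derive_derive1; have [h1 _] := h 1; exact: h1. Qed.

Lemma smooth1_continuous f : smooth1 f -> continuous f.
Proof. by move=> h t; exact: Ck_continuous (h 1) _. Qed.

Definition tens phi x : R := \prod_(j < n) phi j (coor j x).

Definition dtens phi (i : 'I_n) : Rn R n -> R :=
  tens (fun j => if j == i then derive1 (phi j) else phi j).

Lemma cvg_bigprod (T I : Type) (F : set_system T) {FF : Filter F}
    (r : seq I) (f : I -> T -> R) (l : I -> R) :
  (forall i, f i x @[x --> F] --> l i) ->
  (\prod_(i <- r) f i x) @[x --> F] --> \prod_(i <- r) l i.
Proof.
move=> h; elim: r => [|i r IH].
  by under eq_fun do rewrite big_nil; rewrite big_nil; exact: cvg_cst.
by under eq_fun do rewrite big_cons; rewrite big_cons; exact: cvgM.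
Qed.

Lemma continuous_tens phi : (forall j, continuous (phi j)) -> continuous (tens phi).
Proof.
move=> c x; rewrite /tens; apply: (@cvg_bigprod _ _ (nbhs x)) => j.
have cj : coor j y @[y --> x] --> coor j x by exact: coord_continuous.
exact: (cvg_comp _ _ cj (c j _)).
Qed.

Lemma is_derive_tens phi (i : 'I_n) x : (forall j, smooth1 (phi j)) ->
  is_derive x (evec R i) (tens phi) (dtens phi i x).
Proof.
move=> s.
pose P := \prod_(j < n | j != i) phi j (coor j x).
have E1 : dtens phi i x = derive1 (phi i) (coor i x) * P.
  rewrite /dtens /tens (bigD1 i)//= eqxx; congr (_ * _).
  by apply: eq_bigr => j /negbTE ->.
have E2 (h : R) : h^-1 *: (tens phi (h *: evec R i + x) - tens phi x) =
   (h^-1 * (phi i (h + coor i x) - phi i (coor i x))) * P.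
  rewrite /tens (bigD1 i)//= [X in _ - X](bigD1 i)//= /coor !mxE/= !eqxx/= mulr1.
  rewrite [X in _ * X - _](_ : _ = P); last first.
    by apply: eq_bigr => j /negbTE ji; rewrite /coor !mxE/= ji mulr0 add0r.
  by rewrite -/(coor i x) -/P -mulrBl; exact: mulrA.
have H : h^-1 *: (tens phi (h *: evec R i + x) - tens phi x) @[h --> (0:R)^'] --> dtens phi i x.
  under eq_fun do rewrite E2.
  rewrite E1; apply: cvgMl; apply: cvg_of_is_derive; exact: smooth1_is_derive.
by split; [apply/cvg_ex; exists (dtens phi i x) | exact/cvg_lim].
Qed.

(** A partial derivative of a product function is again a product function, so induction on the list
    of directions stays inside the class. *)
Lemma smooth_tens phi : (forall j, smooth1 (phi j)) -> smooth (tens phi).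
Proof.
move=> s l.
have [psi [sp ->]] : exists psi, (forall j, smooth1 (psi j)) /\ dpart (tens phi) l = tens psi.
  elim: l => [|i l [psi [sp E]]]; first by exists phi.
  exists (fun j => if j == i then derive1 (psi j) else psi j); split.
    by move=> j; case: ifP => _ //; exact: smooth1_derive1.
  apply/funext => x /=; rewrite E.
  by have [_ ->] := is_derive_tens i x sp.
split; first by apply: continuous_tens => j; exact: smooth1_continuous.
by move=> i x; have [] := is_derive_tens i x sp.
Qed.

Definition pull phi (a d : 'I_n -> R) (j : 'I_n) (t : R) : R :=
  phi j ((d j)^-1 * t + - (a j / d j)).

Lemma smooth1_pull phi a d j : smooth1 (phi j) -> smooth1 (pull phi a d j).
Proof.
move=> s k; apply: (@Ck_comp _ setT setT) => //; try exact: openT.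
by apply: Ck_affine; exact: openT.
Qed.

Lemma derive1_pull phi a d j t : smooth1 (phi j) ->
  derive1 (pull phi a d j) t =
  (d j)^-1 * derive1 (phi j) ((d j)^-1 * t + - (a j / d j)).
Proof.
move=> s; apply: derive1_eq.
apply: (is_derive_eq (is_derive_fcomp (smooth1_is_derive _ s)
  (is_derive_fD (is_derive_fM (is_derive_fcst (d j)^-1 t) (is_derive_fid t))
    (is_derive_fcst (- (a j / d j)) t)))).
by ring.
Qed.

Lemma pull_arg (a d z : R) : d != 0 -> d^-1 * (a + d * z) + - (a / d) = z.
Proof. by move=> d0; field. Qed.

Lemma tens_pull phi a d z : (forall j, d j != 0) ->
  tens (pull phi a d) (affine a d z) = tens phi z.
Proof.
move=> d0; rewrite /tens; apply: eq_bigr => j _.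
by rewrite /pull /coor mxE pull_arg.
Qed.

Lemma dtens_pull phi a d i z : (forall j, d j != 0) -> (forall j, smooth1 (phi j)) ->
  dtens (pull phi a d) i (affine a d z) = (d i)^-1 * dtens phi i z.
Proof.
move=> d0 s; rewrite /dtens /tens (bigD1 i)//= eqxx [in RHS](bigD1 i)//= eqxx mulrA.
congr (_ * _).
  by rewrite derive1_pull// /coor mxE pull_arg.
apply: eq_bigr => j /negbTE ->; by rewrite /pull /coor mxE pull_arg.
Qed.

(** Coordinate j contributes nu_j (a_j / d_j + z_j): when a_j = 0 the scale d_j cancels, which is
    why transverse scales may be taken arbitrarily small. *)
Lemma euler_pull nu phi a d z : (forall j, d j != 0) -> (forall j, smooth1 (phi j)) ->
  euler nu (tens (pull phi a d)) (affine a d z) =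
  \sum_(j < n) nu j * (a j + d j * coor j z) * ((d j)^-1 * dtens phi j z).
Proof.
move=> d0 s; rewrite /euler; apply: eq_bigr => j _.
have [_ ->] := is_derive_tens j (affine a d z) (fun j => smooth1_pull a d (s j)).
by rewrite dtens_pull// /coor mxE.
Qed.

Lemma smooth_cst0 : smooth (fun _ : Rn R n => 0 : R).
Proof.
have E l : dpart (fun _ : Rn R n => 0 : R) l = (fun=> 0).
  elim: l => [//|i l IH]; apply/funext => x /=; rewrite IH.
  exact: derive_cst.
move=> l; split; first by rewrite E; exact: cst_continuous.
by move=> i x; rewrite E; have [] := @is_derive_cst _ _ _ (0 : R) x (evec R i).
Qed.

Definition cbox (lo hi : 'I_n -> R) : set (Rn R n) :=
  [set z | forall j, lo j <= coor j z <= hi j].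

Lemma compact_cbox lo hi : compact (cbox lo hi).
Proof.
have := @rV_compact R n (fun j => `[lo j, hi j]%classic) (fun j => @segment_compact R _ _).
rewrite (_ : [set v | _] = cbox lo hi)//; apply/seteqP; split => z /= h j; have := h j;
  by rewrite /= in_itv.
Qed.

Lemma Rintegral_cvg_bounded (mu : {measure set (Rn R n) -> \bar R})
   (G : nat -> Rn R n -> R) (g : Rn R n -> R) (M B : R) :
  is_lebesgue_measure mu -> (forall k, measurable_fun setT (G k)) ->
  measurable_fun setT g -> (forall k z, `|G k z| <= M) ->
  (forall k z, B < `|z| -> G k z = 0) -> (forall z, G k z @[k --> \oo] --> g z) ->
  (\int[mu]_z G k z)%R @[k --> \oo] --> (\int[mu]_z g z)%R /\
  mu.-integrable setT (EFin \o g).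
Proof.
move=> hmu mG mg GM GB cG.
have M0 : 0 <= M by exact: le_trans (GM 0%N 0).
pose S : set (Rn R n) := [set x | `|x| <= B].
pose D (x : Rn R n) : R := M * \1_S x.
have iD : mu.-integrable setT (EFin \o D) by exact: integrable_indic_ball.
have GD k z : `|G k z| <= D z.
  rewrite /D indicE; have [zS|zS] := boolP (z \in S); first by rewrite mulr1.
  rewrite mulr0 GB ?normr0//; move: zS; rewrite notin_setE /S/= => /negP.
  by rewrite -ltNge.
have [|||||ig _ H] := @dominated_convergence _ _ R mu setT measurableT
  (fun k => EFin \o G k) (EFin \o g) (EFin \o D).
- by move=> k; exact/measurable_EFinP.
- exact/measurable_EFinP.
- by apply: aeW => z _; apply: cvg_EFin; [exact: nearW|exact: cG].
- exact: iD.
- by apply: aeW => z k _ /=; rewrite lee_fin.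
split => //.
rewrite /Rintegral; apply: fine_cvg.
by rewrite fineK//; exact: integrable_fin_num.
Qed.

End Tensor.

(** * Blow-up at a boundary point *)

Section BlowUp.
Context {R : realType} {n : nat}.
Variables (nu : 'I_n -> R) (qn : Rn R n -> R)
  (mu : {measure set (Rn R n) -> \bar R}) (R0 p alpha beta : R).
Hypotheses (hnu : forall i, 0 < nu i) (hmu : is_lebesgue_measure mu)
  (hq : quasi_norm nu qn) (R00 : 0 < R0) (p1 : 1 < p).
Variables (i0 : 'I_n) (phi : 'I_n -> R -> R) (Y : R).
Hypotheses (sphi : forall j, smooth1 (phi j)) (Y1 : 1 <= Y)
  (supp0 : forall t, phi i0 t != 0 -> - Y <= t <= -1)
  (suppj : forall j t, j != i0 -> phi j t != 0 -> -1 <= t <= 1).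
Implicit Types (x z w : Rn R n) (s eps : R).

Let e := evec R i0.
Let N0 := nu i0.
Let N00 : 0 < N0. Proof. exact: hnu. Qed.

Let e_neq0 : e != 0.
Proof.
apply/eqP => /rowP /(_ i0); rewrite !mxE eqxx/= => /eqP.
by rewrite oner_eq0.
Qed.

Let m := qn e.
Let m0 : 0 < m. Proof. exact: (qn_gt0 hq e_neq0). Qed.

(* [r0] is the point of the axis with quasi-norm [R0]. *)
Let r0 := (R0 / m) `^ N0.
Let r00 : 0 < r0. Proof. by rewrite powR_gt0// divr_gt0. Qed.

(** The blow-up is centred at the boundary point on the axis, and the axial scale carries the factor
    [r0] so that the i0-coordinate of [T s eps z] is r0 (1 + s z_i0). *)
Let aa (j : 'I_n) : R := if j == i0 then r0 else 0.
Let dd s eps (j : 'I_n) : R := if j == i0 then r0 * s else eps.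
Let lo (j : 'I_n) : R := if j == i0 then - Y else -1.
Let hi (j : 'I_n) : R := if j == i0 then -1 else 1.
Let T s eps := affine aa (dd s eps).

Let dd_gt0 s eps j : 0 < s -> 0 < eps -> 0 < dd s eps j.
Proof. by move=> s0 e0; rewrite /dd; case: ifP => // _; rewrite mulr_gt0. Qed.

Let zi z := coor i0 z.

Let box_zi z : cbox lo hi z -> - Y <= zi z <= -1.
Proof. by move=> /(_ i0); rewrite /lo /hi eqxx. Qed.

Lemma ln_one_sub (t : R) : 0 <= t -> t <= 1 / 2 ->
  t <= - ln (1 - t) /\ - ln (1 - t) <= t / (1 - t).
Proof.
move=> t0 t1; have d0 : 0 < 1 - t by lra.
split.
  by rewrite lerNr; apply: le_ln1Dx; lra.
rewrite -lnV ?posrE//.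
have E : (1 - t)^-1 = 1 + t / (1 - t) by field; rewrite gt_eqF.
rewrite [X in ln X]E.
by apply: le_ln1Dx; apply: (@lt_le_trans _ _ 0); [lra|rewrite divr_ge0// ltW].
Qed.

(* The i0-coordinate fixes the dilation parameter, so only continuity of the
   quasi-norm at the single point e is used. *)
Lemma blowup_geometry (d : R) : 0 < d -> exists2 eps : R, 0 < eps &
  forall s z, 0 < s -> s * Y <= 1 / 2 -> cbox lo hi z ->
  0 < qn (T s eps z) /\
  `|Lw qn R0 (T s eps z) + N0^-1 * ln (1 + s * zi z)| <= d.
Proof.
move=> d0.
have c : ln (qn w) @[w --> e] --> ln m.
  have c1 : qn w @[w --> e] --> m by exact: qn_continuous hq e.
  by apply: (cvg_comp _ _ c1); exact: continuous_ln.
have : \forall w \near e, `|ln m - ln (qn w)| <= d.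
  by move/cvgrPdist_le : c; exact.
have : \forall w \near e, 0 < qn w.
  exact: (cvgr_gt _ (@qn_continuous _ _ _ _ hq e)).
move=> h1 h2; have /nbhs_ballP[del /= del0 hdel] :
  nbhs e [set w | 0 < qn w /\ `|ln m - ln (qn w)| <= d] by apply: filterI.
(* [rm] is a lower bound for every dilation parameter [rho] below, because 1 + s z_i0 >= 1/2; [C]
   then bounds all the factors rho^(- nu j). *)
pose rm := (r0 / 2) `^ N0^-1.
have rm0 : 0 < rm by rewrite powR_gt0// divr_gt0.
pose C := \sum_(j < n) rm^-1 `^ nu j.
have C0 : 0 <= C by apply: sumr_ge0 => j _; exact: powR_ge0.
have C1 : 0 < C + 1 by rewrite ltr_wpDl.
exists (del / (C + 1)); first by rewrite divr_gt0.
move=> s z s0 sY bz; set x := T _ _ _.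
have /andP[z1 z2] := box_zi bz.
have u0 : 1 / 2 <= 1 + s * zi z by nra.
have xi0 : coor i0 x = r0 * (1 + s * zi z).
  by rewrite /x /coor mxE /aa /dd eqxx /zi /coor; ring.
have xpos : 0 < r0 * (1 + s * zi z) by rewrite mulr_gt0//; lra.
(* Dilating x by 1/rho makes its i0-coordinate exactly 1, so [w] differs from e only in transverse
   coordinates, which are small with eps. *)
pose rho := (r0 * (1 + s * zi z)) `^ N0^-1.
have rho0 : 0 < rho by exact: powR_gt0.
have rhoN : rho `^ N0 = r0 * (1 + s * zi z).
  by rewrite -powRrM mulVf ?gt_eqF// powRr1// ltW.
pose w := dil nu rho^-1 x.
have xw : x = dil nu rho w.
  by rewrite /w dilM ?invr_ge0 ?(ltW rho0)// mulfV ?gt_eqF// dil1.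
have rmrho : rm <= rho.
  apply: ge0_ler_powR; rewrite ?nnegrE ?invr_ge0 ?divr_ge0 ?(ltW N00) ?(ltW r00) ?(ltW xpos)//.
  by apply: ler_wpM2l; [exact: ltW|lra].
have [qw lw] : 0 < qn w /\ `|ln m - ln (qn w)| <= d.
  apply: hdel; split => // i j; rewrite ord1.
  have wE : w ord0 j = rho^-1 `^ nu j * coor j x by rewrite /w mxE.
  have eE : e ord0 j = (j == i0)%:R by rewrite /e mxE eqxx.
  rewrite /ball/= wE eE.
  have [->|ji] := eqVneq j i0.
    rewrite xi0 -rhoN -powRM ?invr_ge0 ?(ltW rho0)//.
    by rewrite mulVf ?gt_eqF// powR1 subrr normr0.
  have -> : coor j x = del / (C + 1) * coor j z.
    by rewrite /x /coor mxE /aa /dd (negbTE ji) add0r.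
  rewrite sub0r normrN !normrM (gtr0_norm del0).
  rewrite (@gtr0_norm _ (rho^-1 `^ nu j)) ?powR_gt0 ?invr_gt0//.
  rewrite (@gtr0_norm _ (C + 1)^-1) ?invr_gt0//.
  have zj : `|coor j z| <= 1.
    by have := bz j; rewrite /lo /hi (negbTE ji) ler_norml.
  have rj : rho^-1 `^ nu j <= C.
    apply: (@le_trans _ _ (rm^-1 `^ nu j)).
      apply: ge0_ler_powR; rewrite ?nnegrE ?invr_ge0 ?(ltW rho0) ?(ltW rm0) ?(ltW (hnu j))//.
      by rewrite lef_pV2.
    by rewrite /C (bigD1 j)//= lerDl sumr_ge0// => l _; exact: powR_ge0.
  apply: (@le_lt_trans _ _ (C * (del / (C + 1)))).
    rewrite ler_pM ?powR_ge0 ?mulr_ge0 ?invr_ge0 ?(ltW del0) ?(ltW C1)//.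
    by rewrite ler_piMr// divr_ge0 ?(ltW del0) ?(ltW C1).
  rewrite mulrCA gtr_pMr// ltr_pdivrMr// mul1r; lra.
have qx : qn x = rho * qn w by rewrite {1}xw (qn_dil hq).
split; first by rewrite qx mulr_gt0.
rewrite /Lw qx.
have -> : ln (R0 / (rho * qn w)) = ln R0 - ln rho - ln (qn w).
  rewrite lnM ?posrE ?invr_gt0 ?mulr_gt0// lnV ?posrE ?mulr_gt0// lnM ?posrE//.
  by ring.
have -> : ln rho = N0^-1 * (N0 * (ln R0 - ln m) + ln (1 + s * zi z)).
  rewrite /rho ln_powR lnM ?posrE//; last by lra.
  by rewrite /r0 ln_powR lnM ?posrE ?invr_gt0// lnV ?posrE.
rewrite (_ : _ + _ = ln m - ln (qn w))//.
by field; rewrite gt_eqF.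
Qed.

(* Small enough for [sq k * Y <= 1 / 2], [sq k <= 1 / (2 * N0)] and [sq k <= 1]. *)
Let c0 := (2 * Y + 2 * N0 + 2)^-1.
Let sq (k : nat) : R := c0 / k.+1%:R.

Let Y0 : 0 < Y. Proof. exact: lt_le_trans ltr01 Y1. Qed.
Let den0 : 0 < 2 * Y + 2 * N0 + 2. Proof. by rewrite !addr_gt0// mulr_gt0. Qed.
Let c00 : 0 < c0. Proof. by rewrite invr_gt0. Qed.
Let sq0 k : 0 < sq k. Proof. by rewrite divr_gt0. Qed.
Let sq_le k : sq k <= c0.
Proof. by rewrite ler_pdivrMr// ler_peMr ?(ltW c00)// ler1n. Qed.
Let sqY k : sq k * Y <= 1 / 2.
Proof.
apply: (@le_trans _ _ (c0 * Y)); first by rewrite ler_pM2r.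
rewrite mulrC ler_pdivrMr//; have := N00; have := Y0; move=> h1 h2; lra.
Qed.
Let sqN k : sq k <= (2 * N0)^-1.
Proof.
apply: le_trans (sq_le k) _; rewrite lef_pV2 ?posrE ?mulr_gt0//.
by have := N00; have := Y0; move=> h1 h2; lra.
Qed.
Let sq1 k : sq k <= 1.
Proof.
apply: le_trans (sq_le k) _; rewrite invf_le1//.
by have := N00; have := Y0; move=> h1 h2; lra.
Qed.

Let sq_cvg0 : sq k @[k --> \oo] --> 0.
Proof.
rewrite -[X in _ --> X](mulr0 c0); apply: cvgMr.
exact: cvg_harmonic.
Qed.

(** L is of order s = [sq k] near the boundary. A precision of s^2 leaves an error s after the
    division by s in [ell], which vanishes in the limit. *)
Let epsP k := cid2 (@blowup_geometry (sq k ^+ 2) (exprn_gt0 2 (sq0 k))).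
Let eps k : R := projT1 (epsP k).
Let eps0 k : 0 < eps k. Proof. by rewrite /eps; case: (epsP k). Qed.
Let Tk k := T (sq k) (eps k).
Let ell k z := Lw qn R0 (Tk k z) / sq k.

Let geom k z : cbox lo hi z -> 0 < qn (Tk k z) /\
  `|Lw qn R0 (Tk k z) + N0^-1 * ln (1 + sq k * zi z)| <= sq k ^+ 2.
Proof.
rewrite /Tk /eps; case: (epsP k) => /= ep ep0 h bz.
exact: h (sq0 k) (sqY k) bz.
Qed.

Let ell_bounds k z : cbox lo hi z ->
  - zi z / N0 - sq k <= ell k z /\
  ell k z <= - zi z / N0 / (1 + sq k * zi z) + sq k.
Proof.
move=> bz; have [_ +] := geom k bz; have /andP[z1 z2] := box_zi bz.
have t0 : 0 <= sq k * - zi z by rewrite mulr_ge0 ?(ltW (sq0 k))//; lra.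
have t1 : sq k * - zi z <= 1 / 2.
  by apply: le_trans (sqY k); rewrite ler_pM2l//; lra.
have [l1 l2] := ln_one_sub t0 t1.
rewrite mulrN opprK in l1 l2.
rewrite ler_norml => /andP[g1 g2].
have S0 := sq0 k.
have NV : 0 < N0^-1 by rewrite invr_gt0.
rewrite /ell ler_pdivlMr// ler_pdivrMr//; split.
  have : N0^-1 * (sq k * - zi z) <= N0^-1 * - ln (1 + sq k * zi z) by rewrite ler_pM2l// mulrN.
  by move=> h; nra.
have : N0^-1 * - ln (1 + sq k * zi z) <= N0^-1 * (- (sq k * zi z) / (1 + sq k * zi z)).
  by rewrite ler_pM2l//.
have -> : (- zi z / N0 / (1 + sq k * zi z) + sq k) * sq k =
   N0^-1 * (- (sq k * zi z) / (1 + sq k * zi z)) + sq k ^+ 2 by rewrite expr2; ring.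
by move=> h; lra.
Qed.

(** Bounds for [ell] uniform in k: 1 + s z_i0 >= 1/2 gives the 2 in the upper one, and s <= 1 / (2
    N0), subtracted from -z_i0 / N0 >= 1 / N0, gives the lower one. *)
Let hiell := 2 * Y / N0 + 1.
Let loell := (2 * N0)^-1.
Let loell0 : 0 < loell. Proof. by rewrite invr_gt0 mulr_gt0. Qed.

Let ell_range k z : cbox lo hi z -> loell <= ell k z /\ ell k z <= hiell.
Proof.
move=> bz; have [h1 h2] := ell_bounds k bz; have /andP[z1 z2] := box_zi bz.
have sN := sqN k; have s1' := sq1 k; have S0 := sq0 k; have sY := sqY k.
have NV : 0 < N0^-1 by rewrite invr_gt0.
have lE : loell = N0^-1 / 2 by rewrite /loell invfM mulrC.
rewrite -/loell lE in sN; split.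
  apply: le_trans h1; rewrite lE.
  have : N0^-1 <= - zi z / N0 by rewrite ler_peMl ?(ltW NV)//; lra.
  by lra.
apply: le_trans h2 _; rewrite /hiell; apply: lerD => //.
have u0 : 1 / 2 <= 1 + sq k * zi z by nra.
move: (1 + sq k * zi z) u0 => v v0; rewrite ler_pdivrMr; last by lra.
have -> : 2 * Y / N0 * v = 2 * Y * v / N0 by ring.
rewrite ler_pM2r//; have := Y0; nra.
Qed.

Let qnE k z : cbox lo hi z -> qn (Tk k z) = R0 * expR (- (sq k * ell k z)).
Proof.
move=> bz; have [q0 _] := geom k bz.
have -> : sq k * ell k z = Lw qn R0 (Tk k z) by rewrite /ell mulrC divfK// gt_eqF.
rewrite /Lw expRN lnK ?posrE ?divr_gt0// invf_div.
by rewrite mulrCA mulfV ?mulr1// gt_eqF.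
Qed.

Let ell_cvg z : cbox lo hi z -> ell k z @[k --> \oo] --> - zi z / N0.
Proof.
move=> bz.
have c1 : - zi z / N0 - sq k @[k --> \oo] --> - zi z / N0.
  by rewrite -[X in _ --> X]subr0; apply: cvgB => //; exact: cvg_cst.
have c2 : - zi z / N0 / (1 + sq k * zi z) + sq k @[k --> \oo] --> - zi z / N0.
  rewrite -[X in _ --> X]addr0; apply: cvgD => //.
  rewrite -[X in _ --> X]divr1; apply: cvgMr; apply: cvgV => //.
  rewrite -[X in _ --> X]addr0; apply: cvgD; first exact: cvg_cst.
  by rewrite -[X in _ --> X](mul0r (zi z)); apply: cvgMl.
apply: (squeeze_cvgr _ c1 c2).
by near=> k; have [-> ->] := ell_bounds k bz.
Unshelve. all: by end_near. Qed.

Let qn_cvg z : cbox lo hi z -> qn (Tk k z) @[k --> \oo] --> R0.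
Proof.
move=> bz.
rewrite (_ : (fun k => qn (Tk k z)) = (fun k => R0 * expR (- (sq k * ell k z)))); last first.
  by apply/funext => k; rewrite qnE.
rewrite -[X in _ --> X]mulr1; apply: cvgMr; rewrite -expR0.
have c : - (sq k * ell k z) @[k --> \oo] --> (0 : R).
  rewrite -[X in _ --> X]oppr0; apply: cvgN.
  rewrite -[X in _ --> X](mul0r (- zi z / N0)); apply: cvgM => //.
  exact: ell_cvg.
by apply: (cvg_comp _ _ c); exact: continuous_expR.
Qed.

(** The factor s^b absorbs the power of s contained in L = s [ell]. *)
Let scaled_weight (a b : R) k z : cbox lo hi z ->
  sq k `^ b * weight qn R0 a b (Tk k z) = qn (Tk k z) `^ (- a) * ell k z `^ (- b).
Proof.
move=> bz; have [h1 _] := ell_range k bz.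
have l0 : 0 < ell k z by exact: lt_le_trans h1.
have -> : weight qn R0 a b (Tk k z) =
    qn (Tk k z) `^ (- a) * (sq k `^ (- b) * ell k z `^ (- b)).
  rewrite /weight -powRM ?(ltW (sq0 k)) ?(ltW l0)//.
  by rewrite /ell [sq k * _]mulrC divfK// gt_eqF.
rewrite mulrCA; congr (_ * _); rewrite mulrA powRN mulfV ?mul1r//.
by rewrite gt_eqF// powR_gt0.
Qed.

Let sw_bounded (a b : R) : exists M : R, forall k z, cbox lo hi z ->
  sq k `^ b * weight qn R0 a b (Tk k z) <= M.
Proof.
exists (((R0 * expR (- hiell)) `^ (- a) + R0 `^ (- a)) *
        (loell `^ (- b) + hiell `^ (- b))) => k z bz.
have [h1 h2] := ell_range k bz.
have l0 : 0 < ell k z by exact: lt_le_trans h1.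
rewrite scaled_weight//; apply: ler_pM; rewrite ?powR_ge0//; last first.
  exact: powR_le_endpoints.
rewrite qnE//; apply: powR_le_endpoints.
- by rewrite mulr_gt0// expR_gt0.
- rewrite ler_pM2l// ler_expR lerN2.
  by apply: le_trans h2; rewrite ler_piMl// ltW.
- rewrite ger_pMr// -expR0 ler_expR oppr_le0 mulr_ge0//; exact: ltW.
Qed.

Let sw_cvg (a b : R) z : cbox lo hi z ->
  sq k `^ b * weight qn R0 a b (Tk k z) @[k --> \oo] -->
  R0 `^ (- a) * (- zi z / N0) `^ (- b).
Proof.
move=> bz; under eq_fun do rewrite scaled_weight//.
have /andP[z1 z2] := box_zi bz.
apply: cvgM; apply: powR_cvg_pos => //; [exact: qn_cvg| |exact: ell_cvg].
by rewrite divr_gt0//; lra.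
Qed.

Let supp_tens (psi : 'I_n -> R -> R) z :
  (forall t, psi i0 t != 0 -> - Y <= t <= -1) ->
  (forall j t, j != i0 -> psi j t != 0 -> -1 <= t <= 1) ->
  ~ cbox lo hi z -> tens psi z = 0.
Proof.
move=> h0 hj; apply: contra_notP => /eqP.
rewrite /tens => /prodf_neq0 h j; rewrite /lo /hi.
have := h j isT; have [->|ji] := eqVneq j i0; first exact: h0.
exact: hj.
Qed.

Let derive1_supp (f : R -> R) (a b t : R) : (forall t, f t != 0 -> a <= t <= b) ->
  derive1 f t != 0 -> a <= t <= b.
Proof.
move=> h; apply: contraR => nt; apply/eqP; apply: derive1_eq.
apply: near_eq_is_derive (is_derive_fcst 0 t).
have : \forall s \near t, ~~ (a <= s <= b).
  move: nt; rewrite negb_and -!ltNge => /orP[ta|tb].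
    near=> s; rewrite negb_and -!ltNge; apply/orP; left.
    by near: s; exact: lt_nbhsl.
  near=> s; rewrite negb_and -!ltNge; apply/orP; right.
  by near: s; exact: lt_nbhsr.
apply: filterS => s; apply: contraNeq => fs.
by apply: h; rewrite eq_sym.
Unshelve. all: by end_near. Qed.

Let supp_dtens j z : ~ cbox lo hi z -> dtens phi j z = 0.
Proof.
apply: supp_tens.
  by move=> t; case: ifP => _; [exact: derive1_supp|exact: supp0].
by move=> l t li; case: ifP => _; [apply: derive1_supp => u; exact: suppj|exact: suppj].
Qed.

Let F := tens phi.
Let F0 z : ~ cbox lo hi z -> F z = 0. Proof. exact: supp_tens. Qed.

Let uk k := tens (pull phi aa (dd (sq k) (eps k))).
Let fk k x : R[i] := Complex (uk k x) 0.
Let Kk k := cbox (fun j => aa j + dd (sq k) (eps k) j * lo j)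
                 (fun j => aa j + dd (sq k) (eps k) j * hi j).

Let ddk k j : 0 < dd (sq k) (eps k) j. Proof. exact: dd_gt0. Qed.
Let ddn k j : dd (sq k) (eps k) j != 0. Proof. exact: lt0r_neq0. Qed.

Let Tsurj k x : exists z, x = Tk k z.
Proof.
exists (\row_j ((x ord0 j - aa j) / dd (sq k) (eps k) j)).
apply/rowP => j; rewrite !mxE mulrCA mulfV// mulr1.
by rewrite addrC subrK.
Qed.

Let Kk_box k z : Kk k (Tk k z) <-> cbox lo hi z.
Proof.
split=> h j; have := h j; rewrite /coor mxE !lerD2l !ler_pM2l//.
Qed.

Let sm_uk k : smooth (uk k).
Proof. by apply: smooth_tens => j; exact: smooth1_pull. Qed.

Let Kk_sub k : Kk k `<=` [set x | qn x < R0] `\ 0.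
Proof.
move=> x; have [z ->] := Tsurj k x => /Kk_box bz.
have [q0 _] := geom k bz; have [h1 _] := ell_range k bz.
split => /=; last by move=> E; move: q0; rewrite E (qn_eq0 hq 0).2// ltxx.
rewrite qnE// gtr_pMr// -expR0 ltr_expR oppr_lt0 mulr_gt0//.
exact: lt_le_trans h1.
Qed.

Let fk_supp k x : ~ Kk k x -> fk k x = 0.
Proof.
have [z ->] := Tsurj k x => nK; rewrite /fk /uk tens_pull//.
by rewrite [tens phi z]F0// => /Kk_box.
Qed.

Let fk_adm k : C0inf_punct qn R0 (fk k).
Proof.
split; first exact: sm_uk; split; first exact: smooth_cst0.
by exists (Kk k); split; [exact: compact_cbox|exact: Kk_sub|exact: fk_supp].
Qed.

Let Ez k z := \sum_(j < n) nu j * (aa j + dd (sq k) (eps k) j * coor j z) *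
  ((dd (sq k) (eps k) j)^-1 * dtens phi j z).

(** Both densities are rescaled by the same power s^(beta+p+1). In [G] the weight uses all of it; in
    [H] the share s^p tames the Euler field, of size 1/s, and s^(beta+1) goes to the weight. *)
Let G k z := sq k `^ (beta + p + 1) * dens_B qn R0 p alpha beta (fk k) (Tk k z).
Let H k z := sq k `^ (beta + p + 1) * dens_A nu qn R0 p alpha beta (fk k) (Tk k z).

Let GE k z : G k z = `|F z| `^ p *
  (sq k `^ (beta + p + 1) * weight qn R0 (alpha + p) (beta + p + 1) (Tk k z)).
Proof.
rewrite /G /dens_B /fk /uk tens_pull// /cabs/= expr0n/= addr0 sqrtr_sqr.
by rewrite mulrCA.
Qed.

Let HE k z : H k z = `|sq k * Ez k z| `^ p *
  (sq k `^ (beta + 1) * weight qn R0 (alpha + p) (beta + 1) (Tk k z)).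
Proof.
rewrite /H /dens_A /gradR.
have -> : euler nu (fun x => complex.Im (fk k x)) (Tk k z) = 0.
  by rewrite /euler big1// => j _; rewrite [X in _ * X](@derive_cst _ _ _ (0 : R)) mulr0.
have -> : euler nu (fun x => complex.Re (fk k x)) (Tk k z) = Ez k z.
  by transitivity (euler nu (uk k) (Tk k z)) => //; rewrite euler_pull.
rewrite /cabs/= expr0n/= addr0 sqrtr_sqr.
move: (Ez k z) (weight qn R0 _ _ (Tk k z)) => E W.
move: (sq k) (sq0 k) => s s0.
rewrite (normrM s) (gtr0_norm s0) powRM ?(ltW s0)//.
rewrite (_ : beta + p + 1 = p + (beta + 1)); last by ring.
rewrite powRD; last by apply/implyP => _; rewrite gt_eqF.
by ring.
Qed.

(** The Jacobian of the blow-up and the rescaling power are positive and common to both sides, so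
    they cancel. *)
Let GH_int (C : R) : (forall f, C0inf_punct qn R0 f ->
    C * I_f qn mu R0 p alpha beta f <= I_Rf nu qn mu R0 p alpha beta f) ->
  forall k, C * (\int[mu]_z G k z)%R <= (\int[mu]_z H k z)%R.
Proof.
move=> hC k; have := hC _ (fk_adm k).
have su : smooth (fun x => complex.Re (fk k x)) by exact: sm_uk.
have sv : smooth (fun x => complex.Im (fk k x)) by exact: smooth_cst0.
have cK := @compact_cbox R n (fun j => aa j + dd (sq k) (eps k) j * lo j)
                 (fun j => aa j + dd (sq k) (eps k) j * hi j).
have KR := @Kk_sub k; have fK := @fk_supp k.
have bA : bsupp (Kk k) (dens_A nu qn R0 p alpha beta (fk k)).
  exact: (bsupp_A _ _ hq R00 p1 su sv cK KR fK).
have bB : bsupp (Kk k) (dens_B qn R0 p alpha beta (fk k)).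
  exact: (bsupp_cabs_weight hq R00 p1 su sv cK KR fK).
have iA := bsupp_integrable hmu cK bA; have iB := bsupp_integrable hmu cK bB.
rewrite (I_fE mu alpha beta p1 KR fK) (I_RfE mu alpha beta hq p1 su sv cK KR fK).
rewrite (@Rintegral_affine R n mu aa (dd (sq k) (eps k)) _ hmu (ddk k) iB).
rewrite (@Rintegral_affine R n mu aa (dd (sq k) (eps k)) _ hmu (ddk k) iA).
have D0 : 0 < \prod_(i < n) dd (sq k) (eps k) i by exact: prodr_gt0.
rewrite mulrCA ler_pM2l// => h.
rewrite /G /H !RintegralZl//.
- by rewrite mulrCA ler_pM2l// powR_gt0.
- exact: (@integrable_affine R n mu aa (dd (sq k) (eps k)) _ hmu (ddk k) iA).
- exact: (@integrable_affine R n mu aa (dd (sq k) (eps k)) _ hmu (ddk k) iB).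
Qed.

(** On the axis centre over scale is 1/s, so the factor s leaves N0 (1 + s z_i0); transverse
    coordinates have centre 0 and contribute only O(s). *)
Let sEz k z : sq k * Ez k z = N0 * (1 + sq k * zi z) * dtens phi i0 z +
  sq k * \sum_(j < n | j != i0) nu j * coor j z * dtens phi j z.
Proof.
rewrite /Ez (bigD1 i0)//= mulrDr; congr (_ + _).
  rewrite /aa /dd eqxx -/N0 -/(zi z).
  by field; rewrite !gt_eqF.
congr (_ * _); apply: eq_bigr => j ji; rewrite /aa /dd (negbTE ji) add0r.
by field; rewrite gt_eqF.
Qed.

Let Ez_cvg z : `|sq k * Ez k z| `^ p @[k --> \oo] --> `|N0 * dtens phi i0 z| `^ p.
Proof.
apply: powR_cvg_nneg => //; first by exact: lt_trans ltr01 p1.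
apply: cvg_norm.
rewrite (_ : (fun k => sq k * Ez k z) = (fun k => N0 * (1 + sq k * zi z) * dtens phi i0 z +
  sq k * \sum_(j < n | j != i0) nu j * coor j z * dtens phi j z)); last first.
  by apply/funext => k; exact: sEz.
rewrite -[X in _ --> X]addr0; apply: cvgD.
  apply: cvgMl; rewrite -[X in _ --> X]mulr1; apply: cvgMr.
  rewrite -[X in _ --> X]addr0; apply: cvgD; first exact: cvg_cst.
  by rewrite -[X in _ --> X](mul0r (zi z)); exact: cvgMl.
by rewrite -[X in _ --> X](mul0r (\sum_(j < n | j != i0) nu j * coor j z * dtens phi j z));
  exact: cvgMl.
Qed.

Let cdtens j : continuous (dtens phi j).
Proof.
apply: continuous_tens => l; case: ifP => _; last exact: smooth1_continuous.
by apply: smooth1_continuous; exact: smooth1_derive1.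
Qed.

Let cF : continuous F.
Proof. by apply: continuous_tens => l; exact: smooth1_continuous. Qed.

Let Ez_bounded : exists M : R, forall k z, cbox lo hi z -> `|sq k * Ez k z| <= M.
Proof.
have hb j : exists M : R, forall z, cbox lo hi z -> `|dtens phi j z| <= M.
  by apply: continuous_bounded_on; [exact: compact_cbox|move=> x _; exact: cdtens].
have [M hM] := choice hb.
exists (N0 * M i0 + \sum_(j < n | j != i0) nu j * M j) => k z bz.
have /andP[z1 z2] := box_zi bz; have S0 := sq0 k; have S1 := sq1 k; have SY := sqY k.
rewrite sEz; apply: le_trans (ler_normD _ _) _; apply: lerD.
  rewrite !normrM (gtr0_norm N00) -mulrA; apply: ler_wpM2l; first exact: ltW.
  rewrite -[leRHS]mul1r; apply: ler_pM => //; last exact: hM.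
  by rewrite ler_norml; apply/andP; split; nra.
rewrite normrM (gtr0_norm S0) -[leRHS]mul1r; apply: ler_pM => //; first exact: ltW.
apply: le_trans (ler_norm_sum _ _ _) _; apply: ler_sum => j ji.
rewrite !normrM (gtr0_norm (hnu j)) -mulrA; apply: ler_wpM2l; first exact: ltW.
rewrite -[leRHS]mul1r; apply: ler_pM => //; last exact: hM.
by have := bz j; rewrite /lo /hi (negbTE ji) ler_norml.
Qed.

Let Bb : R := projT1 (cid (compact_bounded (@compact_cbox R n lo hi))).
Let box_norm z : Bb + 1 < `|z| -> ~ cbox lo hi z.
Proof.
rewrite /Bb; case: cid => B [? hB] /= Bz bz.
have : `|z| <= B + 1 by apply: (hB (B + 1)) => //; rewrite ltrDl.
by rewrite leNgt Bz.
Qed.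

Let mw a b k : measurable_fun setT (fun z => weight qn R0 a b (Tk k z)).
Proof.
apply: (measurableT_comp (measurable_weight _ hq _ _)); exact: measurable_affine.
Qed.

Let mzi : measurable_fun setT zi. Proof. exact: measurable_coor. Qed.

Let pp : 0 < p. Proof. exact: lt_trans ltr01 p1. Qed.

Let mpow (g : Rn R n -> R) (a : R) : measurable_fun setT g ->
  measurable_fun setT (fun z => g z `^ a).
Proof. by move=> mg; apply: (measurableT_comp (measurable_powR _)). Qed.

Definition lim_B z := `|F z| `^ p * (R0 `^ (- (alpha + p)) * (- zi z / N0) `^ (- (beta + p + 1))).
Definition lim_A z := `|N0 * dtens phi i0 z| `^ p *
  (R0 `^ (- (alpha + p)) * (- zi z / N0) `^ (- (beta + 1))).

Let mzN b : measurable_fun setT (fun z => (- zi z / N0) `^ b).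
Proof.
apply: mpow; apply: measurable_funM => //.
by apply: measurableT_comp => //; exact: oppr_measurable.
Qed.

Let G_cvg : (\int[mu]_z G k z)%R @[k --> \oo] --> (\int[mu]_z lim_B z)%R /\
  mu.-integrable setT (EFin \o lim_B).
Proof.
have [M1 h1] : exists M : R, forall z, cbox lo hi z -> `|F z| <= M.
  by apply: continuous_bounded_on; [exact: compact_cbox|move=> x _; exact: cF].
have [M2 h2] := sw_bounded (alpha + p) (beta + p + 1).
have Gz k z : ~ cbox lo hi z -> G k z = 0.
  by move=> nb; rewrite GE F0// normr0 powR0 ?mul0r// gt_eqF.
apply: (@Rintegral_cvg_bounded _ _ _ _ _ `|M1 `^ p * M2| (Bb + 1)) => //.
- move=> k; rewrite (_ : G k = (fun z => `|F z| `^ p * (sq k `^ (beta + p + 1) *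
    weight qn R0 (alpha + p) (beta + p + 1) (Tk k z)))); last by apply/funext => z; exact: GE.
  apply: measurable_funM.
    apply: mpow; apply: measurableT_comp => //; exact: continuous_measurable_Rn.
  by apply: measurable_funM => //; exact: mw.
- apply: measurable_funM.
    apply: mpow; apply: measurableT_comp => //; exact: continuous_measurable_Rn.
  by apply: measurable_funM => //; exact: mzN.
- move=> k z; have [bz|nb] := pselect (cbox lo hi z); last by rewrite Gz// normr0.
  rewrite GE (le_trans _ (ler_norm _))// normrM; apply: ler_pM => //.
    rewrite ger0_norm ?powR_ge0//; apply: ge0_ler_powR; rewrite ?nnegrE ?(ltW pp)//; last exact: h1.
    by apply: le_trans (h1 z bz).
  by rewrite ger0_norm; [exact: h2|rewrite mulr_ge0 ?powR_ge0 ?weight_ge0].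
- by move=> k z /box_norm; exact: Gz.
- move=> z; have [bz|nb] := pselect (cbox lo hi z); last first.
    rewrite (_ : (fun k => G k z) = (fun=> 0)); last by apply/funext => k; exact: Gz.
    by rewrite /lim_B F0// normr0 powR0 ?gt_eqF// mul0r; exact: cvg_cst.
  rewrite (_ : (fun k => G k z) = (fun k => `|F z| `^ p * (sq k `^ (beta + p + 1) *
    weight qn R0 (alpha + p) (beta + p + 1) (Tk k z)))); last by apply/funext => k; exact: GE.
  by apply: cvgMr; exact: sw_cvg.
Qed.

Let H_cvg : (\int[mu]_z H k z)%R @[k --> \oo] --> (\int[mu]_z lim_A z)%R /\
  mu.-integrable setT (EFin \o lim_A).
Proof.
have [M1 h1] := Ez_bounded.
have [M2 h2] := sw_bounded (alpha + p) (beta + 1).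
have Ez0 k z : ~ cbox lo hi z -> sq k * Ez k z = 0.
  by move=> nb; rewrite /Ez big1 ?mulr0// => j _; rewrite supp_dtens// !mulr0.
have Hz k z : ~ cbox lo hi z -> H k z = 0.
  by move=> nb; rewrite HE Ez0// normr0 powR0 ?mul0r// gt_eqF.
have mEz k : measurable_fun setT (fun z => sq k * Ez k z).
  apply: measurable_funM => //; apply: continuous_measurable_Rn => z.
  apply: (@cvg_bigsum R _ _ (nbhs z)) => j.
  apply: (@cvgM _ _ (nbhs z) _ (fun z => nu j * (aa j + dd (sq k) (eps k) j * coor j z))
    (fun z => (dd (sq k) (eps k) j)^-1 * dtens phi j z)).
    apply: (@cvgM _ _ (nbhs z) _ (fun=> nu j)); first exact: cvg_cst.
    apply: (@cvgD _ _ _ (nbhs z) _ (fun=> aa j)); first exact: cvg_cst.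
    apply: (@cvgM _ _ (nbhs z) _ (fun=> dd (sq k) (eps k) j)); first exact: cvg_cst.
    exact: coord_continuous.
  apply: (@cvgM _ _ (nbhs z) _ (fun=> (dd (sq k) (eps k) j)^-1)); first exact: cvg_cst.
  exact: cdtens.
apply: (@Rintegral_cvg_bounded _ _ _ _ _ `|M1 `^ p * M2| (Bb + 1)) => //.
- move=> k; rewrite (_ : H k = (fun z => `|sq k * Ez k z| `^ p * (sq k `^ (beta + 1) *
    weight qn R0 (alpha + p) (beta + 1) (Tk k z)))); last by apply/funext => z; exact: HE.
  apply: measurable_funM.
    by apply: mpow; apply: measurableT_comp => //; exact: mEz.
  by apply: measurable_funM => //; exact: mw.
- apply: measurable_funM.
    apply: mpow; apply: measurableT_comp => //; apply: measurable_funM => //.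
    exact: continuous_measurable_Rn.
  by apply: measurable_funM => //; exact: mzN.
- move=> k z; have [bz|nb] := pselect (cbox lo hi z); last by rewrite Hz// normr0.
  rewrite HE (le_trans _ (ler_norm _))// normrM; apply: ler_pM => //.
    rewrite ger0_norm ?powR_ge0//; apply: ge0_ler_powR; rewrite ?nnegrE ?(ltW pp)//; last exact: h1.
    by apply: le_trans (h1 k z bz).
  by rewrite ger0_norm; [exact: h2|rewrite mulr_ge0 ?powR_ge0 ?weight_ge0].
- by move=> k z /box_norm; exact: Hz.
- move=> z; have [bz|nb] := pselect (cbox lo hi z); last first.
    rewrite (_ : (fun k => H k z) = (fun=> 0)); last by apply/funext => k; exact: Hz.
    by rewrite /lim_A supp_dtens// mulr0 normr0 powR0 ?gt_eqF// mul0r; exact: cvg_cst.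
  rewrite (_ : (fun k => H k z) = (fun k => `|sq k * Ez k z| `^ p * (sq k `^ (beta + 1) *
    weight qn R0 (alpha + p) (beta + 1) (Tk k z)))); last by apply/funext => k; exact: HE.
  by apply: cvgM; [exact: Ez_cvg|exact: sw_cvg].
Qed.

Lemma blowup_inequality (C : R) : (forall f, C0inf_punct qn R0 f ->
    C * I_f qn mu R0 p alpha beta f <= I_Rf nu qn mu R0 p alpha beta f) ->
  [/\ mu.-integrable setT (EFin \o lim_B), mu.-integrable setT (EFin \o lim_A) &
      C * (\int[mu]_z lim_B z)%R <= (\int[mu]_z lim_A z)%R].
Proof.
move=> hC; have [cG iB] := G_cvg; have [cH iA] := H_cvg; split => //.
have cG' : C * (\int[mu]_z G k z)%R @[k --> \oo] --> C * (\int[mu]_z lim_B z)%R.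
  exact: cvgMr.
apply: (ler_cvg_to cG' cH).
by near=> k; exact: GH_int.
Unshelve. all: by end_near. Qed.

End BlowUp.

(** * Truncated extremals *)

Section Plateau.
Context {R : realType} {n : nat}.
Variables (mu : {measure set (Rn R n) -> \bar R}) (i0 : 'I_n) (p kap : R).
Hypotheses (hmu : is_lebesgue_measure mu) (p1 : 1 < p).
Implicit Types (z : Rn R n) (N k : nat) (t y : R).

Let pp : 0 < p. Proof. exact: lt_trans ltr01 p1. Qed.
Let oT : open (setT : set R). Proof. exact: openT. Qed.

(** The arguments are affine in the shape of [Ck_affine]; [plateauE] gives the readable form. *)
Definition plateau N y : R :=
  step (1 * y + -1) * step (- (2 ^+ N)^-1 * y + 2).

Definition dplateau N y : R :=
  derive1 step (y - 1) * step (2 - y / 2 ^+ N) -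
  step (y - 1) * derive1 step (2 - y / 2 ^+ N) / 2 ^+ N.

Let e2 N : 0 < 2 ^+ N :> R. Proof. exact: exprn_gt0. Qed.

Lemma plateauE N y : plateau N y = step (y - 1) * step (2 - y / 2 ^+ N).
Proof. by rewrite /plateau; congr (step _ * step _); ring. Qed.

Lemma Ck_plateau N k : Ck setT k (plateau N).
Proof.
apply: CkM => //.
  by apply: (@Ck_comp _ setT setT) => //; [exact: Ck_step|exact: Ck_affine].
by apply: (@Ck_comp _ setT setT) => //; [exact: Ck_step|exact: Ck_affine].
Qed.

Lemma is_derive_plateau N y : is_derive y 1 (plateau N) (dplateau N y).
Proof.
have ds t : is_derive t 1 step (derive1 step t) by exact: smooth1_is_derive Ck_step.
have d1 := is_derive_fcomp (ds _) (is_derive_fD (is_derive_fM (is_derive_fcst 1 y)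
  (is_derive_fid y)) (is_derive_fcst (-1) y)).
have d2 := is_derive_fcomp (ds _) (is_derive_fD (is_derive_fM
  (is_derive_fcst (- (2 ^+ N)^-1) y) (is_derive_fid y)) (is_derive_fcst 2 y)).
apply: (is_derive_eq (is_derive_fM d1 d2)).
rewrite /dplateau (_ : 1 * y + -1 = y - 1); last by ring.
rewrite (_ : - (2 ^+ N)^-1 * y + 2 = 2 - y / 2 ^+ N); last by ring.
by ring.
Qed.

Let scaled N y c : y <= c * 2 ^+ N -> y / 2 ^+ N <= c.
Proof. by rewrite ler_pdivrMr. Qed.
Let scaled' N y c : c * 2 ^+ N <= y -> c <= y / 2 ^+ N.
Proof. by rewrite ler_pdivlMr. Qed.

Lemma plateau_left N y : y <= 1 -> plateau N y = 0 /\ dplateau N y = 0.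
Proof.
move=> y1; rewrite plateauE /dplateau step_eq0; last by lra.
by rewrite derive1_step_eq0 ?mul0r ?subr0//; left; lra.
Qed.

Lemma plateau_right N y : 2 ^+ N.+1 <= y -> plateau N y = 0 /\ dplateau N y = 0.
Proof.
rewrite exprS => /scaled' h; rewrite plateauE /dplateau.
rewrite (@step_eq0 _ (2 - y / 2 ^+ N)); last by lra.
by rewrite (@derive1_step_eq0 _ (2 - y / 2 ^+ N)) ?mulr0 ?mul0r ?subr0//; left; lra.
Qed.

Lemma plateau_mid N y : 2 <= y -> y <= 2 ^+ N -> plateau N y = 1 /\ dplateau N y = 0.
Proof.
move=> y2; rewrite -[2 ^+ N]mul1r => /scaled h; rewrite plateauE /dplateau.
rewrite !step_eq1 ?mulr1; [|lra|lra].
rewrite !derive1_step_eq0; [by rewrite mulr0 mul0r subr0|right; lra|right; lra].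
Qed.

Lemma plateau_ge0 N y : 0 <= plateau N y.
Proof. by rewrite mulr_ge0 ?step_ge0. Qed.

Lemma plateau_le1 N y : plateau N y <= 1.
Proof. by rewrite mulr_ile1 ?step_ge0 ?step_le1. Qed.

(** The operator y d/dy is invariant under scaling: on the outer shell the chain rule factor 2^(-N)
    is compensated by y <= 2^(N+1). The bound is therefore independent of N. *)
Lemma dplateau_bounded : exists S : R, 0 <= S /\ forall N y, (0 < N)%N ->
  1 <= y -> (y < 2 \/ 2 ^+ N <= y) -> y <= 2 ^+ N.+1 -> `|y * dplateau N y| <= S.
Proof.
have [S hS] := @derive1_step_bounded R.
have S0 : 0 <= S by exact: le_trans (hS 0).
exists (2 * S); split; first by rewrite mulr_ge0.
move=> N y N0 y1 yc yN; rewrite /dplateau.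
have N2 : 2 <= 2 ^+ N :> R by rewrite -[leLHS]expr1 ler_eXn2l// ltr1n.
case: yc => [y2|yN'].
  have h : y / 2 ^+ N <= 1 by apply: scaled; lra.
  rewrite (@derive1_step_eq0 _ (2 - y / 2 ^+ N)); last by right; lra.
  rewrite mulr0 mul0r subr0 mulrA normrM.
  rewrite (ger0_norm (step_ge0 _)) -[leRHS]mulr1; apply: ler_pM => //.
  - exact: step_ge0.
  - rewrite normrM; apply: ler_pM; rewrite ?normr_ge0 ?hS//.
    by rewrite ger0_norm; lra.
  - exact: step_le1.
rewrite (@derive1_step_eq0 _ (y - 1)); last by right; lra.
rewrite mul0r sub0r mulrN normrN.
have -> : y * (step (y - 1) * derive1 step (2 - y / 2 ^+ N) / 2 ^+ N) =
  (y / 2 ^+ N) * derive1 step (2 - y / 2 ^+ N) * step (y - 1) by ring.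
rewrite normrM (ger0_norm (step_ge0 _)) -[leRHS]mulr1; apply: ler_pM => //.
- exact: step_ge0.
- rewrite normrM; apply: ler_pM; rewrite ?normr_ge0 ?hS//.
  rewrite ger0_norm; first by apply: scaled; rewrite -exprS.
  by rewrite divr_ge0//; lra.
- exact: step_le1.
Qed.

(** The power y^kap solves the extremal equation of the limiting inequality; the cut-off makes it
    admissible, with y = - t because the ball lies on the negative side of the boundary point. *)
Definition profile N t : R := (-1 * t + 0) `^ kap * plateau N (-1 * t + 0).

Let negE t : -1 * t + 0 = - t :> R. Proof. by rewrite mulN1r addr0. Qed.

(** The power is smooth only for t < 0, while the cut-off makes the product vanish for t > -1; these
    two open sets cover the line. *)
Lemma smooth1_profile N : smooth1 (profile N).
Proof.
move=> k.
pose U : set R := [set t | t < 0]; pose V : set R := [set t | -1 < t].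
have oU : open U by exact: open_lt.
have oV : open V by exact: open_gt.
have -> : setT = U `|` V.
  apply/seteqP; split => // t _ /=; have [h|h] := ltP t 0; first by left.
  by right; rewrite /V/=; lra.
apply: Ck_union.
  apply: CkM => //.
    apply: (@Ck_comp _ U [set x | 0 < x] _ (fun x => x `^ kap)) => //.
    - by move=> t /=; rewrite negE /U/=; lra.
    - exact: Ck_powR.
    - exact: Ck_affine.
  by apply: (@Ck_comp _ U setT) => //; [exact: Ck_plateau|exact: Ck_affine].
apply: (@Ck_ext _ V k (fun=> 0)) => //; last exact: Ck_cst.
move=> t Vt; have [h _] : plateau N (- t) = 0 /\ dplateau N (- t) = 0.
  by apply: plateau_left; move: Vt; rewrite /V/=; lra.
by rewrite /profile negE h mulr0.
Qed.

Lemma profile_supp N t : profile N t != 0 -> - 2 ^+ N.+1 <= t <= -1.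
Proof.
apply: contraR; rewrite negb_and -!ltNge /profile negE => /orP[h|h].
  by have [-> _] := @plateau_right N (- t) ltac:(lra); rewrite mulr0.
by have [-> _] := @plateau_left N (- t) ltac:(lra); rewrite mulr0.
Qed.

(** Factoring out y^(kap-1) leaves kap h + y h' for the plateau h, and this is kap wherever h is
    1. *)
Lemma derive1_profile N t : t < 0 -> derive1 (profile N) t =
  - ((- t) `^ (kap - 1) * (kap * plateau N (- t) - t * dplateau N (- t))).
Proof.
move=> t0; apply: derive1_eq.
have dn := is_derive_fD (is_derive_fM (is_derive_fcst (-1) t) (is_derive_fid t))
  (is_derive_fcst 0 t).
have y0 : 0 < -1 * t + 0 by rewrite negE; lra.
have d1 := @is_derive_fpowR R (fun t => -1 * t + 0) t _ kap y0 dn.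
have d2 := @is_derive_fcomp R (plateau N) (fun t => -1 * t + 0) t _ _
  (is_derive_plateau N _) dn.
apply: (is_derive_eq (is_derive_fM d1 d2)); rewrite negE.
have -> : (- t) `^ kap = (- t) `^ (kap - 1) * - t.
  rewrite -{3}[- t]powRr1; last by lra.
  by rewrite -powRD ?subrK//; apply/implyP => _; rewrite gt_eqF//; lra.
by ring.
Qed.

Lemma derive1_profile0 N t : -1 < t -> derive1 (profile N) t = 0.
Proof.
move=> t1; apply: derive1_eq; apply: near_eq_is_derive (is_derive_fcst 0 t).
near=> s; have s1 : -1 < s by near: s; exact: lt_nbhsr.
apply/esym/eqP; apply: contraT => /profile_supp /andP[_ h]; lra.
Unshelve. all: by end_near. Qed.

Definition family N (j : 'I_n) : R -> R := if j == i0 then profile N else bump.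

Definition cross z : R := \prod_(j < n | j != i0) bump (coor j z).

Let bump_le1 t : bump t <= 1.
Proof.
have f1 s : flat 0 s <= 1 :> R.
  rewrite /flat; case: ifP => // s0; rewrite expr0 mul1r -expR0 ler_expR oppr_le0.
  by rewrite invr_ge0 ltW.
by rewrite mulr_ile1 ?flat_ge0.
Qed.

Lemma cross_ge0 z : 0 <= cross z.
Proof. by apply: prodr_ge0 => j _; exact: bump_ge0. Qed.

Lemma cross_le1 z : cross z <= 1.
Proof. by apply: prodr_ile1 => j _; rewrite bump_ge0 bump_le1. Qed.

Lemma continuous_cross : continuous cross.
Proof.
move=> z; rewrite /cross.
rewrite (_ : (fun x : Rn R n => \prod_(j < n | j != i0) bump (coor j x)) =
  (fun x => \prod_(j <- [seq j <- index_enum 'I_n | j != i0]) bump (coor j x))); last first.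
  by apply/funext => x; rewrite big_filter.
apply: (@cvg_bigprod _ _ _ (nbhs z)) => j.
have cj : coor j y @[y --> z] --> coor j z by exact: coord_continuous.
have cb : continuous (@bump R) by apply: smooth1_continuous => k; exact: Ck_bump.
exact: (cvg_comp _ _ cj (cb (coor j z))).
Qed.

Lemma tens_family N z : tens (family N) z = profile N (coor i0 z) * cross z.
Proof.
rewrite /tens (bigD1 i0)//= {1}/family eqxx; congr (_ * _).
by apply: eq_bigr => j /negbTE ji; rewrite /family ji.
Qed.

Lemma dtens_family N z : dtens (family N) i0 z = derive1 (profile N) (coor i0 z) * cross z.
Proof.
rewrite /dtens /tens (bigD1 i0)//= eqxx {1}/family eqxx; congr (_ * _).
by apply: eq_bigr => j /negbTE ji; rewrite /family ji.
Qed.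

(** The density of cross^p dz / y on the slab between y = a and y = b, where y = - z_i0. *)
Definition shell (a b : R) z : R :=
  cross z `^ p * (- coor i0 z) `^ (-1) * \1_[set z : Rn R n | a <= - coor i0 z < b] z.

Let mcoor : measurable_fun setT (@coor R n i0). Proof. exact: measurable_coor. Qed.

Let mopp : measurable_fun setT (fun z => - coor i0 z).
Proof. by apply: measurableT_comp => //; exact: oppr_measurable. Qed.

Lemma measurable_shell a b : measurable_fun setT (shell a b).
Proof.
apply: measurable_funM.
  apply: measurable_funM; apply: (measurableT_comp (measurable_powR _)) => //.
  exact: continuous_measurable_Rn continuous_cross.
apply: measurable_indic.
rewrite (_ : [set _ | _] = setT `&` (fun z => - coor i0 z) @^-1` `[a, b[).
  exact: mopp.
by rewrite setTI; apply/seteqP; split => z /=; rewrite in_itv.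
Qed.

Lemma shell_in a b z : a <= - coor i0 z < b ->
  shell a b z = cross z `^ p * (- coor i0 z) `^ (-1).
Proof. by move=> h; rewrite /shell indicE mem_set ?mulr1. Qed.

Lemma shell_out a b z : ~~ (a <= - coor i0 z < b) -> shell a b z = 0.
Proof. by move=> h; rewrite /shell indicE memNset ?mulr0//=; exact/negP. Qed.

Lemma shell_ge0 a b z : 0 <= shell a b z.
Proof.
have [h|h] := boolP (a <= - coor i0 z < b); last by rewrite shell_out.
by rewrite shell_in// mulr_ge0 ?powR_ge0.
Qed.

Lemma integrable_shell a b : 1 <= a -> mu.-integrable setT (EFin \o shell a b).
Proof.
move=> a1.
apply: (@bounded_support_integrable _ _ _ (Num.max 1 b) 1) => //.
- exact: measurable_shell.
- move=> z; rewrite ger0_norm ?shell_ge0//.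
  have [h|h] := boolP (a <= - coor i0 z < b); last by rewrite shell_out.
  rewrite shell_in// mulr_ile1 ?powR_ge0//.
    have E1 : 1 `^ p = 1 :> R by rewrite powR1.
    rewrite -[leRHS]E1; apply: ge0_ler_powR; rewrite ?nnegrE ?cross_ge0 ?(ltW pp)//.
    exact: cross_le1.
  case/andP: h => h _; rewrite powR_inv1; last by lra.
  by rewrite invf_le1; lra.
- move=> z; apply: contraTeq => hz; rewrite -leNgt.
  have [h|h] := boolP (a <= - coor i0 z < b); last by rewrite shell_out ?eqxx in hz.
  rewrite shell_in// in hz.
  apply: mx_norm_le; first by rewrite le_max ler01.
  move=> j; have [->|ji] := eqVneq j i0.
    case/andP: h => h1 h2; rewrite ler0_norm; last by lra.
    by rewrite le_max (ltW h2) orbT.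
  rewrite le_max; apply/orP; left; apply: bump_supp.
  apply: contra_neq hz => bz; rewrite /cross (bigD1 j)//= bz mul0r powR0 ?mul0r//.
  exact: lt0r_neq0.
Qed.

Lemma shell_split a b c z : a <= b -> b <= c ->
  shell a c z = shell a b z + shell b c z.
Proof.
move=> ab bc; have [h|h] := boolP (a <= - coor i0 z < b).
  rewrite (shell_in h) (@shell_out b c) ?addr0 ?shell_in//; move: h => /andP[h1 h2].
    by rewrite h1/=; lra.
  by rewrite negb_and -ltNge h2.
rewrite (shell_out h) add0r.
have [h'|h'] := boolP (b <= - coor i0 z < c).
  rewrite !shell_in//; move: h' => /andP[h1 h2]; rewrite h2 andbT; lra.
rewrite !shell_out//; apply/negP => /andP[h1 h2].
have [h3|h3] := ltP (- coor i0 z) b; first by rewrite h1 h3 in h.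
by rewrite h3 h2 in h'.
Qed.

(** Doubling the i0-coordinate has Jacobian 2, which cancels the 1/2 coming from 1/y. *)
Lemma Rintegral_shell_scale a b : 1 <= a ->
  (\int[mu]_z shell (2 * a) (2 * b) z)%R = (\int[mu]_z shell a b z)%R.
Proof.
move=> a1; pose d (j : 'I_n) : R := if j == i0 then 2 else 1.
have d0 j : 0 < d j by rewrite /d; case: ifP.
have i2 : mu.-integrable setT (EFin \o shell (2 * a) (2 * b)).
  by apply: integrable_shell; lra.
rewrite (@Rintegral_affine R n mu (fun=> 0) d _ hmu d0 i2).
have -> : \prod_(i < n) d i = 2.
  by rewrite (bigD1 i0)//= {1}/d eqxx big1 ?mulr1// => j /negbTE ji; rewrite /d ji.
have E z : shell (2 * a) (2 * b) (affine (fun=> 0) d z) = 2^-1 * shell a b z.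
  have Ec : cross (affine (fun=> 0) d z) = cross z.
    apply: eq_bigr => j /negbTE ji; rewrite /coor mxE /d ji add0r mul1r.
    by [].
  have Ei : coor i0 (affine (fun=> 0) d z) = 2 * coor i0 z.
    by rewrite /coor mxE /d eqxx add0r.
  have [h|h] := boolP (a <= - coor i0 z < b).
    rewrite !shell_in// ?Ec ?Ei; last by move: h => /andP[h1 h2]; apply/andP; split; lra.
    have y0 : 0 < - coor i0 z by move: h => /andP[h1 _]; lra.
    rewrite !powR_inv1 ?(ltW y0)//; last by lra.
    rewrite -mulrN invfM; ring.
  rewrite !shell_out ?mulr0// Ei; move: h; rewrite !negb_and -!ltNge -!leNgt.
  by move=> /orP[h|h]; apply/orP; [left|right]; lra.
under eq_Rintegral do rewrite E.
rewrite RintegralZl//; last exact: integrable_shell.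
by rewrite mulrA mulfV ?mul1r.
Qed.

Lemma Rintegral_shell_pow k :
  (\int[mu]_z shell (2 ^+ k) (2 ^+ k.+1) z)%R = (\int[mu]_z shell 1 2 z)%R.
Proof.
elim: k => [|k IH]; first by rewrite expr0 expr1.
by rewrite !(exprS _ k.+1) (exprS _ k) Rintegral_shell_scale ?IH -?exprS// exprn_ege1// ler1n.
Qed.

Lemma Rintegral_shell_total N :
  (\int[mu]_z shell 2 (2 ^+ N.+1) z)%R = N%:R * (\int[mu]_z shell 1 2 z)%R.
Proof.
elim: N => [|N IH].
  rewrite expr1 mul0r; under eq_Rintegral => z _.
    rewrite shell_out; last by apply/negP => /andP[h1 h2]; lra.
    over.
  by rewrite Rintegral_cst// mul0r.
have N2 : 2 <= 2 ^+ N.+1 :> R by rewrite exprS ler_peMr// exprn_ege1// ler1n.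
under eq_Rintegral => z _.
  rewrite (@shell_split _ (2 ^+ N.+1)); [|exact: N2|]; last first.
    by rewrite ler_weXn2l// ler1n.
  over.
rewrite RintegralD//; [|by apply: integrable_shell; lra|by apply: integrable_shell; lra].
by rewrite IH Rintegral_shell_pow -[N.+1%:R]natr1 mulrDl mul1r.
Qed.

Lemma Rintegral_shell_gt0 : 0 < (\int[mu]_z shell 1 2 z)%R.
Proof.
pose z0 : Rn R n := \row_j (if j == i0 then - (3 / 2) else 0).
pose A := [set z | shell 1 2 z != 0].
have zA : nbhs z0 A.
  have cj j : coor j y @[y --> z0] --> coor j z0 by exact: coord_continuous.
  have zi : coor i0 z0 = - (3 / 2) by rewrite /coor mxE eqxx.
  have zj j : `|coor j z0| < (if j == i0 then 2 else 1).
    by rewrite /coor mxE; case: ifP => _; rewrite ?normrN ger0_norm//; lra.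
  have a1 : \forall y \near z0, - 2 < coor i0 y.
    by apply: (cvgr_gt _ (cj i0)); rewrite zi; lra.
  have a2 : \forall y \near z0, coor i0 y < - 1.
    by apply: (cvgr_lt _ (cj i0)); rewrite zi; lra.
  have a3 j : \forall y \near z0, `|coor j y| < (if j == i0 then 2 else 1).
    have := zj j; rewrite ltr_norml => /andP[l1 l2].
    have b1 : \forall y \near z0, - (if j == i0 then 2 else 1) < coor j y.
      exact: (cvgr_gt _ (cj j)).
    have b2 : \forall y \near z0, coor j y < (if j == i0 then 2 else 1).
      exact: (cvgr_lt _ (cj j)).
    by near=> y; rewrite ltr_norml; apply/andP; split; near: y.
  near=> y.
  have y1 : - 2 < coor i0 y by near: y.
  have y2 : coor i0 y < - 1 by near: y.
  have y3 : forall j, `|coor j y| < (if j == i0 then 2 else 1).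
    by near: y; exact: filter_forall.
  rewrite /A/= shell_in; last by apply/andP; split; lra.
  rewrite mulf_neq0// gt_eqF// powR_gt0//; last by lra.
  by apply: prodr_gt0 => j ji; apply: bump_gt0; have := y3 j; rewrite (negbTE ji).
apply: (@Rintegral_gt0 _ _ _ _ (interior A) z0) => //.
- exact: integrable_shell.
- exact: shell_ge0.
- exact: open_interior.
- by move=> y /interior_subset.
Unshelve. all: by end_near. Qed.

(** The limit densities up to a common constant. With p kap = beta + p, both y^(p kap) y^(-beta-p-1)
    and y^(p (kap-1)) y^(-beta-1) equal y^(-1). *)
Definition dens_X N z := plateau N (- coor i0 z) `^ p * (cross z `^ p * (- coor i0 z) `^ (-1)).
Definition dens_Z N z := `|kap * plateau N (- coor i0 z) - coor i0 z * dplateau N (- coor i0 z)| `^ p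
  * (cross z `^ p * (- coor i0 z) `^ (-1)).

Lemma shell_le_X N z : shell 2 (2 ^+ N) z <= dens_X N z.
Proof.
have [h|h] := boolP (2 <= - coor i0 z < 2 ^+ N); last first.
  by rewrite shell_out// mulr_ge0 ?powR_ge0// mulr_ge0 ?powR_ge0.
rewrite shell_in// /dens_X; case/andP : h => h1 h2.
by have [-> _] := plateau_mid h1 (ltW h2); rewrite powR1 mul1r.
Qed.

(** Where the plateau is locally 0 or 1 the two densities agree up to |kap|^p; on the two transition
    shells |kap h + y h'| is at most |kap| + S, with S independent of N. *)
Lemma Z_le : exists2 M : R, 0 <= M & forall N z, (0 < N)%N ->
  dens_Z N z <= `|kap| `^ p * dens_X N z +
    M * (shell 1 2 z + shell (2 ^+ N) (2 ^+ N.+1) z).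
Proof.
have [S [S0 hS]] := dplateau_bounded.
exists ((`|kap| + S) `^ p); first exact: powR_ge0.
move=> N z N0; rewrite /dens_Z /dens_X; set y := - coor i0 z.
have -> : coor i0 z = - y by rewrite opprK.
rewrite mulNr opprK.
set W := cross z `^ p * y `^ (-1).
have W0 : 0 <= W by rewrite mulr_ge0 ?powR_ge0.
have M0 : 0 <= (`|kap| + S) `^ p by exact: powR_ge0.
have X0 : 0 <= `|kap| `^ p * (plateau N y `^ p * W) by rewrite !mulr_ge0 ?powR_ge0.
have sh0 : 0 <= (`|kap| + S) `^ p * (shell 1 2 z + shell (2 ^+ N) (2 ^+ N.+1) z).
  by rewrite mulr_ge0// addr_ge0 ?shell_ge0.
have zero : plateau N y = 0 /\ dplateau N y = 0 ->
    `|kap * plateau N y + y * dplateau N y| `^ p * W <=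
    `|kap| `^ p * (plateau N y `^ p * W) +
    (`|kap| + S) `^ p * (shell 1 2 z + shell (2 ^+ N) (2 ^+ N.+1) z).
  move=> [-> ->]; rewrite !mulr0 addr0 normr0 powR0 ?lt0r_neq0// !mul0r.
  by rewrite mulr0 add0r.
have trans : (1 <= y -> y < 2 \/ 2 ^+ N <= y -> y <= 2 ^+ N.+1 ->
    W <= shell 1 2 z + shell (2 ^+ N) (2 ^+ N.+1) z ->
    `|kap * plateau N y + y * dplateau N y| `^ p * W <=
    `|kap| `^ p * (plateau N y `^ p * W) +
    (`|kap| + S) `^ p * (shell 1 2 z + shell (2 ^+ N) (2 ^+ N.+1) z)).
  move=> y1 yc yN hW; apply: (@le_trans _ _ ((`|kap| + S) `^ p * W)); last first.
    by rewrite ler_wpDl//; exact: ler_wpM2l.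
  apply: ler_wpM2r => //; apply: ge0_ler_powR; rewrite ?nnegrE ?addr_ge0 ?(ltW pp)//.
  apply: le_trans (ler_normD _ _) _; apply: lerD; last exact: hS.
  rewrite normrM ler_piMr// ger0_norm ?plateau_ge0//; exact: plateau_le1.
have [y1|y1] := ltP y 1; first by apply: zero; apply: plateau_left; exact: ltW.
have [y2|y2] := ltP y 2.
  have N2 : 2 <= 2 ^+ N.+1 :> R by rewrite exprS ler_peMr// exprn_ege1// ler1n.
  apply: trans => //; [by left|lra|].
  by rewrite (@shell_in 1 2) ?y1// lerDl shell_ge0.
have [yN|yN] := leP (2 ^+ N.+1) y; first by apply: zero; exact: plateau_right.
have [yM|yM] := ltP y (2 ^+ N).
  have [-> ->] := plateau_mid y2 (ltW yM).
  by rewrite mulr0 addr0 mulr1 powR1 mul1r lerDl.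
apply: trans => //; [by right|exact: ltW|].
by rewrite (@shell_in (2 ^+ N)) ?yM// lerDr shell_ge0.
Qed.

(** If C exceeded |kap|^p by [del], the full shells would give del N a <= 2 M a for every N, where a
    > 0 is the mass of one shell. *)
Lemma plateau_sharp (C : R) :
  (forall N, (0 < N)%N -> [/\ mu.-integrable setT (EFin \o dens_X N),
     mu.-integrable setT (EFin \o dens_Z N) &
     C * (\int[mu]_z dens_X N z)%R <= (\int[mu]_z dens_Z N z)%R]) ->
  C <= `|kap| `^ p.
Proof.
move=> hC; rewrite leNgt; apply/negP => cC.
have [M M0 hM] := Z_le.
set a := (\int[mu]_z shell 1 2 z)%R; have a0 : 0 < a by exact: Rintegral_shell_gt0.
pose del := C - `|kap| `^ p; have del0 : 0 < del by rewrite subr_gt0.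
have key N : del * N%:R <= 2 * M.
  (* The index is shifted because the plateau [2, 2^(N+1)] consists of exactly N dyadic shells. *)
  have [iX iZ h] := hC N.+1 isT.
  have N1 : 1 <= 2 ^+ N.+1 :> R by rewrite exprn_ege1// ler1n.
  have is1 : mu.-integrable setT (EFin \o shell 1 2) by exact: integrable_shell.
  have is2 : mu.-integrable setT (EFin \o shell (2 ^+ N.+1) (2 ^+ N.+2)).
    exact: integrable_shell.
  have is12 : mu.-integrable setT (EFin \o (fun z => shell 1 2 z + shell (2 ^+ N.+1) (2 ^+ N.+2) z)).
    by have := integrableD measurableT is1 is2.
  have isM : mu.-integrable setT (EFin \o (fun z => M * (shell 1 2 z + shell (2 ^+ N.+1) (2 ^+ N.+2) z))).
    by have := integrableZl measurableT M is12.
  have iX' : mu.-integrable setT (EFin \o (fun z => `|kap| `^ p * dens_X N.+1 z)).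
    by have := integrableZl measurableT (`|kap| `^ p) iX.
  have i12 : mu.-integrable setT (EFin \o (fun z => `|kap| `^ p * dens_X N.+1 z +
      M * (shell 1 2 z + shell (2 ^+ N.+1) (2 ^+ N.+2) z))).
    by have := integrableD measurableT iX' isM.
  have h1 : (\int[mu]_z dens_Z N.+1 z)%R <= `|kap| `^ p * (\int[mu]_z dens_X N.+1 z)%R + M * (a + a).
    apply: le_trans (le_Rintegral measurableT iZ i12 _) _.
      by move=> z _; exact: hM.
    rewrite RintegralD// RintegralZl// RintegralZl// RintegralD//.
    by rewrite Rintegral_shell_pow.
  have h2 : N%:R * a <= (\int[mu]_z dens_X N.+1 z)%R.
    rewrite -Rintegral_shell_total; apply: le_Rintegral => //.
      by apply: integrable_shell; lra.
    by move=> z _; exact: shell_le_X.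
  have h3 : del * (\int[mu]_z dens_X N.+1 z)%R <= M * (a + a).
    by rewrite /del mulrBl lerBlDl; exact: le_trans h h1.
  have h4 : del * (N%:R * a) <= M * (a + a).
    by apply: le_trans h3; rewrite ler_pM2l.
  by rewrite -(ler_pM2r a0) -mulrA; apply: le_trans h4 _; rewrite -mulr2n mulrnAr -mulrnAl mulr_natl.
have := key (Num.truncn (2 * M / del)).+1.
have := truncnS_gt (2 * M / del); rewrite ltr_pdivrMr// [_ * del]mulrC => h1 h2.
by have := lt_le_trans h1 h2; rewrite ltxx.
Qed.

End Plateau.

(** * Sharpness of the constant and conclusion *)

Lemma hardy_constant_sharp (R : realType) (n : nat) (nu : 'I_n -> R) (qn : Rn R n -> R)
    (mu : {measure set (Rn R n) -> \bar R}) (R0 p alpha beta C : R) :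
  (0 < n)%N -> (forall i, 0 < nu i) -> is_lebesgue_measure mu ->
  quasi_norm nu qn -> 0 < R0 -> 1 < p ->
  (forall f, C0inf_punct qn R0 f ->
     C * I_f qn mu R0 p alpha beta f <= I_Rf nu qn mu R0 p alpha beta f) ->
  C <= `|(beta + p) / p| `^ p.
Proof.
move=> n0 hnu hmu hq R00 p1 hC.
have pp : 0 < p by lra.
pose i0 := Ordinal n0; pose kap := (beta + p) / p.
apply: (@plateau_sharp R n mu i0 p kap hmu p1) => N _.
have sf j : smooth1 (family i0 kap N j).
  rewrite /family; case: ifP => _; first exact: smooth1_profile.
  by move=> k; exact: Ck_bump.
have Y1 : 1 <= 2 ^+ N.+1 :> R by rewrite exprn_ege1// ler1n.
have s0 t : family i0 kap N i0 t != 0 -> - 2 ^+ N.+1 <= t <= -1.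
  by rewrite /family eqxx; exact: profile_supp.
have sj j t : j != i0 -> family i0 kap N j t != 0 -> -1 <= t <= 1.
  by move=> /negbTE ji; rewrite /family ji => /bump_supp; rewrite ler_norml.
have [iB iA] := blowup_inequality hnu hmu hq R00 p1 sf Y1 s0 sj hC.
pose N0 := nu i0; have N00 : 0 < N0 by exact: hnu.
(* The constant common to both limit densities: N0 enters [lim_B] through (y / N0)^(-beta-p-1) and
   [lim_A] through N0^p (y / N0)^(-beta-1), with the same total power. *)
pose c1 : R := R0 `^ (- (alpha + p)) * N0 `^ (beta + p + 1).
have c10 : 0 < c1 by rewrite mulr_gt0// powR_gt0.
have side (x : R) (b : bool) : 0 < x -> b ==> (x != 0).
  by move=> x0; apply/implyP => _; rewrite gt_eqF.
have EN b : N0^-1 `^ (- b) = N0 `^ b.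
  by rewrite -powR_inv1 ?(ltW N00)// -powRrM mulN1r opprK.
have EB z : lim_B nu R0 p alpha beta i0 (family i0 kap N) z = c1 * dens_X i0 p N z.
  rewrite /lim_B /dens_X tens_family -/N0.
  have [z0|z0] := leP 0 (coor i0 z).
    have -> : profile kap N (coor i0 z) = 0.
      by apply/eqP; apply: contraT => /profile_supp /andP[_ h]; lra.
    have [-> _] := @plateau_left R N (- coor i0 z) ltac:(lra).
    by rewrite mul0r normr0 powR0 ?gt_eqF// !mul0r mulr0.
  rewrite /profile mulN1r addr0; move: (coor i0 z) z0 => t t0.
  have y0 : 0 < - t by lra.
  move: (- t) y0 => y y0.
  move: (plateau N y) (plateau_ge0 N y) (cross i0 z) (cross_ge0 i0 z) => h h0 b b0.
  have yk : 0 <= y `^ kap by exact: powR_ge0.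
  rewrite ger0_norm; last by rewrite !mulr_ge0.
  rewrite !(powRM _ _ b0) ?mulr_ge0// (powRM _ yk h0).
  rewrite (powRM _ (ltW y0)) ?invr_ge0 ?(ltW N00)// EN.
  have -> : y `^ (-1) = (y `^ kap) `^ p * y `^ (- (beta + p + 1)).
    rewrite -powRrM -powRD ?side//; congr (_ `^ _); rewrite /kap; field.
    by rewrite gt_eqF.
  by rewrite /c1; ring.
have EA z : lim_A nu R0 p alpha beta i0 (family i0 kap N) z = c1 * dens_Z i0 p kap N z.
  rewrite /lim_A /dens_Z dtens_family -/N0.
  have [z0|z0] := leP 0 (coor i0 z).
    rewrite derive1_profile0; last by lra.
    have [-> ->] := @plateau_left R N (- coor i0 z) ltac:(lra).
    by rewrite mul0r !mulr0 subr0 normr0 powR0 ?gt_eqF// !mul0r mulr0.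
  rewrite derive1_profile//; move: (coor i0 z) z0 => t t0.
  have y0 : 0 < - t by lra.
  rewrite -[in X in _ - X * _](opprK t); move: (- t) y0 => y y0.
  move: (kap * plateau N y - - y * dplateau N y) => E.
  move: (cross i0 z) (cross_ge0 i0 z) => b b0.
  have -> : N0 * (- (y `^ (kap - 1) * E) * b) = - (N0 * y `^ (kap - 1) * b * E) by ring.
  have yk : 0 <= y `^ (kap - 1) by exact: powR_ge0.
  have Nyk : 0 <= N0 * y `^ (kap - 1) by rewrite mulr_ge0// ltW.
  rewrite normrN normrM (ger0_norm (mulr_ge0 Nyk b0)).
  rewrite (powRM _ (mulr_ge0 Nyk b0) (normr_ge0 E)) (powRM _ Nyk b0) (powRM _ (ltW N00) yk).
  rewrite (powRM _ (ltW y0)) ?invr_ge0 ?(ltW N00)// EN.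
  have -> : y `^ (-1) = (y `^ (kap - 1)) `^ p * y `^ (- (beta + 1)).
    rewrite -powRrM -powRD ?side//; congr (_ `^ _); rewrite /kap; field.
    by rewrite gt_eqF.
  rewrite /c1 (_ : beta + p + 1 = p + (beta + 1)); last by ring.
  have -> : N0 `^ (p + (beta + 1)) = N0 `^ p * N0 `^ (beta + 1) by rewrite powRD ?side.
  by ring.
have iX : mu.-integrable setT (EFin \o dens_X i0 p N).
  have := integrableZl measurableT c1^-1 iB.
  apply: eq_integrable => // z _ /=.
  by rewrite EB -EFinM mulrA mulVf ?mul1r// gt_eqF.
have iZ : mu.-integrable setT (EFin \o dens_Z i0 p kap N).
  have := integrableZl measurableT c1^-1 iA.
  apply: eq_integrable => // z _ /=.
  by rewrite EA -EFinM mulrA mulVf ?mul1r// gt_eqF.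
move=> h; split => //; move: h.
under eq_Rintegral do rewrite EB.
under [X in _ <= X -> _]eq_Rintegral do rewrite EA.
by rewrite !RintegralZl// mulrCA ler_pM2l.
Qed.

Theorem theorem4p2 (R : realType) (n : nat) (nu : 'I_n -> R)
    (mul : Rn R n -> Rn R n -> Rn R n)
    (mu : {measure set (Rn R n) -> \bar R})
    (qn : Rn R n -> R) (R0 p alpha beta : R) :
  (0 < n)%N ->
  homogeneous_group nu mul ->
  is_lebesgue_measure mu ->
  quasi_norm nu qn ->
  0 < R0 -> 1 < p ->
  let Q := hdim nu in
  let c := `|(beta + p) / p| `^ p in
  let I1 := I_f qn mu R0 p alpha beta in
  let I2 := I_Rf nu qn mu R0 p alpha beta in
  let I3 := I_f' qn mu R0 p alpha beta in
  let ICp := I_Cp nu qn mu R0 p alpha beta in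
  let adm := C0inf_punct qn R0 in
  (* (i) *)
  (0 <= (Q - alpha - p) * (beta + p) ->
     (forall f, adm f -> c * I1 f <= I2 f) /\
     (beta != - p ->
        forall C : R, (forall f, adm f -> C * I1 f <= I2 f) -> C <= c)) /\
  (* (ii) *)
  (forall f, adm f ->
     c * I1 f = I2 f
       - (Q - alpha - p) * ((beta + p) / p) * `|(beta + p) / p| `^ (p - 2) * I3 f
       - ICp f) /\
  (* (iii) *)
  (Q = alpha + p -> 2 <= p ->
     forall f, adm f ->
       (ICp f = 0 ->
          (exists phi : Rn R n -> R[i],
             forall x : Rn R n, qball qn R0 x -> x != 0 ->
               f x = real_complex R (Lw qn R0 x `^ ((beta + p) / p)) * phi (dil nu (qn x)^-1 x))
          /\ f = (fun _ => 0)) /\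
       (f <> (fun _ => 0) -> c * I1 f < I2 f)).
Proof.
move=> n0 [[hnu _ _ _ _] _] hmu hq R00 p1 Q c I1 I2 I3 ICp adm; split; [|split].
- move=> hQ; split; last first.
    by move=> _ C hC; exact: (hardy_constant_sharp n0 hnu hmu hq R00 p1 hC).
  move=> f [su [sv [K [cK KR fK]]]].
  exact: (hardy_inequality hmu hq R00 p1 su sv cK KR fK hQ).
- move=> f [su [sv [K [cK KR fK]]]].
  exact: (hardy_identity alpha beta hmu hq R00 p1 su sv cK KR fK).
- move=> hQ _ f [su [sv [K [cK KR fK]]]].
  have f0 : ICp f = 0 -> f = (fun _ => 0).
    exact: (ICp_eq0 hmu hq R00 p1 su sv cK KR fK).
  split=> [/f0 ->|fn0].
    (* f is already known to vanish, so the angular profile is 0. The form L^kap phi underlies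
       [ray_zero], where f L^(-kap) is constant along rays. *)
    by split=> //; exists (fun _ => 0) => x _ _; rewrite mulr0.
  (* For Q = alpha + p the middle term of the identity drops out, and the gap in the inequality is
     exactly the remainder. *)
  have -> : c * I1 f = I2 f - ICp f.
    rewrite /c /I1 (hardy_identity alpha beta hmu hq R00 p1 su sv cK KR fK).
    rewrite -/Q hQ (_ : alpha + p - alpha - p = 0); last by ring.
    by rewrite !mul0r subr0.
  rewrite gtrDl oppr_lt0 lt_neqAle ICp_ge0// andbT eq_sym.
  by apply/eqP => /f0.
Qed.
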